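(* Let $\phi=T_1+\cdots+T_s \in \mathbb{Z}[T_1,\ldots,T_s]$ and, for a prime $p$, let $D_{\phi,p}$ be the kernel function of $\phi$ in characteristic $p$. Then for all $\mathbf t\in\mathbb R^s$ and $r\in\mathbb R$ the limit $$D_{\phi,\infty}(\mathbf{t},r)=\lim_{p\to\infty}D_{\phi,p}(\mathbf{t},r)$$ exists, and $$\frac{\partial}{\partial r^\pm}D_{\phi,p}(\mathbf{t},r)\to \frac{\partial}{\partial r^\pm}D_{\phi,\infty}(\mathbf{t},r)\qquad (p\to\infty)$$ for any $\mathbf{t},r$.
   Context: For a field $k$ of characteristic $p$ (the choice, e.g. $k=\mathbb F_p$, does not matter) and $q=p^e$, $D_{\phi,p}(\mathbf t,r)=\lim_{q\to\infty}q^{-s}\,l\big(k[T_1,\ldots,T_s]/(T_1^{\lceil t_1q\rceil},\ldots,T_s^{\lceil t_sq\rceil},\phi^{\lceil rq\rceil})\big)$, where nonpositive powers generate the unit ideal. $\frac{\partial}{\partial r^{+}}$ and $\frac{\partial}{\partial r^{-}}$ denote right and left partial derivatives. *)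

(* Defs.v *)
From HB Require Import structures.
From mathcomp Require Import all_boot all_order all_algebra.
From mathcomp Require Import all_classical all_reals all_analysis.
(* mpoly's notations clash with those of mathcomp-analysis. *)
From mathcomp Require Import -(notations) mpoly.

Set Implicit Arguments.
Unset Strict Implicit.
Unset Printing Implicit Defensive.

Import Order.TTheory GRing.Theory Num.Theory.
Import numFieldNormedType.Exports.

Local Open Scope classical_set_scope.
Local Open Scope ring_scope.

(* The unit ideal is allowed, unlike in mathcomp's [idealr_closed]. *)
Definition is_ideal (A : comNzRingType) (I : set A) : Prop :=
  [/\ I 0, forall x y, I x -> I y -> I (x + y) & forall a x, I x -> I (a * x)].

Definition ideal_gen (A : comNzRingType) (G : set A) : set A :=
  smallest (@is_ideal A) G.

(* J 0 < J 1 < ... < J n, all containing I; for I an ideal these are the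
   preimages in A of the strict chains of submodules of A / I. *)
Definition ideal_chain (A : comNzRingType) (I : set A) (n : nat)
    (J : nat -> set A) : Prop :=
  (forall i, (i <= n)%N -> is_ideal (J i) /\ I `<=` J i) /\
  (forall i, (i < n)%N -> J i `<` J i.+1).

Definition quotient_length (R : realType) (A : comNzRingType) (I : set A) :
    \bar R :=
  ereal_sup [set n%:R%:E | n in [set n : nat | exists J, ideal_chain I n J]].

(* Nonpositive powers generate the unit ideal. *)
Definition ideal_pow (A : comNzRingType) (x : A) (z : int) : A :=
  match z with Posz n => x ^+ n | Negz _ => 1 end.

Section KernelFunction.
Context {R : realType} (k : fieldType) (p s : nat).
Variable phi : mpoly s int.

Definition mvar (i : 'I_s) : mpoly s k :=
  mpolyX k (mnm1 i).

Definition kernel_ideal (t : 'rV[R]_s) (r : R) (q : nat) :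
    set (mpoly s k) :=
  ideal_gen
    ([set ideal_pow (mvar i) (Num.ceil (t ord0 i * q%:R)) | i in [set: 'I_s]]
     `|` [set ideal_pow (map_mpoly (intr : int -> k) phi)
                        (Num.ceil (r * q%:R))]).

Definition kernel_fun (t : 'rV[R]_s) (r : R) : R :=
  lim ((fun e : nat =>
          fine (quotient_length R (kernel_ideal t r (p ^ e)))
          / (p ^ e)%:R ^+ s) @ \oo).

End KernelFunction.

Definition prime_infty : set_system nat :=
  within [set p : nat | prime p] \oo.

Definition kernel_fun_infty {R : realType} (k : nat -> fieldType) (s : nat)
    (phi : mpoly s int) (t : 'rV[R]_s) (r : R) : R :=
  lim (kernel_fun (k p) p phi t r @[p --> prime_infty]).

Definition diff_quotient {R : realType} (f : R -> R) (r h : R) : R :=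
  h^-1 * (f (r + h) - f r).

Definition right_derivable {R : realType} (f : R -> R) (r : R) : Prop :=
  cvg (diff_quotient f r h @[h --> 0^'+]).

Definition right_derive {R : realType} (f : R -> R) (r : R) : R :=
  lim (diff_quotient f r h @[h --> 0^'+]).

Definition left_derivable {R : realType} (f : R -> R) (r : R) : Prop :=
  cvg (diff_quotient f r h @[h --> 0^'-]).

Definition left_derive {R : realType} (f : R -> R) (r : R) : R :=
  lim (diff_quotient f r h @[h --> 0^'-]).

Definition sum_vars (s : nat) : mpoly s int :=
  \sum_(i < s) mpolyX int (mnm1 i).

(* Main.v *)
Require Import Defs.
From HB Require Import structures.
From mathcomp Require Import all_boot all_order all_algebra.
From mathcomp Require Import all_classical all_reals all_analysis.
From mathcomp Require Import -(notations) mpoly.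
From mathcomp Require Import zify ring lra.

Set Implicit Arguments.
Unset Strict Implicit.
Unset Printing Implicit Defensive.

Import Order.TTheory GRing.Theory Num.Theory.
Import numFieldNormedType.Exports.

Local Open Scope classical_set_scope.
Local Open Scope ring_scope.

(** Write [V_a] for [k[T]/(T^a)]. The length of
    [k[T_1, .., T_s]/(T_1^a_1, .., T_s^a_s, (T_1 + .. + T_s)^a_0)] is the number
    [L_p(a_0, .., a_s)] of Jordan blocks of the operator [T_0 + .. + T_s] on
    [V_(a_0) (x) .. (x) V_(a_s)] ([quotient_lengthE], [num_blocks_cons]), so
    it is symmetric in all [s + 1] exponents. Everything is deduced from a few
    tensor product decompositions in characteristic [p].

    _Shape of the counts._ Tensoring with [V_2] turns [a] into [a - 1] and
    [a + 1] unless [p] divides [a], so in two of its exponents the count solves a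
    discrete wave equation away from the multiples of [p]; when one of the two
    is a multiple of [p], it is affine in the other between multiples of [p]. On
    each cell of side [p] its deviation from bilinear interpolation is therefore
    a solution with zero boundary values ([cell_wave_wave]), which d'Alembert's
    formula recovers from its first row. Decomposing [V_(p+1) (x) V_(pm)] and
    [V_(p+1) (x) V_(pm+1)] expresses the first rows, cell by cell, through
    counts with one exponent less ([cell_wave_rec1], [cell_wave_recS]), by
    recursions whose form does not depend on [p].

    _Large [p]._ The increments of [L_p] in one exponent are numbers of Jordan
    blocks and hence monotone; together with d'Alembert's formula this squeezes
    them between two explicit expressions ([slope_sandwich]) that differ by a
    shift of one. So, if the counts with fewer exponents have a scaling limit,
    the rescaled increments converge at scaled points that stay in one cell
    ([cvg_slope]), and Riemann sums of monotone functions give the scaling limit of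
    the counts ([has_density_all]).

    _The limit over powers of [p]._ Since [L_p(p a) = p^s L_p(a)], the kernel
    function at [p] lies between the rescaled counts at [floor (t p)] and
    [ceil (t p)]; hence it converges as [p] grows. In the same way its secants
    in [r] lie between rescaled increments of [L_p] at the scale [p]
    ([kdensity_secant_le], [kdensity_secant_ge]). When [p] tends to infinity
    and simultaneously the increment [h] of [r] tends to zero from one side,
    both bounds stay in one cell and converge to the same value
    ([joint_right_limit], [joint_left_limit]). So the difference quotients
    have a joint limit in [(p, h)], both iterated limits equal it
    ([iterated_limit]), and that is the assertion. For [s = 1] the argument
    has no second exponent to work with, but then the kernel function is the
    minimum of [t] and [r] for nonnegative [t] and [r] and every [p]
    ([kdensity_pair]). *)

(** * Kernels of Jordan operators *)

Section Jordan.
Variable K : fieldType.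
Implicit Types V W : vectType K.

Definition nullity V W (f : 'Hom(V, W)) : nat := \dim (lker f).

(** The change of variables [g] has to be bijective on the kernels only. *)
Lemma nullity_transfer V V' W W' (f : 'Hom(V, W)) (f' : 'Hom(V', W'))
    (g : 'Hom(V, V')) :
    (forall v, f v = 0 -> g v = 0 -> v = 0) ->
    (forall v, f v = 0 -> f' (g v) = 0) ->
    (forall v', f' v' = 0 -> exists2 v, f v = 0 & g v = v') ->
  nullity f = nullity f'.
Proof.
move=> ginj gker gsurj; rewrite /nullity.
have -> : lker f' = (g @: lker f)%VS.
  apply/vspaceP=> w; rewrite memv_ker; apply/eqP/memv_imgP.
    by move=> /gsurj[v fv gv]; exists v; rewrite ?memv_ker ?fv ?gv.
  by case=> v; rewrite memv_ker => /eqP /gker fgv ->.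
rewrite limg_dim_eq //; apply/eqP; rewrite -subv0; apply/subvP => v.
by rewrite memv_cap !memv_ker => /andP[/eqP fv /eqP gv]; rewrite (ginj v) ?mem0v.
Qed.

Definition lpow V (N : 'End(V)) n : 'End(V) := iter n (comp_lfun N) \1%VF.
Arguments lpow : simpl never.

Lemma lpowE V (N : 'End(V)) n v : lpow N n v = iter n N v.
Proof.
by elim: n => [|n IH]; rewrite /lpow /= ?id_lfunE // comp_lfunE -/(lpow N n) IH.
Qed.

Lemma lpowD V (N : 'End(V)) m n v : lpow N (m + n) v = lpow N m (lpow N n v).
Proof. by rewrite !lpowE iterD. Qed.

Lemma lpowS V (N : 'End(V)) n v : lpow N n.+1 v = N (lpow N n v).
Proof. by rewrite !lpowE. Qed.

Lemma lpowSr V (N : 'End(V)) n v : lpow N n.+1 v = lpow N n (N v).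
Proof. by rewrite !lpowE iterSr. Qed.

Lemma lpow0 V (N : 'End(V)) v : lpow N 0 v = v.
Proof. by rewrite lpowE. Qed.

Lemma lpow_lpow V (N : 'End(V)) m n v : lpow (lpow N m) n v = lpow N (m * n) v.
Proof.
by elim: n => [|n IH]; rewrite ?muln0 ?lpow0 // lpowS IH mulnS lpowD.
Qed.

(** Elements of [V^a] are handled as functions on [nat] that vanish from [a] on;
    this makes the Jordan shift below a total operation without boundary
    case. *)
Definition coord V a (u : {ffun 'I_a -> V}) (n : nat) : V :=
  if insub n is Some i then u i else 0.

Definition truncate V a (x : nat -> V) : {ffun 'I_a -> V} := [ffun i => x (val i)].

Lemma coord_ord V a (u : {ffun 'I_a -> V}) (i : 'I_a) : coord u i = u i.
Proof. by rewrite /coord insubT //= => h; congr (u _); apply/val_inj. Qed.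

Lemma coord_ge V a (u : {ffun 'I_a -> V}) n : (a <= n)%N -> coord u n = 0.
Proof. by move=> h; rewrite /coord insubF // ltnNge h. Qed.

Lemma coord_truncate V a (x : nat -> V) n :
  coord (truncate a x) n = if (n < a)%N then x n else 0.
Proof.
case: ltnP => h; last exact: coord_ge.
by rewrite -[n]/(val (Ordinal h)) coord_ord ffunE.
Qed.

Lemma coord_inj V a (u v : {ffun 'I_a -> V}) : coord u =1 coord v -> u = v.
Proof. by move=> h; apply/ffunP => i; rewrite -!coord_ord h. Qed.

Lemma coord0 V a n : coord (0 : {ffun 'I_a -> V}) n = 0.
Proof. by rewrite /coord; case: insub => // i; rewrite ffunE. Qed.

Lemma coord_eq0 V a (u : {ffun 'I_a -> V}) : u = 0 <-> forall n, coord u n = 0.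
Proof.
by split=> [-> n|h]; [rewrite coord0 | apply: coord_inj => n; rewrite h coord0].
Qed.

Lemma coordP V a k (u v : {ffun 'I_a -> V}) n :
  coord (k *: u + v) n = k *: coord u n + coord v n.
Proof.
by rewrite /coord; case: insub => [i|]; rewrite ?ffunE ?scaler0 ?addr0.
Qed.

(** [jordan N a] is the operator [N (x) 1 + 1 (x) S] on [V (x) k^a], where [S]
    is a nilpotent Jordan block of size [a]: the action of a primitive element
    [T] on the tensor product of [V] with [k[T]/(T^a)]. *)
Definition jordan_fun V (N : 'End(V)) a (u : {ffun 'I_a -> V}) :
  {ffun 'I_a -> V} := truncate a (fun n => N (coord u n) + coord u n.+1).

Lemma jordan_fun_linear V (N : 'End(V)) a : linear (@jordan_fun V N a).
Proof.
move=> k u v; apply/ffunP => i; rewrite !ffunE !coordP linearP scalerDr.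
by rewrite addrACA.
Qed.

HB.instance Definition _ V (N : 'End(V)) a :=
  GRing.isLinear.Build K _ _ _ (@jordan_fun V N a) (@jordan_fun_linear V N a).

Definition jordan V (N : 'End(V)) a : 'End({ffun 'I_a -> V}) :=
  linfun (@jordan_fun V N a).

Lemma coord_jordan V (N : 'End(V)) a u n :
  coord (jordan N a u) n = N (coord u n) + coord u n.+1.
Proof.
rewrite lfunE /= coord_truncate; case: ltnP => // h.
by rewrite !coord_ge ?linear0 ?addr0 // ltnW.
Qed.

(** Powers of the Jordan operator are computed on functions on [nat], before
    truncation. The step [r] is general because [p]-th powers turn step [1] into
    step [p]. *)
Definition shift_add V (M : 'End(V)) r (x : nat -> V) n := M (x n) + x (n + r)%N.

Lemma iter_shift_add V (M : 'End(V)) r m x n :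
  iter m (shift_add M r) x n =
  \sum_(j < m.+1) lpow M (m - j) (x (n + r * j)%N) *+ 'C(m, j).
Proof.
elim: m n => [|m IH] n.
  by rewrite big_ord_recl big_ord0 /= bin0 muln0 addn0 addr0 lpow0.
rewrite iterS {1}/shift_add !IH.
rewrite raddf_sum /=.
under eq_bigr => j _ do rewrite raddfMn /= -lpowS -subSn ?leq_ord //.
under [X in _ + X]eq_bigr => j _ do rewrite -addnA -mulnS.
rewrite [RHS]big_ord_recl /= /bump /=.
under [X in _ = _ + X]eq_bigr => j _ do rewrite add1n binS mulrnDr.
rewrite big_split /= addrA; congr (_ + _).
rewrite [X in _ = _ + X]big_ord_recr /= (@bin_small m m.+1) // mulr0n addr0.
by rewrite big_ord_recl /= !bin0.
Qed.

Lemma coord_iter_jordan V (N : 'End(V)) a u m n :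
  coord (lpow (jordan N a) m u) n = iter m (shift_add N 1) (coord u) n.
Proof.
elim: m n => [|m IH] n; first by rewrite lpow0.
by rewrite lpowS coord_jordan !IH iterS /shift_add addn1.
Qed.

(** In characteristic [p] the middle binomials of the [p]-th power vanish. *)
Lemma iter_shift_add_char V (M : 'End(V)) r p x n : p \in [pchar K] ->
  iter p (shift_add M r) x n = shift_add (lpow M p) (r * p) x n.
Proof.
move=> pK; have p_pr := pcharf_prime pK; have p_gt0 := prime_gt0 p_pr.
rewrite iter_shift_add /shift_add; case: p pK p_pr p_gt0 => // p pK p_pr _.
rewrite big_ord_recl big_ord_recr /= bin0 ?subn0 ?muln0 ?addn0 ?mulr1n; congr (_ + _).
rewrite big1 ?add0r => [|i _]; last first.
  rewrite -scaler_nat /bump /= add1n (_ : _%:R = 0) ?scale0r //; apply/eqP.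
  by rewrite -(dvdn_pcharf pK) prime_dvd_bin //= ltnS ltn_ord.
by rewrite /bump /= add1n subnn binn lpow0.
Qed.

Lemma iter_shift_add_mul V (M : 'End(V)) r p m x n : p \in [pchar K] ->
  iter (p * m) (shift_add M r) x n = iter m (shift_add (lpow M p) (r * p)) x n.
Proof.
move=> pK; elim: m n => [|m IH] n; first by rewrite muln0.
rewrite mulnS iterD iter_shift_add_char // iterS /shift_add !IH.
by [].
Qed.

End Jordan.
Arguments lpow : simpl never.

Section Intertwining.
Variable K : fieldType.
Implicit Types V W : vectType K.

Section Diagonal.
Variables (V : vectType K) (n : nat).

Definition inject_fun (i : 'I_n) (v : V) : {ffun 'I_n -> V} :=
  [ffun j => if j == i then v else 0].

Lemma inject_fun_linear i : linear (inject_fun i).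
Proof.
move=> k u v; apply/ffunP => j; rewrite !ffunE.
by case: eqP => //; rewrite scaler0 addr0.
Qed.

HB.instance Definition _ i :=
  GRing.isLinear.Build K _ _ _ (inject_fun i) (inject_fun_linear i).

Definition inject i : 'Hom(V, {ffun 'I_n -> V}) := linfun (inject_fun i).

Lemma nullity_diag W (f : 'Hom({ffun 'I_n -> V}, W)) (f_ : 'I_n -> 'End(V)) :
  (forall u, f u = 0 <-> forall i, f_ i (u i) = 0) ->
  nullity f = (\sum_i nullity (f_ i))%N.
Proof.
move=> fP; rewrite /nullity.
have injE i v j : inject i v j = if j == i then v else 0 by rewrite lfunE ffunE.
have -> : lker f = (\sum_i inject i @: lker (f_ i))%VS.
  apply/vspaceP => u; rewrite memv_ker; apply/eqP/memv_sumP => [fu|[u_ uP ->]].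
    exists (fun i => inject i (u i)) => [i _|].
      by apply: memv_img; rewrite memv_ker; apply/eqP; apply: (iffLR (fP u)).
    apply/ffunP => j; rewrite sum_ffunE (bigD1 j) //= injE eqxx big1 ?addr0 //.
    by move=> i /negPf ij; rewrite injE eq_sym ij.
  apply: (iffRL (fP _)) => j; rewrite sum_ffunE raddf_sum big1 // => i _.
  have /memv_imgP[v + ->] := uP i isT; rewrite memv_ker => /eqP fv.
  by rewrite injE; case: eqP => [->//|_]; rewrite raddf0.
have dir : directv (\sum_i inject i @: lker (f_ i)).
  apply/directv_sum_independent => u_ uP s0 i _.
  have /memv_imgP[v _ uE] := uP i isT.
  have : (\sum_i u_ i) i = 0 by rewrite s0 ffunE.
  rewrite sum_ffunE (bigD1 i) //= big1 ?addr0 => [|j /negPf ji].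
    by rewrite uE injE eqxx => ->; rewrite linear0.
  have /memv_imgP[w _ ->] := uP j isT.
  by rewrite injE eq_sym ji.
rewrite (directvP dir) /=; apply: eq_bigr => i _; rewrite limg_dim_eq //; apply/eqP; rewrite -subv0.
apply/subvP => v; rewrite memv_cap !memv_ker => /andP[_ /eqP] /ffunP/(_ i).
by rewrite injE eqxx ffunE => ->; rewrite mem0v.
Qed.

(** Kernels of upper triangular block operators are computed by an injective
    change of variables [g] that turns the equations [f u = 0] into separate
    equations [N^(e i) (g u i) = 0]. *)
Lemma nullity_separate W (N : 'End(V)) (f : 'Hom({ffun 'I_n -> V}, W))
    (g : 'End({ffun 'I_n -> V})) (e : 'I_n -> nat) :
  (forall u, g u = 0 -> u = 0) ->
  (forall u, f u = 0 <-> forall i, lpow N (e i) (g u i) = 0) ->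
  nullity f = (\sum_i nullity (lpow N (e i)))%N.
Proof.
move=> ginj fgP.
have ker_g : lker g == 0%VS.
  by rewrite -subv0; apply/subvP => u; rewrite memv_ker => /eqP/ginj ->; exact: mem0v.
pose f' := (f \o g^-1)%VF.
rewrite -(@nullity_diag _ f') => [|u].
  apply: (nullity_transfer (g := g)) => [v _|v fv|v' f'v].
  - exact: ginj.
  - by rewrite comp_lfunE lker0_lfunK.
  - exists (g^-1%VF v'); first by rewrite -f'v comp_lfunE.
    by rewrite lker0_lfunVK.
by rewrite comp_lfunE fgP lker0_lfunVK.
Qed.

End Diagonal.

Lemma eq_nullity V W W' (f : 'Hom(V, W)) (f' : 'Hom(V, W')) :
  (forall v, f v = 0 <-> f' v = 0) -> nullity f = nullity f'.
Proof.
move=> h; apply: (nullity_transfer (g := \1%VF)) => v.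
- by rewrite id_lfunE.
- by rewrite id_lfunE => /h.
- by move=> /h fv; exists v; rewrite ?id_lfunE.
Qed.

Lemma nullity_lpow0 V (N : 'End(V)) : nullity (lpow N 0) = 0%N.
Proof.
apply/eqP; rewrite dimv_eq0 -subv0; apply/subvP => v.
by rewrite memv_ker lpow0 => /eqP->; exact: mem0v.
Qed.

Lemma jordan0_eq0 V (N : 'End(V)) (u : {ffun 'I_0 -> V}) : u = 0.
Proof. by apply/ffunP => -[]. Qed.

Lemma nullity_jordan0 V (N : 'End(V)) : nullity (jordan N 0) = 0%N.
Proof.
apply/eqP; rewrite dimv_eq0 -subv0; apply/subvP => v _.
by rewrite (jordan0_eq0 N v) mem0v.
Qed.

(** A kernel vector of the Jordan operator is determined by its first entry:
    the equations read [u_(i+1) = - N u_i]. *)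
Lemma nullity_jordan V (N : 'End(V)) b : nullity (jordan N b) = nullity (lpow N b).
Proof.
case: b => [|b]; first by rewrite nullity_jordan0 nullity_lpow0.
pose g_ (v : V) : {ffun 'I_b.+1 -> V} := truncate b.+1 (fun n => lpow (- N) n v).
have g_lin : linear g_ by move=> k u v; apply/ffunP=> i; rewrite !ffunE linearP.
pose g := linfun (HB.pack g_ (GRing.isLinear.Build K _ _ _ g_ g_lin) : {linear _ -> _}).
have gE v n : coord (g v) n = if (n < b.+1)%N then lpow (- N) n v else 0.
  by rewrite lfunE /= coord_truncate.
have powN n v : lpow (- N) n v = (-1) ^+ n *: lpow N n v.
  elim: n => [|n IH]; first by rewrite !lpow0 scale1r.
  by rewrite !lpowS IH opp_lfunE linearZ /= exprS mulN1r scaleNr.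
symmetry; apply: (nullity_transfer (g := g)) => [v _|v Nv|u ju].
- by move/coord_eq0/(_ 0%N); rewrite gE lpow0.
- apply/coord_eq0 => n; rewrite coord_jordan !gE ltnS.
  have [nb|nb] := ltnP n b.
    by rewrite (ltnW nb) ltnS nb lpowS opp_lfunE subrr.
  rewrite ltnS ltnNge nb /= addr0; case: leqP => nb'; last by rewrite linear0.
  have {nb nb'} -> : n = b by apply/eqP; rewrite eqn_leq nb nb'.
  by rewrite powN linearZ /= -lpowS Nv scaler0.
- have uS n : coord u n.+1 = - N (coord u n).
    have /coord_eq0/(_ n) := ju; rewrite coord_jordan => /eqP.
    by rewrite addrC addr_eq0 => /eqP.
  have uE n : coord u n = lpow (- N) n (coord u 0).
    by elim: n => [|n IH]; rewrite ?lpow0 // uS IH lpowS opp_lfunE.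
  exists (coord u 0).
    have := uE b.+1; rewrite coord_ge // powN => /esym/eqP.
    by rewrite scaler_eq0 signr_eq0 => /eqP.
  by apply: coord_inj => n; rewrite gE -uE; case: ltnP => // h; rewrite coord_ge.
Qed.

(** Isomorphism of the [k[T]]-modules [(V, N)] and [(V', N')]. *)
Definition intertwined V V' (N : 'End(V)) (N' : 'End(V')) :=
  exists g : 'Hom(V, V'), exists h : 'Hom(V', V),
    [/\ cancel g h, cancel h g & forall v, g (N v) = N' (g v)].

Lemma intertwined_refl V (N : 'End(V)) : intertwined N N.
Proof. by exists \1%VF, \1%VF; split=> v; rewrite !id_lfunE. Qed.

Lemma intertwined_trans V V' V'' (N : 'End(V)) (N' : 'End(V')) (N'' : 'End(V'')) :
  intertwined N N' -> intertwined N' N'' -> intertwined N N''.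
Proof.
case=> g [h [gh hg gN]] [g' [h' [gh' hg' gN']]].
exists (g' \o g)%VF, (h \o h')%VF; split=> v; rewrite !comp_lfunE.
- by rewrite gh' gh.
- by rewrite hg hg'.
- by rewrite gN gN'.
Qed.

Lemma intertwined_lpow V V' (N : 'End(V)) (N' : 'End(V')) n :
  intertwined N N' -> intertwined (lpow N n) (lpow N' n).
Proof.
case=> g [h [gh hg gN]]; exists g, h; split=> // v.
by elim: n => [|n IH]; rewrite ?lpow0 // !lpowS gN IH.
Qed.

Lemma intertwined_nullity V V' (N : 'End(V)) (N' : 'End(V')) :
  intertwined N N' -> nullity N = nullity N'.
Proof.
case=> g [h [gh hg gN]]; apply: (nullity_transfer (g := g)) => v.
- by move=> _ gv; rewrite -[v]gh gv linear0.
- by rewrite -gN => ->; rewrite linear0.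
- move=> Nv; exists (h v); last by rewrite hg.
  by rewrite -[N _]gh gN hg Nv linear0.
Qed.

Definition ffun_map V V' (g : 'Hom(V, V')) a (u : {ffun 'I_a -> V}) :
  {ffun 'I_a -> V'} := [ffun i => g (u i)].

Lemma ffun_map_linear V V' (g : 'Hom(V, V')) a : linear (@ffun_map V V' g a).
Proof. by move=> k u v; apply/ffunP => i; rewrite !ffunE linearP. Qed.

HB.instance Definition _ V V' (g : 'Hom(V, V')) a :=
  GRing.isLinear.Build K _ _ _ (@ffun_map V V' g a) (@ffun_map_linear V V' g a).

(** The direct sum of [a] copies of the operator [g]. *)
Definition copies V V' (g : 'Hom(V, V')) a :
  'Hom({ffun 'I_a -> V}, {ffun 'I_a -> V'}) := linfun (@ffun_map V V' g a).

Lemma coord_copies V V' (g : 'Hom(V, V')) a u n :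
  coord (copies g a u) n = g (coord u n).
Proof.
by rewrite lfunE /coord; case: insub => [i|]; rewrite ?ffunE ?linear0.
Qed.

Lemma copies_cancel V V' (g : 'Hom(V, V')) (h : 'Hom(V', V)) a :
  cancel g h -> cancel (copies g a) (copies h a).
Proof. by move=> gh u; apply: coord_inj => n; rewrite !coord_copies gh. Qed.

Lemma intertwined_jordan V V' (N : 'End(V)) (N' : 'End(V')) a :
  intertwined N N' -> intertwined (jordan N a) (jordan N' a).
Proof.
case=> g [h [gh hg gN]]; exists (copies g a), (copies h a).
split=> [||u]; try exact: copies_cancel.
by apply: coord_inj => n; rewrite coord_copies !coord_jordan !coord_copies raddfD /= gN.
Qed.

Lemma intertwined_copies V V' (N : 'End(V)) (N' : 'End(V')) a :
  intertwined N N' -> intertwined (copies N a) (copies N' a).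
Proof.
case=> g [h [gh hg gN]]; exists (copies g a), (copies h a).
split=> [||u]; try exact: copies_cancel.
by apply: coord_inj => n; rewrite !coord_copies gN.
Qed.

Definition transpose_fun V a b (u : {ffun 'I_a -> {ffun 'I_b -> V}}) :
  {ffun 'I_b -> {ffun 'I_a -> V}} := [ffun j => [ffun i => u i j]].

Lemma transpose_fun_linear V a b : linear (@transpose_fun V a b).
Proof. by move=> k u v; apply/ffunP => i; apply/ffunP => j; rewrite !ffunE. Qed.

HB.instance Definition _ V a b :=
  GRing.isLinear.Build K _ _ _ (@transpose_fun V a b) (@transpose_fun_linear V a b).

Definition transposef V a b :
  'Hom({ffun 'I_a -> {ffun 'I_b -> V}}, {ffun 'I_b -> {ffun 'I_a -> V}}) :=
  linfun (@transpose_fun V a b).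

Lemma transposefK V a b : cancel (@transposef V a b) (@transposef V b a).
Proof. by move=> u; apply/ffunP => i; apply/ffunP => j; rewrite !lfunE !ffunE. Qed.

Lemma coord_transposef V a b (u : {ffun 'I_a -> {ffun 'I_b -> V}}) m n :
  coord (coord (transposef V a b u) m) n = coord (coord u n) m.
Proof.
rewrite lfunE.
case: (ltnP m b) => hm; last first.
  by rewrite [coord _ m]coord_ge // coord0 [RHS]coord_ge.
case: (ltnP n a) => hn; last first.
  by rewrite [LHS]coord_ge // [coord u n]coord_ge // coord0.
rewrite -[m]/(val (Ordinal hm)) -[n]/(val (Ordinal hn)).
by rewrite !coord_ord !ffunE.
Qed.

Lemma coordD V a (u v : {ffun 'I_a -> V}) n : coord (u + v) n = coord u n + coord v n.
Proof. by rewrite -[u]scale1r coordP !scale1r. Qed.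

Lemma intertwined_swap V (N : 'End(V)) a b :
  intertwined (jordan (jordan N a) b) (jordan (jordan N b) a).
Proof.
exists (transposef V b a), (transposef V a b); split=> [||u]; try exact: transposefK.
apply: coord_inj => m; apply: coord_inj => n.
rewrite coord_transposef !coord_jordan !coordD !coord_jordan !coord_transposef.
by rewrite -!addrA; congr (_ + _); rewrite addrC.
Qed.

Lemma intertwined_jordan_copies V (N : 'End(V)) a d :
  intertwined (jordan (copies N d) a) (copies (jordan N a) d).
Proof.
exists (transposef V a d), (transposef V d a); split=> [||u]; try exact: transposefK.
apply: coord_inj => m; apply: coord_inj => n.
rewrite coord_transposef coord_copies !coord_jordan !coordD !coord_copies.
by rewrite !coord_transposef.
Qed.

Lemma nullity_copies V (N : 'End(V)) d : nullity (copies N d) = (d * nullity N)%N.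
Proof.
rewrite (@nullity_diag _ _ _ _ (fun=> N)) ?sum_nat_const ?card_ord // => u.
rewrite coord_eq0; split=> [h i|h n]; first by have := h i; rewrite coord_copies coord_ord.
rewrite coord_copies; case: (ltnP n d) => hn; last by rewrite coord_ge ?linear0.
by rewrite -[n]/(val (Ordinal hn)) coord_ord h.
Qed.

Lemma intertwined_jordan1 V (N : 'End(V)) : intertwined (jordan N 1) N.
Proof.
pose h_ (v : V) : {ffun 'I_1 -> V} := [ffun=> v].
pose g_ (u : {ffun 'I_1 -> V}) : V := u ord0.
have g_lin : linear g_ by move=> k u v; rewrite /g_ !ffunE.
have h_lin : linear h_ by move=> k u v; apply/ffunP=> i; rewrite !ffunE.
pose g := linfun (HB.pack g_ (GRing.isLinear.Build K _ _ _ g_ g_lin) : {linear _ -> _}).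
pose h := linfun (HB.pack h_ (GRing.isLinear.Build K _ _ _ h_ h_lin) : {linear _ -> _}).
have gE u : g u = coord u 0 by rewrite lfunE /= -[0%N]/(val (ord0 : 'I_1)) coord_ord.
have hE v : h v = [ffun=> v] by rewrite lfunE.
exists g, h; split=> u.
- by rewrite hE gE; apply/ffunP=> i; rewrite ffunE -coord_ord ord1.
- by rewrite gE hE -[0%N]/(val (ord0 : 'I_1)) coord_ord ffunE.
- by rewrite !gE coord_jordan [coord u 1]coord_ge // addr0.
Qed.

End Intertwining.

(** * Decompositions in characteristic p *)

Section Decompositions.
Variable K : fieldType.
Implicit Types V W : vectType K.

Definition lin_hom V W (f : V -> W) (f_lin : linear f) : 'Hom(V, W) :=
  linfun (HB.pack f (GRing.isLinear.Build K V W _ f f_lin) : {linear V -> W}).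

Lemma lin_homE V W (f : V -> W) (f_lin : linear f) v : lin_hom f_lin v = f v.
Proof. by rewrite lfunE. Qed.

Lemma iter_shift_add0 V (M : 'End(V)) r m x n :
  (forall k, (n + r <= k)%N -> x k = 0) ->
  iter m (shift_add M r) x n = lpow M m (x n).
Proof.
move=> x0; elim: m n x0 => [|m IH] n x0; first by rewrite lpow0.
rewrite iterS {1}/shift_add IH // IH => [|k h]; last by apply: x0; lia.
by rewrite (x0 (n + r)%N) // raddf0 addr0 lpowS.
Qed.

(** Far enough out only one more entry is in reach, so of the binomial
    expansion two terms survive. *)
Lemma iter_shift_add1 V (M : 'End(V)) r m x n :
  (forall k, (n + r + r <= k)%N -> x k = 0) ->
  iter m (shift_add M r) x n =
  lpow M m (x n) + m%:R *: lpow M m.-1 (x (n + r)%N).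
Proof.
move=> x0; elim: m => [|m IH]; first by rewrite lpow0 scale0r addr0.
rewrite iterS {1}/shift_add IH iter_shift_add0 //= raddfD /= linearZ /= -!lpowS.
rewrite -addrA; congr (_ + _); case: m {IH} => [|m] /=.
  by rewrite scale0r add0r scale1r.
by rewrite -[X in _ + X]scale1r -scalerDl natr1.
Qed.

Lemma lpow_jordan2 V (N : 'End(V)) b u :
  lpow (jordan N 2) b u = 0 <->
  lpow N b (coord u 0) + b%:R *: lpow N b.-1 (coord u 1) = 0 /\
  lpow N b (coord u 1) = 0.
Proof.
have c0 k : (2 <= k)%N -> coord u k = 0 by exact: coord_ge.
rewrite coord_eq0; split=> [h|[h0 h1] [|[|n]]].
- split.
    by have := h 0%N; rewrite coord_iter_jordan iter_shift_add1.
  by have := h 1%N; rewrite coord_iter_jordan iter_shift_add0.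
- by rewrite coord_iter_jordan iter_shift_add1.
- by rewrite coord_iter_jordan iter_shift_add0.
- by rewrite coord_ge.
Qed.

(** [V_2 (x) V_b] is [V_(b-1) + V_(b+1)] when [b] is a unit, by the change of
    variables [(u0, u1) |-> (u0, N u0 + b u1)], and [2 V_b] otherwise. *)
Lemma nullity_jordan2_unit V (N : 'End(V)) b : (0 < b)%N -> b%:R != 0 :> K ->
  nullity (lpow (jordan N 2) b) =
  (nullity (lpow N b.-1) + nullity (lpow N b.+1))%N.
Proof.
move=> b_gt0 b0.
pose g_ (u : {ffun 'I_2 -> V}) : {ffun 'I_2 -> V} := truncate 2 (fun n =>
  if n == 0%N then coord u 0 else N (coord u 0) + b%:R *: coord u 1).
have g_lin : linear g_.
  move=> k u v; apply: coord_inj => n; rewrite coordP !coord_truncate.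
  case: ltnP => _; last by rewrite scaler0 addr0.
  case: eqP => _; rewrite !coordP // linearP !scalerDr !scalerA /= [b%:R * k]mulrC.
  by rewrite addrACA.
have [g gE] : exists g : 'End({ffun 'I_2 -> V}), forall u n,
    coord (g u) n = if (n < 2)%N then
      if n == 0%N then coord u 0 else N (coord u 0) + b%:R *: coord u 1 else 0.
  by exists (lin_hom g_lin) => u n; rewrite lin_homE coord_truncate.
pose e (i : 'I_2) := if val i == 0%N then b.+1 else b.-1.
rewrite (@nullity_separate _ _ _ _ N _ g e) => [|u gu|u].
- by rewrite !big_ord_recl big_ord0 /e /= addn0 addnC.
- have u0 : coord u 0 = 0 by have := gE u 0; rewrite gu coord0.
  have /esym/eqP := gE u 1%N; rewrite gu coord0 /= u0 raddf0 add0r scaler_eq0.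
  rewrite (negPf b0) /= => /eqP u1; apply/coord_eq0 => -[|[|n]] //.
  by rewrite coord_ge.
rewrite lpow_jordan2; case: b b_gt0 {g_ g_lin} b0 gE @e => // b _ b0 gE e /=.
have E : lpow N b.+1 (coord u 0) + b.+1%:R *: lpow N b (coord u 1) =
   lpow N b (coord (g u) 1) by rewrite gE /= raddfD /= linearZ /= lpowSr.
rewrite E; split=> [[h1 h2] i|h].
  rewrite -coord_ord /e; case: eqP => [->|i0].
    rewrite gE /= lpowS; have := congr1 N E; rewrite h1 raddf0 raddfD /= linearZ /=.
    by rewrite -!lpowS h2 scaler0 addr0.
  by have -> : val i = 1%N by move: i i0 => [[|[|]]].
have := h ord0; have := h (@Ordinal 2 1 isT); rewrite -!coord_ord /e /= => h1 h0.
split=> //; move: h0; rewrite gE /= lpowS => h0.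
have := congr1 N E; rewrite h1 raddf0 raddfD /= linearZ /= -!lpowS.
rewrite lpowS h0 add0r => /eqP; rewrite scaler_eq0 (negPf b0) /=.
by move/eqP.
Qed.

Lemma nullity_jordan2_nonunit V (N : 'End(V)) b : b%:R = 0 :> K ->
  nullity (lpow (jordan N 2) b) = (2 * nullity (lpow N b))%N.
Proof.
move=> b0; rewrite -nullity_copies; apply: eq_nullity => u.
rewrite lpow_jordan2 b0 scale0r addr0 coord_eq0; split=> [[h0 h1] n|h].
  by rewrite coord_copies; case: n => [|[|n]] //; rewrite [coord u _]coord_ge ?raddf0.
by have := h 0%N; have := h 1%N; rewrite !coord_copies.
Qed.

Section CharP.
Variable p : nat.
Hypothesis pK : p \in [pchar K].

Lemma coord_lpow_jordanSp V (N : 'End(V)) m u n :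
  coord (lpow (jordan N p.+1) (p * m) u) n =
  lpow N (p * m) (coord u n) + m%:R *: lpow N (p * m.-1) (coord u (n + p)%N).
Proof.
have p_gt0 := prime_gt0 (pcharf_prime pK).
rewrite coord_iter_jordan (iter_shift_add_mul N 1 m) // mul1n iter_shift_add1.
  by rewrite !lpow_lpow.
by move=> k h; apply: coord_ge; lia.
Qed.

(** [V_(p+1) (x) V_(pm) = (p-1) V_(pm) + V_(pm-p) + V_(pm+p)]: in
    [T^(pm) = (T^p)^m] only the entries [0] and [p] interact, and they do so as in
    [V_2 (x) V_m]. *)
Lemma nullity_jordanSp_mul V (N : 'End(V)) m : (0 < m)%N -> m%:R != 0 :> K ->
  nullity (lpow (jordan N p.+1) (p * m)) =
  (p.-1 * nullity (lpow N (p * m)) + nullity (lpow N (p * m.-1))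
   + nullity (lpow N (p * m.+1)))%N.
Proof.
move=> m_gt0 m0; have p_gt1 := prime_gt1 (pcharf_prime pK).
pose g_ (u : {ffun 'I_p.+1 -> V}) : {ffun 'I_p.+1 -> V} := truncate p.+1 (fun n =>
  if n == p then lpow N p (coord u 0) + m%:R *: coord u p else coord u n).
have g_lin : linear g_.
  move=> k u v; apply: coord_inj => n; rewrite coordP !coord_truncate.
  case: ltnP => _; last by rewrite scaler0 addr0.
  case: eqP => _; rewrite !coordP // linearP !scalerDr !scalerA /= [m%:R * k]mulrC.
  by rewrite addrACA.
have [g gE] : exists g : 'End({ffun 'I_p.+1 -> V}), forall u n,
    coord (g u) n = if (n < p.+1)%N then
    if n == p then lpow N p (coord u 0) + m%:R *: coord u p else coord u n else 0.
  by exists (lin_hom g_lin) => u n; rewrite lin_homE coord_truncate.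
pose e (i : 'I_p.+1) := if val i == 0%N then p * m.+1 else
                        if val i == p then p * m.-1 else p * m.
rewrite (@nullity_separate _ _ _ _ N _ g e) => [|u gu|u].
- rewrite big_ord_recl (_ : e ord0 = p * m.+1)%N //.
  case: p p_gt1 @e {g_ g_lin g gE} => // -[] // q _ e.
  rewrite big_ord_recr /= (_ : e _ = q.+2 * m.-1)%N; last first.
    by rewrite /e /= /bump /= add1n eqxx.
  rewrite (eq_bigr (fun=> nullity (lpow N (q.+2 * m)))) => [|i _].
    by rewrite sum_nat_const card_ord /=; lia.
  rewrite /e /= /bump /= add1n eqSS; case: eqP => // E.
  by have := ltn_ord i; rewrite E ltnn.
- have uE n : (n < p)%N -> coord u n = 0.
    by move=> h; have := gE u n; rewrite gu coord0 ltnW // ltn_eqF.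
  apply/coord_eq0 => n; have [/uE //|] := ltnP n p; rewrite leq_eqVlt.
  case/orP=> [/eqP <-|h]; last by rewrite coord_ge.
  have /esym/eqP := gE u p; rewrite gu coord0 ltnSn eqxx uE ?raddf0 ?add0r; last by lia.
  by rewrite scaler_eq0 (negPf m0) => /eqP.
have pmS : (p * m = p * m.-1 + p)%N by rewrite -mulnSr prednK.
have y0 : coord (lpow (jordan N p.+1) (p * m) u) 0 = lpow N (p * m.-1) (coord (g u) p).
  by rewrite coord_lpow_jordanSp add0n gE ltnSn eqxx raddfD /= linearZ /= -lpowD -pmS.
have yS n : (0 < n)%N -> coord (lpow (jordan N p.+1) (p * m) u) n = lpow N (p * m) (coord u n).
  move=> n_gt0.
  by rewrite coord_lpow_jordanSp [coord u (_ + _)]coord_ge ?raddf0 ?scaler0 ?addr0 //; lia.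
have y0p : lpow N p (coord (lpow (jordan N p.+1) (p * m) u) 0) =
  lpow N (p * m.+1) (coord u 0) + m%:R *: lpow N (p * m) (coord u p).
  rewrite y0 gE ltnSn eqxx raddfD /= raddfD /= !linearZ /= -!lpowD.
  by rewrite [(p + p * m.-1)%N]addnC -pmS [(p * m + p)%N]addnC -mulnS.
rewrite coord_eq0; split=> [h i|h].
  rewrite -coord_ord /e; case: i => [[|n] hn] /=.
    rewrite gE /= (ltn_eqF (ltnW p_gt1)); move: y0p; rewrite h raddf0.
    by rewrite -yS 1?ltnW // h scaler0 addr0 => <-.
  case: eqP => [->|np]; first by rewrite -y0 h.
  by rewrite gE hn; case: eqP => // _; rewrite -yS // h.
have hc n : (n < p.+1)%N -> lpow N (if n == 0%N then p * m.+1 else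
      if n == p then p * m.-1 else p * m)%N (coord (g u) n) = 0.
  by move=> hn; have := h (Ordinal hn); rewrite -coord_ord.
have z0 : lpow N (p * m.+1) (coord u 0) = 0.
  by have := hc 0%N isT; rewrite gE /= ltn_eqF //; lia.
have zp : lpow N (p * m.-1) (coord (g u) p) = 0.
  by have := hc p (ltnSn p); rewrite eqxx gtn_eqF //; lia.
move=> [|n]; first by rewrite y0.
rewrite yS //; have [hn|hn] := ltnP n.+1 p.
  by have := hc n.+1 (leqW hn); rewrite /= gE (ltn_eqF hn) leqW.
move: hn; rewrite leq_eqVlt => /orP[/eqP <-|hn]; last by rewrite coord_ge ?raddf0.
move/eqP: y0p; rewrite y0 zp raddf0 z0 add0r eq_sym scaler_eq0 (negPf m0) /=.
by move/eqP.
Qed.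

End CharP.
End Decompositions.

Section OddDecomposition.
Variable K : fieldType.
Implicit Types V W : vectType K.
Variable p : nat.
Hypothesis pK : p \in [pchar K].

(** [V_(p+1) (x) V_(pm+1) = (p-2) V_(pm) + V_(pm+p+1) + V_(pm+p-1) + V_(pm-p+1)]:
    this is how the class of [V_(p+1) - V_(p-1)] shifts by [p], as [V_2] shifts
    by [1]. *)
Lemma nullity_jordanSp_mulS V (N : 'End(V)) m : (2 < p)%N -> (0 < m)%N ->
    m%:R != 0 :> K -> m.+1%:R != 0 :> K ->
  nullity (lpow (jordan N p.+1) (p * m).+1) =
  (p.-2 * nullity (lpow N (p * m)) + nullity (lpow N (p * m + p).+1)
   + nullity (lpow N (p * m + p.-1)) + nullity (lpow N (p * m.-1).+1))%N.
Proof.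
move=> p_gt2 m_gt0 m0 mS0; have p_pr := pcharf_prime pK.
have p_odd : odd p by have [E|//] := even_prime p_pr; rewrite E in p_gt2.
set a := (p * m)%N; set a' := (p * m.-1)%N.
have aE : a = (a' + p)%N by rewrite /a /a' -mulnSr prednK.
(* The equations of degree [n > 0] chain the entries by
   [N^a (u_(n+1) + N u_n) = 0], which the sums [u_n + N u_(n-1)] decouple; entry
   [p] is the combination that occurs in the equation of degree [0]. *)
pose g_ (u : {ffun 'I_p.+1 -> V}) : {ffun 'I_p.+1 -> V} := truncate p.+1 (fun n =>
  if n == 0%N then coord u 0 else
  if n == 1%N then m.+1%:R *: coord u 1 + N (coord u 0) else
  if n == p then m%:R *: coord u p + (lpow N p.-1 (coord u 1) + lpow N p (coord u 0))
  else coord u n + N (coord u n.-1)).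
have g_lin : linear g_.
  move=> k u v; apply: coord_inj => n; rewrite coordP !coord_truncate.
  case: ltnP => _; last by rewrite scaler0 addr0.
  case: eqP => _; first by rewrite coordP.
  case: eqP => _; first by rewrite !coordP ![in LHS]linearP !scalerDr addrACA.
  case: eqP => _; rewrite !coordP ![in LHS]linearP !scalerDr; last by rewrite addrACA.
  rewrite [X in _ + X]addrACA /=; exact: addrACA.
have [g gE] : exists g : 'End({ffun 'I_p.+1 -> V}), forall u n,
    coord (g u) n = if (n < p.+1)%N then
  if n == 0%N then coord u 0 else
  if n == 1%N then m.+1%:R *: coord u 1 + N (coord u 0) else
  if n == p then m%:R *: coord u p + (lpow N p.-1 (coord u 1) + lpow N p (coord u 0))
  else coord u n + N (coord u n.-1) else 0.
  by exists (lin_hom g_lin) => u n; rewrite lin_homE coord_truncate.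
move: g_lin => _.
pose e n := (if n == 0 then (a + p).+1 else if n == 1 then a + p.-1 else
                        if n == p then a'.+1 else a)%N.
have g0 u : coord (g u) 0 = coord u 0 by rewrite gE.
have g1 u : coord (g u) 1 = m.+1%:R *: coord u 1 + N (coord u 0).
  by rewrite gE /= ltnS; case: ltnP => //; lia.
have gp u : coord (g u) p =
    m%:R *: coord u p + (lpow N p.-1 (coord u 1) + lpow N p (coord u 0)).
  by rewrite gE ltnSn eqxx !gtn_eqF //; lia.
have gS u n : (1 < n < p)%N -> coord (g u) n = coord u n + N (coord u n.-1).
  by move=> /andP[n1 np]; rewrite gE ltnW // (ltn_eqF np) !gtn_eqF //; lia.
rewrite (@nullity_separate _ _ _ _ N _ g e) => [|u gu|u].
- rewrite -(big_mkord xpredT (fun i => nullity (lpow N (e i)))).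
  rewrite big_ltn // big_ltn; last by lia.
  rewrite big_nat_recr /=; last by lia.
  rewrite (eq_big_nat _ _ (F2 := fun=> nullity (lpow N a))) => [|i hi].
    rewrite sum_nat_const_nat /e /= eqxx !gtn_eqF; try lia.
  by rewrite /e; do 3!(case: eqP => [?|_]; first by exfalso; lia).
- have u0 : coord u 0 = 0 by rewrite -g0 gu coord0.
  have u1 : coord u 1 = 0.
    have /esym/eqP := g1 u; rewrite gu coord0 u0 raddf0 addr0 scaler_eq0 (negPf mS0).
    by move/eqP.
  have un n : (n < p)%N -> coord u n = 0.
    elim: n => // -[|n] IH h //.
    have := gS u n.+2; rewrite h gu coord0 => /(_ isT) /=.
    by rewrite IH ?raddf0 ?addr0 // ltnW.
  apply/coord_eq0 => n; have [/un //|] := ltnP n p; rewrite leq_eqVlt.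
  case/orP=> [/eqP <-|h]; last by rewrite coord_ge.
  have /esym/eqP := gp u; rewrite gu coord0 u0 u1 !raddf0 !addr0.
  by rewrite scaler_eq0 (negPf m0) => /eqP.
have y0 : coord (lpow (jordan N p.+1) a.+1 u) 0 = lpow N a'.+1 (coord (g u) p).
  rewrite lpowS coord_jordan !coord_lpow_jordanSp // -/a -/a' add0n.
  rewrite [coord u (1 + p)]coord_ge // raddf0 scaler0 addr0.
  rewrite gp !raddfD /= !linearZ /= -!lpowD -!lpowS.
  rewrite -addrA addrC -addrA; congr (_ + (lpow N _ _ + lpow N _ _)); lia.
have yS n : (0 < n)%N -> coord (lpow (jordan N p.+1) a.+1 u) n =
    lpow N a (coord u n.+1 + N (coord u n)).
  move=> n_gt0; rewrite lpowS coord_jordan !coord_lpow_jordanSp // -/a -/a'.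
  rewrite [coord u (n + p)]coord_ge ?[coord u (n.+1 + p)]coord_ge //; try lia.
  by rewrite !raddf0 ?scaler0 !addr0 raddfD /= -lpowS lpowSr addrC.
have chain k : (forall n, (0 < n < k)%N -> lpow N a (coord u n.+1 + N (coord u n)) = 0) ->
    forall n, (0 < n <= k)%N ->
    lpow N a (coord u n) = (-1) ^+ n.-1 *: lpow N (a + n.-1) (coord u 1).
  move=> H; elim=> // -[|n] IH hn; first by rewrite scale1r addn0.
  have := H n.+1; rewrite raddfD /= -lpowSr => /(_ hn)/eqP.
  rewrite addr_eq0 => /eqP ->; rewrite lpowS IH; last by lia.
  by rewrite linearZ /= -lpowS addnS exprS mulN1r scaleNr.
have signp1 : (-1) ^+ p.-1 = 1 :> K.
  by rewrite -signr_odd; case: (p) p_gt2 p_odd => //= q _ /negPf ->.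
have signp2 : (-1) ^+ p.-2 = -1 :> K.
  by rewrite -signr_odd; case: (p) p_gt2 p_odd => // -[] //= q _ /negPn ->.
have gpa : lpow N a (coord (g u) p) = m%:R *: lpow N a (coord u p)
    + (lpow N (a + p.-1) (coord u 1) + lpow N (a + p) (coord u 0)).
  by rewrite gp !raddfD /= linearZ /= -!lpowD.
have g1a : lpow N (a + p.-1) (coord (g u) 1) =
    m.+1%:R *: lpow N (a + p.-1) (coord u 1) + lpow N (a + p) (coord u 0).
  rewrite g1 raddfD /= linearZ /= -lpowSr; congr (_ + lpow N _ _); lia.
rewrite coord_eq0; split=> [h i|h].
  have {}chain n : (0 < n <= p)%N ->
      lpow N a (coord u n) = (-1) ^+ n.-1 *: lpow N (a + n.-1) (coord u 1).
    by apply: chain => {}n /andP[n_gt0 _]; rewrite -yS.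
  have Nxp : lpow N a (coord u p) = lpow N (a + p.-1) (coord u 1).
    by rewrite chain ?signp1 ?scale1r //; lia.
  have gpa0 : lpow N a (coord (g u) p) = 0.
    have -> : a = (p.-1 + a'.+1)%N by lia.
    by rewrite lpowD -y0 h raddf0.
  have e1 : lpow N (a + p.-1) (coord (g u) 1) = 0.
    by rewrite g1a -[RHS]gpa0 gpa Nxp -natr1 scalerDl scale1r addrA.
  have x1 : lpow N (a + p) (coord u 1) = 0.
    have := h p; rewrite yS ?(prime_gt0 p_pr) // [coord u p.+1]coord_ge // add0r.
    rewrite -lpowSr lpowS Nxp -lpowS => <-; congr (lpow N _ _); lia.
  have e0 : lpow N (a + p).+1 (coord u 0) = 0.
    have := congr1 N e1; rewrite g1a raddf0 raddfD /= linearZ /= -!lpowS.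
    have -> : (a + p.-1).+1 = (a + p)%N by lia.
    by rewrite x1 scaler0 add0r.
  rewrite -coord_ord /e; case: i => n hn /=.
  case: eqP => [->|n0]; first by rewrite g0.
  case: eqP => [->|n1] //.
  case: eqP => [->|np]; first by rewrite -y0 h.
  have n2 : (1 < n < p)%N by lia.
  rewrite gS // -(h n.-1) yS; last by lia.
  by rewrite prednK //; lia.
have hc n : (n < p.+1)%N -> lpow N (e n) (coord (g u) n) = 0.
  by move=> hn; have := h (Ordinal hn); rewrite -coord_ord.
have e0 : lpow N (a + p).+1 (coord u 0) = 0 by have := hc 0%N isT; rewrite g0.
have e1 : lpow N (a + p.-1) (coord (g u) 1) = 0.
  by have := hc 1%N (leqW (prime_gt1 p_pr)).
have ep : lpow N a'.+1 (coord (g u) p) = 0.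
  by have := hc p (ltnSn p); rewrite /e eqxx !gtn_eqF //; lia.
have en n : (1 < n < p)%N -> lpow N a (coord u n + N (coord u n.-1)) = 0.
  move=> /[dup] hn /andP[n1 np]; rewrite -gS //; have := hc n (ltnW np).
  by rewrite /e (ltn_eqF np) !gtn_eqF //; lia.
have x1 : lpow N (a + p) (coord u 1) = 0.
  have := congr1 N e1; rewrite g1a raddf0 raddfD /= linearZ /= -!lpowS.
  have -> : (a + p.-1).+1 = (a + p)%N by lia.
  by rewrite e0 addr0 => /eqP; rewrite scaler_eq0 (negPf mS0) => /eqP.
have Nxp : lpow N a (coord u p) = lpow N (a + p.-1) (coord u 1).
  have gpa0 : lpow N a (coord (g u) p) = 0.
    have -> : a = (p.-1 + a'.+1)%N by lia.
    by rewrite lpowD ep raddf0.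
  have : m%:R *: (lpow N a (coord u p) - lpow N (a + p.-1) (coord u 1)) = 0.
    transitivity (lpow N a (coord (g u) p) - lpow N (a + p.-1) (coord (g u) 1)).
      rewrite gpa g1a -natr1 scalerDl scale1r scalerBr.
      by rewrite -[X in _ = _ - X]addrA opprD addrACA subrr addr0.
    by rewrite gpa0 e1 subrr.
  by move/eqP; rewrite scaler_eq0 (negPf m0) subr_eq0 => /eqP.
have {}chain n : (0 < n <= p.-1)%N ->
    lpow N a (coord u n) = (-1) ^+ n.-1 *: lpow N (a + n.-1) (coord u 1).
  by apply: chain => {}n hn; apply: (en n.+1); lia.
case=> [|n]; first by rewrite y0.
rewrite yS //; case: (ltngtP n.+2 p) => hn.
- exact: en.
- have [np|np] := ltnP n.+1 p.+1; last by rewrite !coord_ge ?raddf0 ?addr0 ?raddf0 //; lia.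
  have -> : n.+1 = p by lia.
  rewrite coord_ge // add0r -lpowSr lpowS Nxp -lpowS -[RHS]x1.
  by congr (lpow N _ _); lia.
- have nE : n = p.-2 by lia.
  rewrite hn raddfD /= Nxp -lpowSr lpowS chain; last by lia.
  rewrite linearZ /= -lpowS nE signp2 scaleN1r.
  have -> : (a + p.-2).+1 = (a + p.-1)%N by lia.
  by rewrite subrr.
Qed.

End OddDecomposition.

(** * Jordan block counts of tensor products *)

Section Embed.
Variable K : fieldType.
Implicit Types V W : vectType K.

Definition embedded V V' (N : 'End(V)) (N' : 'End(V')) :=
  exists2 g : 'Hom(V, V'), injective g & forall v, g (N v) = N' (g v).

Lemma embedded_refl V (N : 'End(V)) : embedded N N.
Proof. by exists \1%VF => [u v|v]; rewrite !id_lfunE. Qed.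

Lemma embedded_trans V V' V'' (N : 'End(V)) (N' : 'End(V')) (N'' : 'End(V'')) :
  embedded N N' -> embedded N' N'' -> embedded N N''.
Proof.
case=> g gi gN [g' gi' gN']; exists (g' \o g)%VF => [u v|v]; rewrite !comp_lfunE.
  by move/gi'/gi.
by rewrite gN gN'.
Qed.

Lemma embedded_jordan V V' (N : 'End(V)) (N' : 'End(V')) a :
  embedded N N' -> embedded (jordan N a) (jordan N' a).
Proof.
case=> g gi gN; exists (copies g a) => [u v uv|u]; apply: coord_inj => n.
  by apply: gi; rewrite -!coord_copies uv.
by rewrite coord_copies !coord_jordan !coord_copies raddfD /= gN.
Qed.

(** [V_a] is the submodule of multiples of [T^(b-a)] in [V_b]. *)
Lemma embedded_jordan_leq V (N : 'End(V)) a b : (a <= b)%N ->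
  embedded (jordan N a) (jordan N b).
Proof.
move=> ab.
pose g_ (u : {ffun 'I_a -> V}) : {ffun 'I_b -> V} := truncate b (coord u).
have g_lin : linear g_.
  move=> k u v; apply: coord_inj => n; rewrite coordP !coord_truncate.
  by case: ltnP => _; rewrite ?coordP // scaler0 addr0.
have gE u n : coord (lin_hom g_lin u) n = coord u n.
  rewrite lin_homE coord_truncate; case: ltnP => // h.
  by rewrite coord_ge // (leq_trans ab).
exists (lin_hom g_lin) => [u v uv|u]; apply: coord_inj => n.
  by rewrite -!gE uv.
by rewrite gE !coord_jordan !gE.
Qed.

Lemma embedded_nullity V V' (N : 'End(V)) (N' : 'End(V')) :
  embedded N N' -> (nullity N <= nullity N')%N.
Proof.
case=> g gi gN; rewrite /nullity -(limg_dim_eq (f := g)).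
  apply: dimvS; apply/subvP => _ /memv_imgP[v + ->].
  by rewrite !memv_ker -gN => /eqP->; rewrite raddf0.
by have /lker0P/eqP -> := gi; rewrite capv0.
Qed.

(** The number of Jordan blocks of size greater than [v]. *)
Definition long_blocks V (N : 'End(V)) v : nat :=
  \dim (lker N :&: limg (lpow N v)).

(** [N^v] maps the kernel of [N^(v+1)] onto [ker N] intersected with the image
    of [N^v]. *)
Lemma nullity_lpowS V (N : 'End(V)) v :
  nullity (lpow N v.+1) = (nullity (lpow N v) + long_blocks N v)%N.
Proof.
rewrite /nullity -(limg_ker_dim (lpow N v) (lker (lpow N v.+1))); congr (_ + _)%N.
  congr (\dim _); apply/capv_idPr; apply/subvP => u.
  by rewrite !memv_ker lpowS => /eqP ->; rewrite raddf0.
congr (\dim _); apply/vspaceP => w; apply/memv_imgP/idP => [[u + ->]|].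
  by rewrite memv_cap !memv_ker lpowS => ->; rewrite memv_img ?memvf.
rewrite memv_cap memv_ker => /andP[Nw /memv_imgP[u _ wE]].
by exists u => //; rewrite memv_ker lpowS -wE.
Qed.

Lemma long_blocks_le V (N : 'End(V)) v w : (v <= w)%N ->
  (long_blocks N w <= long_blocks N v)%N.
Proof.
move=> /subnKC <-; apply/dimvS/capvS => //; apply/subvP => _ /memv_imgP[u _ ->].
by rewrite lpowD memv_img ?memvf.
Qed.

Lemma long_blocks_embedded V V' (N : 'End(V)) (N' : 'End(V')) v :
  embedded N N' -> (long_blocks N v <= long_blocks N' v)%N.
Proof.
case=> g gi gN; rewrite /long_blocks -(limg_dim_eq (f := g)); last first.
  by have /lker0P/eqP -> := gi; rewrite capv0.
apply: dimvS; apply/subvP => _ /memv_imgP[u + ->].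
rewrite !memv_cap !memv_ker -gN => /andP[/eqP -> /memv_imgP[w _ ->]].
rewrite raddf0 eqxx /=; have -> : g (lpow N v w) = lpow N' v (g w).
  by elim: v => [|n IH]; rewrite ?lpow0 // !lpowS gN IH.
by rewrite memv_img ?memvf.
Qed.

End Embed.

Section Frobenius.
Variable K : fieldType.
Implicit Types V W : vectType K.
Variable p : nat.
Hypothesis pK : p \in [pchar K].

(** [T^p] acts on [V (x) k[x]/(x^(pa))] through [T^p] on [V] and [x^p], and
    [k[x]/(x^(pa))] is free over [k[x^p]] on [1, x, .., x^(p-1)]. *)
Lemma intertwined_frobenius V (N : 'End(V)) a :
  intertwined (lpow (jordan N (p * a)) p) (copies (jordan (lpow N p) a) p).
Proof.
have p_gt0 := prime_gt0 (pcharf_prime pK).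
pose g_ (u : {ffun 'I_(p * a) -> V}) : {ffun 'I_p -> {ffun 'I_a -> V}} :=
  truncate p (fun r => truncate a (fun j => coord u (p * j + r))).
pose h_ (w : {ffun 'I_p -> {ffun 'I_a -> V}}) : {ffun 'I_(p * a) -> V} :=
  truncate (p * a) (fun n => coord (coord w (n %% p)) (n %/ p)).
have g_lin : linear g_.
  move=> k u v; apply/ffunP => i; apply/ffunP => j.
  by rewrite !ffunE coordP.
have h_lin : linear h_.
  by move=> k u v; apply/ffunP => i; rewrite !ffunE !coordP.
have gE u r j : (r < p)%N -> coord (coord (lin_hom g_lin u) r) j = coord u (p * j + r).
  move=> rp; rewrite lin_homE coord_truncate rp coord_truncate; case: ltnP => // aj.
  by rewrite coord_ge // (leq_trans _ (leq_addr _ _)) // leq_mul2l aj orbT.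
have hE w n : coord (lin_hom h_lin w) n = coord (coord w (n %% p)) (n %/ p).
  rewrite lin_homE coord_truncate; case: ltnP => // h.
  by rewrite [RHS]coord_ge // leq_divRL // mulnC.
exists (lin_hom g_lin), (lin_hom h_lin); split=> u.
- by apply: coord_inj => n; rewrite hE gE ?ltn_mod // [(p * (_ %/ _))%N]mulnC -divn_eq.
- apply: coord_inj => r; apply: coord_inj => j.
  have [rp|pr] := ltnP r p; last by rewrite ![coord _ r]coord_ge.
  by rewrite gE // hE [(p * j)%N]mulnC modnMDl modn_small // divnMDl // divn_small // addn0.
- apply: coord_inj => r; apply: coord_inj => j.
  have [rp|pr] := ltnP r p; last by rewrite ![coord _ r]coord_ge.
  rewrite gE // coord_copies coord_jordan !gE //.
  rewrite coord_iter_jordan iter_shift_add_char // /shift_add mul1n.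
  by congr (_ + coord u _); rewrite mulnS; lia.
Qed.

(** Space and operator are bundled so that both can vary in recursions on lists
    of exponents. *)
Record kmod := KMod { kcar : vectType K; kop : 'End(kcar) }.

(** The direct sum of [p^k] copies. *)
Fixpoint kcopies k (M : kmod) : kmod :=
  if k is k'.+1 then KMod (copies (kop (kcopies k' M)) p) else M.

Lemma kcopies_jordan k M a :
  intertwined (jordan (kop (kcopies k M)) a) (kop (kcopies k (KMod (jordan (kop M) a)))).
Proof.
elim: k => [|k IH] /=; first exact: intertwined_refl.
exact/(intertwined_trans (intertwined_jordan_copies _ _ _))/intertwined_copies.
Qed.

Lemma kcopies_nullity k M a :
  nullity (lpow (kop (kcopies k M)) a) = (p ^ k * nullity (lpow (kop M) a))%N.
Proof.
elim: k => [|k IH] /=; first by rewrite mul1n.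
rewrite expnS -mulnA -IH -nullity_copies; apply: eq_nullity => u.
suff -> : lpow (copies (kop (kcopies k M)) p) a u =
          copies (lpow (kop (kcopies k M)) a) p u by [].
elim: a {IH} => [|a IHa]; first by apply: coord_inj => n; rewrite coord_copies !lpow0.
by rewrite lpowS IHa; apply: coord_inj => n; rewrite !coord_copies lpowS.
Qed.

End Frobenius.

Section TensorBlocks.
Variable K : fieldType.

Fixpoint tensor_blocks (l : seq nat) : kmod K :=
  if l is a :: l' then KMod (jordan (kop (tensor_blocks l')) a)
  else @KMod K K^o 0.

(** The number of Jordan blocks of [k[T]/(T^a_0) (x) .. (x) k[T]/(T^a_s)], which
    is also the length of
    [k[T_1, .., T_s]/(T_1^a_1, .., T_s^a_s, (T_1 + .. + T_s)^a_0)]. *)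
Definition num_blocks l : nat := nullity (kop (tensor_blocks l)).

Lemma num_blocks_nil : num_blocks [::] = 1%N.
Proof.
rewrite /num_blocks /nullity /= (_ : lker 0 = fullv); first by rewrite dimvf.
by apply/vspaceP => v; rewrite memv_ker zero_lfunE eqxx memvf.
Qed.

Lemma num_blocks_cons a l :
  num_blocks (a :: l) = nullity (lpow (kop (tensor_blocks l)) a).
Proof. exact: nullity_jordan. Qed.

Lemma intertwined_perm l l' : perm_eq l l' ->
  intertwined (kop (tensor_blocks l)) (kop (tensor_blocks l')).
Proof.
have rot_in l1 a l2 : intertwined (kop (tensor_blocks (a :: l1 ++ l2)))
                                  (kop (tensor_blocks (l1 ++ a :: l2))).
  elim: l1 => [|b l1 IH] /=; first exact: intertwined_refl.
  exact/(intertwined_trans (intertwined_swap _ _ _))/intertwined_jordan.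
elim: l l' => [|a l IH] l'.
  by rewrite perm_sym => /perm_nilP ->; exact: intertwined_refl.
move=> pl; have al' : a \in l' by rewrite -(perm_mem pl) mem_head.
case/splitPr: al' pl => l1 l2 pl.
apply: intertwined_trans (rot_in _ _ _); apply/intertwined_jordan/IH.
by rewrite -(perm_cons a) (permPl pl) perm_catC /= perm_cons perm_catC.
Qed.

Lemma num_blocks_perm l l' : perm_eq l l' -> num_blocks l = num_blocks l'.
Proof. by move=> /intertwined_perm/intertwined_nullity. Qed.

Lemma num_blocks_swap a b l : num_blocks [:: a, b & l] = num_blocks [:: b, a & l].
Proof. exact/intertwined_nullity/intertwined_swap. Qed.

Lemma num_blocks0 l : 0%N \in l -> num_blocks l = 0%N.
Proof.
move=> l0; rewrite (num_blocks_perm (perm_to_rem l0)) num_blocks_cons.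
exact: nullity_lpow0.
Qed.

Lemma num_blocks1 l : num_blocks (1%N :: l) = num_blocks l.
Proof. exact/intertwined_nullity/intertwined_jordan1. Qed.

Lemma embedded_blocks l l' : all2 leq l l' ->
  embedded (kop (tensor_blocks l)) (kop (tensor_blocks l')).
Proof.
elim: l l' => [|a l IH] [|b l'] //=; first by move=> _; exact: embedded_refl.
move=> /andP[ab /IH ll'].
exact/(embedded_trans (embedded_jordan_leq _ ab))/embedded_jordan.
Qed.

Lemma leq_num_blocks l l' : all2 leq l l' -> (num_blocks l <= num_blocks l')%N.
Proof. by move=> /embedded_blocks/embedded_nullity. Qed.

(** The increments of the block count in its first entry. As numbers of Jordan
    blocks they are monotone in [v] and in [l], which makes the count concave in
    each entry. *)
Definition block_slope v l : nat := long_blocks (kop (tensor_blocks l)) v.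

Lemma num_blocksS v l : num_blocks (v.+1 :: l) = (num_blocks (v :: l) + block_slope v l)%N.
Proof. by rewrite !num_blocks_cons nullity_lpowS. Qed.

Lemma block_slope_le v w l : (v <= w)%N -> (block_slope w l <= block_slope v l)%N.
Proof. exact: long_blocks_le. Qed.

Lemma leq_block_slope v l l' : all2 leq l l' -> (block_slope v l <= block_slope v l')%N.
Proof. by move=> ll'; apply/long_blocks_embedded/embedded_blocks. Qed.

Lemma block_slope0 l : block_slope 0 l = num_blocks l.
Proof.
by have := num_blocksS 0 l; rewrite num_blocks1 [in RHS]num_blocks0 ?mem_head.
Qed.

Lemma num_blocks_prod a l : (num_blocks (a :: l) <= \prod_(b <- l) b)%N.
Proof.
rewrite num_blocks_cons; apply: leq_trans (dimvS (subvf _)) _.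
elim: l {a} => [|b l IH] /=; first by rewrite big_nil dimvf.
rewrite big_cons dimvf /dim /=.
by rewrite card_ord leq_mul2l; move: IH; rewrite dimvf /dim => ->; rewrite orbT.
Qed.

Variable p : nat.
Hypothesis pK : p \in [pchar K].

Lemma num_blocks2 b l : (0 < b)%N -> ~~ (p %| b)%N ->
  num_blocks [:: 2, b & l] = (num_blocks (b.-1 :: l) + num_blocks (b.+1 :: l))%N.
Proof.
move=> b0 pb.
by rewrite num_blocks_swap num_blocks_cons nullity_jordan2_unit ?num_blocks_cons // -(dvdn_pcharf pK).
Qed.

Lemma num_blocks2_dvd b l : (p %| b)%N ->
  num_blocks [:: 2, b & l] = (2 * num_blocks (b :: l))%N.
Proof.
rewrite (dvdn_pcharf pK) => /eqP b0.
by rewrite num_blocks_swap num_blocks_cons nullity_jordan2_nonunit ?num_blocks_cons.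
Qed.

Lemma num_blocksSp_mul m l : (0 < m)%N -> ~~ (p %| m)%N ->
  num_blocks [:: p.+1, p * m & l]%N =
  (p.-1 * num_blocks (p * m :: l) + num_blocks (p * m.-1 :: l)
   + num_blocks (p * m.+1 :: l))%N.
Proof.
move=> m0 pm.
by rewrite num_blocks_swap num_blocks_cons nullity_jordanSp_mul ?num_blocks_cons // -(dvdn_pcharf pK).
Qed.

Lemma num_blocksSp_mulS m l : (2 < p)%N -> (0 < m)%N -> ~~ (p %| m)%N ->
    ~~ (p %| m.+1)%N ->
  num_blocks [:: p.+1, (p * m).+1 & l]%N =
  (p.-2 * num_blocks (p * m :: l) + num_blocks ((p * m + p).+1 :: l)
   + num_blocks (p * m + p.-1 :: l) + num_blocks ((p * m.-1).+1 :: l))%N.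
Proof.
move=> p2 m0 pm pm1.
by rewrite num_blocks_swap num_blocks_cons nullity_jordanSp_mulS ?num_blocks_cons // -(dvdn_pcharf pK).
Qed.

(** The [p]-th power of the operator for the exponents [p a_1, .., p a_s] is a
    sum of [p^s] copies of the operator for [a_1, .., a_s]. *)
Lemma num_blocks_frobenius a l :
  num_blocks (map (muln p) (a :: l)) = (p ^ size l * num_blocks (a :: l))%N.
Proof.
rewrite !num_blocks_cons -(kcopies_nullity p).
transitivity (nullity (lpow (lpow (kop (tensor_blocks (map (muln p) l))) p) a)).
  by apply: eq_nullity => v; rewrite lpow_lpow.
apply/intertwined_nullity/intertwined_lpow => {a}; elim: l => [|a l IH] /=.
  exists \1%VF, \1%VF; split=> v; rewrite !id_lfunE // zero_lfunE.
  by rewrite -(prednK (prime_gt0 (pcharf_prime pK))) lpowS zero_lfunE.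
apply: intertwined_trans (intertwined_frobenius pK _ _) _.
apply/intertwined_copies/(intertwined_trans _ (kcopies_jordan _ _ _ _)).
exact: intertwined_jordan.
Qed.

End TensorBlocks.

(** * The discrete wave equation *)

Section Wave.
Variables (R : realFieldType) (p : nat).

(** The discrete wave equation on a square of side [p] with zero boundary
    values. *)
Definition wave (W : nat -> nat -> R) :=
  [/\ forall c, (c <= p)%N -> W 0%N c = 0, forall c, (c <= p)%N -> W p c = 0,
      forall b, (b <= p)%N -> W b 0%N = 0, forall b, (b <= p)%N -> W b p = 0 &
      forall b c, (0 < b < p)%N -> (0 < c < p)%N ->
        W b.+1 c + W b.-1 c = W b c.+1 + W b c.-1].

(** d'Alembert: [G(c+b) + G(c-b)] for the odd [2p]-periodic extension [G] of [g].
    Truncated subtraction takes care of the signs since [g 0 = g p = 0]. *)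
Definition dalembert (g : nat -> R) b c :=
  g (minn (c + b) p) - g (minn p (2 * p - (c + b))) + (g (c - b)%N - g (b - c)%N).

Lemma dalembert_last g c : g 0%N = 0 -> g p = 0 -> (c <= p)%N ->
  dalembert g p c = - 2 * g (p - c)%N.
Proof.
move=> g0 gp cp; rewrite /dalembert.
have /minn_idPr -> := leq_addl c p.
have -> : (2 * p - (c + p) = p - c)%N by rewrite mul2n -addnn subnDr.
have /minn_idPr -> := leq_subr c p.
have -> : (c - p = 0)%N by apply/eqP; rewrite subn_eq0.
by rewrite gp g0; ring.
Qed.

(** d'Alembert's formula is used for the increments over two time steps: they
    involve four values of the first row, while the solution itself is a sum of
    many. *)
Lemma wave_step (W : nat -> nat -> R) : wave W -> forall b c, (b < p)%N -> (c <= p)%N ->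
  (if b is b'.+1 then W b.+1 c - W b' c else 2 * W 1%N c) = dalembert (W 1%N) b c.
Proof.
move=> [W0 Wp W_0 W_p Wst] b c bp cp.
have g0 : W 1%N 0%N = 0 by apply: W_0; lia.
have gp : W 1%N p = 0 by apply: W_p; lia.
have base x : (x <= p)%N -> 2 * W 1%N x = dalembert (W 1%N) 0 x.
  move=> xp; rewrite /dalembert addn0 subn0 sub0n g0 (minn_idPl xp).
  by rewrite (_ : minn _ _ = p) ?gp; [ring | lia].
elim/ltn_ind: b bp c cp => -[_ bp c cp|b IH bp c cp]; first exact: base.
have [c0|c_gt0] := posnP c.
  rewrite c0 !W_0; try lia.
  rewrite /dalembert add0n sub0n subn0 g0.
  by rewrite (minn_idPl (ltnW bp)) (_ : minn _ _ = p) ?gp; [ring | lia].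
have [pc|cltp] := leqP p c.
  have -> : c = p by lia.
  rewrite !W_p; try lia.
  rewrite /dalembert (_ : minn _ _ = p) ?gp; last by lia.
  rewrite (_ : minn _ _ = p - b.+1)%N; last by lia.
  by rewrite (_ : b.+1 - p = 0)%N ?g0; [ring | lia].
case: b bp IH => [|b] bp IH.
  have := Wst 1%N c ltac:(lia) ltac:(lia); rewrite /= !W0 // addr0 subr0 => ->.
  rewrite /dalembert subn1 addn1 (_ : 1 - c = 0)%N ?g0; last by lia.
  rewrite (minn_idPl cltp) (_ : minn _ _ = p) ?gp; last by lia.
  ring.
have IH1 x (xp : (x <= p)%N) := IH b.+1 (ltnSn _) (ltnW bp) x xp.
have IH0 := IH b (ltnW (ltnSn _)) (ltnW (ltnW bp)) c cp.
have st1 := Wst b.+2 c; have st0 := Wst b.+1 c.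
have E1 := IH1 c.+1 cltp; have E2 := IH1 c.-1 (leq_trans (leq_pred _) cp).
have dE : dalembert (W 1%N) b.+2 c = dalembert (W 1%N) b.+1 c.+1
    + dalembert (W 1%N) b.+1 c.-1 - dalembert (W 1%N) b c.
  rewrite /dalembert.
  have -> : (c + b.+2 = c.+1 + b.+1)%N by lia.
  have -> : (c.-1 + b.+1 = c + b)%N by lia.
  have -> : (c - b.+2 = c.-1 - b.+1)%N by lia.
  have -> : (b.+2 - c = b.+1 - c.-1)%N by lia.
  have -> : (c.+1 - b.+1 = c - b)%N by lia.
  have -> : (b.+1 - c.+1 = b - c)%N by lia.
  ring.
rewrite dE -E1 -E2 -IH0 /=.
have {}st1 := st1 ltac:(lia) ltac:(lia); have {}st0 := st0 ltac:(lia) ltac:(lia).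
move: st1 st0 => /=; case: b {IH IH1 IH0 E1 E2 dE} bp => [|b] bp st1 st0.
  rewrite W0 // in st0; rewrite !W0; try lia.
  lra.
have st' := Wst b.+1 c ltac:(lia) ltac:(lia); move: st' => /= st'.
lra.
Qed.

Lemma wave_sym1 (W : nat -> nat -> R) : wave W -> forall b, (0 < p)%N -> (b <= p)%N ->
  W b 1%N = W 1%N b.
Proof.
move=> wW b p_gt0; have [W0 Wp W_0 W_p Wst] := wW.
elim/ltn_ind: b => -[|[|b]] IH hb //.
  by rewrite W0 ?W_0 //; lia.
have := wave_step wW hb (_ : 1 <= p)%N; rewrite /= => /(_ ltac:(lia))/eqP.
rewrite subr_eq => /eqP ->; rewrite IH; try lia.
rewrite /dalembert add1n (minn_idPl hb) (_ : minn _ _ = p); last by lia.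
rewrite W_p; last by lia.
by rewrite subSS sub0n W_0 ?subn1 /=; [ring | lia].
Qed.

Lemma wave_rev (W : nat -> nat -> R) : wave W -> wave (fun b c => W (p - b)%N c).
Proof.
move=> [W0 Wp W_0 W_p Wst]; split=> [c cp|c cp|b bp|b bp|b c hb hc].
- by rewrite subn0 Wp.
- by rewrite subnn W0.
- by rewrite W_0 ?leq_subr.
- by rewrite W_p ?leq_subr.
- rewrite -Wst //; last by lia.
  have -> : (p - b.+1 = (p - b).-1)%N by lia.
  have -> : (p - b.-1 = (p - b).+1)%N by lia.
  by rewrite addrC.
Qed.

Lemma wave_last (W : nat -> nat -> R) : wave W -> forall c, (0 < p)%N -> (c <= p)%N ->
  W p.-1 c = W 1%N (p - c)%N.
Proof.
move=> wW c p0 cp; have := wave_sym1 (wave_rev wW) p0 cp.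
by rewrite subn1 => <-; rewrite wave_sym1 ?leq_subr.
Qed.

End Wave.

(** * Block counts on cells of side p *)

Section Interp.
Variables (R : realFieldType) (p : nat).
Implicit Types phi psi : nat -> R.
Hypothesis p_gt0 : (0 < p)%N.

Let p0 : p%:R != 0 :> R. Proof. by rewrite pnatr_eq0 -lt0n. Qed.

(** The deviation of [phi] from its linear interpolation on the cell
    [[p k, p (k + 1)]]. *)
Definition deviation phi k c : R :=
  phi (p * k + c)%N - phi (p * k)%N
  - c%:R / p%:R * (phi (p * k + p)%N - phi (p * k)%N).

Lemma deviation0 phi k : deviation phi k 0 = 0.
Proof. by rewrite /deviation addn0; field. Qed.

Lemma deviation_p phi k : deviation phi k p = 0.
Proof. by rewrite /deviation; field. Qed.

Lemma eq_deviation phi psi k c : phi =1 psi -> deviation phi k c = deviation psi k c.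
Proof. by move=> h; rewrite /deviation !h. Qed.

Lemma deviation_exchange (Z : nat -> nat -> R) n b m c :
  deviation (fun x => deviation (Z x) m c) n b =
  deviation (fun y => deviation (Z^~ y) n b) m c.
Proof. by rewrite /deviation; field. Qed.

(** At multiples of [p] the operation [phi |-> psi] of [V_2] doubles, which is
    what makes the linear interpolations of both sides agree. *)
Lemma deviation_step phi psi n b :
    (forall a, psi a = if (p %| a)%N then 2 * phi a else phi a.-1 + phi a.+1) ->
    (0 < b < p)%N ->
  deviation psi n b = deviation phi n b.+1 + deviation phi n b.-1.
Proof.
move=> h hb; rewrite /deviation !h dvdn_mulr // -mulnSr dvdn_mulr //.
have -> : (p %| p * n + b)%N = false.
  by rewrite dvdn_addr ?dvdn_mulr //; apply/negbTE; rewrite gtnNdvd; lia.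
have -> : (p * n + b).-1 = (p * n + b.-1)%N by lia.
rewrite -addnS -[b.+1%:R]natr1.
have -> : b%:R = b.-1%:R + 1 :> R by rewrite natr1 prednK //; lia.
by field.
Qed.

Lemma deviation_affine phi n c :
    (forall a, ~~ (p %| a)%N -> phi a.-1 + phi a.+1 = 2 * phi a) ->
  (c <= p)%N -> deviation phi n c = 0.
Proof.
move=> h; have st b : (0 < b < p)%N ->
    2 * deviation phi n b = deviation phi n b.+1 + deviation phi n b.-1.
  move=> hb; rewrite -(@deviation_step phi (fun a => 2 * phi a)) //.
    by rewrite /deviation; field.
  by move=> a; case: ifPn => // /h ->.
have lin b : (b <= p)%N -> deviation phi n b = b%:R * deviation phi n 1.
  elim/ltn_ind: b => -[|[|b]] IH hb; first by rewrite deviation0 mul0r.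
    by rewrite mul1r.
  have := st b.+1 hb; rewrite /= (IH b.+1) ?(IH b) //; [|lia..].
  rewrite -[b.+2%:R]natr1 -[b.+1%:R]natr1 => E; lra.
move=> cp; rewrite lin //; have := lin p (leqnn p).
by rewrite deviation_p => /esym/eqP; rewrite mulf_eq0 (negPf p0) => /eqP ->; rewrite mulr0.
Qed.

End Interp.

Section Recursion.
Variables (R : realFieldType) (K : fieldType) (p : nat).
Hypothesis pK : p \in [pchar K].

Let p_gt0 : (0 < p)%N := prime_gt0 (pcharf_prime pK).
Let p_gt1 : (1 < p)%N := prime_gt1 (pcharf_prime pK).
Let p0 : p%:R != 0 :> R. Proof. by rewrite pnatr_eq0 -lt0n. Qed.

Local Notation B l := ((num_blocks K l)%:R : R).

Lemma block_slopeE v l : B (v.+1 :: l) - B (v :: l) = (block_slope K v l)%:R.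
Proof. by rewrite num_blocksS natrD addrAC subrr add0r. Qed.

Lemma blocks2E l a : B [:: 2, a & l]%N =
  if (p %| a)%N then 2 * B (a :: l) else B (a.-1 :: l) + B (a.+1 :: l).
Proof.
case: ifPn => pa; first by rewrite (num_blocks2_dvd pK) // natrM.
have a_gt0 : (0 < a)%N by rewrite lt0n; apply: contraNneq pa => ->; exact: dvdn0.
by rewrite (num_blocks2 pK) // natrD.
Qed.

(** [V_2 (x) V_(pm)] is [2 V_(pm)]; letting [V_2] act on [V_a] instead gives the
    relation. *)
Lemma blocks_affine a m l : ~~ (p %| a)%N ->
  B [:: a.-1, p * m & l]%N + B [:: a.+1, p * m & l]%N = 2 * B [:: a, p * m & l]%N.
Proof.
move=> pa; have := blocks2E (p * m :: l)%N a; rewrite (negPf pa) => <-.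
rewrite -(num_blocks_swap K (p * m) a) -[2 * _]/(2 * _).
have <- : num_blocks K [:: p * m, 2, a & l]%N = num_blocks K [:: 2, a, p * m & l]%N.
  by apply/num_blocks_perm/permEl/(perm_catCA [:: _] [:: _; _]).
by rewrite num_blocks_swap blocks2E dvdn_mulr.
Qed.

Lemma deviation_blocks_mul n b m l : (b <= p)%N ->
  deviation p (fun a => B [:: a, p * m & l]%N) n b = 0.
Proof. by apply: deviation_affine => // a; exact: blocks_affine. Qed.

(** Between multiples of [p] the count is affine in either entry when the other
    one is a multiple of [p], so this is the deviation from the bilinear interpolation of the four
    corners of a cell. *)
Definition cell_wave n m l b c : R :=
  deviation p (fun a => B [:: a, p * m + c & l]%N) n b.

(** The wave equation says that [V_2] may act on either of the two entries. *)
Lemma cell_wave_wave n m l : wave p (cell_wave n m l).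
Proof.
split=> [c cp|c cp|b bp|b bp|b c hb hc]; rewrite /cell_wave.
- exact: deviation0.
- exact: deviation_p.
- by rewrite addn0 deviation_blocks_mul.
- by rewrite -mulnSr deviation_blocks_mul.
rewrite -(deviation_step p_gt0 n (blocks2E _) hb).
have E a : B [:: 2, a, p * m + c & l]%N =
    B [:: a, p * m + c.+1 & l]%N + B [:: a, p * m + c.-1 & l]%N.
  have -> : num_blocks K [:: 2, a, p * m + c & l]%N =
            num_blocks K [:: 2, p * m + c, a & l]%N.
    by apply: num_blocks_perm; rewrite perm_cons; apply/permEl/(perm_catCA [:: _] [:: _]).
  rewrite blocks2E dvdn_addr ?dvdn_mulr // gtnNdvd; try lia.
  rewrite addrC addnS -!(num_blocks_swap K a); congr (_ + (num_blocks K _)%:R).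
  by congr [:: _, _ & _]; lia.
by rewrite (eq_deviation p n b E) /deviation; field.
Qed.

Lemma cell_waveC n m l b c : (b <= p)%N -> (c <= p)%N ->
  cell_wave n m l b c = cell_wave m n l c b.
Proof.
have double n' m' b' c' : (b' <= p)%N -> cell_wave n' m' l b' c' =
    deviation p (fun a => deviation p (fun a' => B [:: a, a' & l]) m' c') n' b'.
  move=> hb'; rewrite deviation_exchange //.
  pose D y := deviation p (fun a => B [:: a, y & l]) n' b'.
  rewrite -[RHS]/(D (p * m' + c')%N - D (p * m')%N
                  - c'%:R / p%:R * (D (p * m' + p)%N - D (p * m')%N)).
  by rewrite -mulnSr /D !deviation_blocks_mul // subrr mulr0 !subr0.
move=> bp cp; rewrite double // deviation_exchange // double //.
by apply: eq_deviation => a; apply: eq_deviation => a'; rewrite num_blocks_swap.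
Qed.

Lemma deviation_cell_wave l k c : (c <= p)%N ->
  deviation p (fun a => B (a :: l)) k c = cell_wave k 0 l 1 c.
Proof.
move=> cp; rewrite -(wave_sym1 (cell_wave_wave k 0 l)) //.
rewrite /cell_wave muln0 add0n; apply: eq_deviation => a.
by rewrite num_blocks_swap num_blocks1.
Qed.

Lemma deviation_cell_wave_rev l k c : (c <= p)%N ->
  deviation p (fun a => B [:: a, c & l]) k p.-1 = deviation p (fun a => B (a :: l)) k (p - c).
Proof.
move=> cp; rewrite [RHS]deviation_cell_wave ?leq_subr //.
by rewrite -(wave_last (cell_wave_wave k 0 l)) // /cell_wave muln0.
Qed.

(** A value of the first row is a corner value for one more exponent, so
    relations between first rows need to be proved at a single point only. *)
Lemma cell_wave_shift n m l c : (c <= p)%N ->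
  cell_wave n m l 1 c = cell_wave n m (c :: l) 1 1.
Proof.
move=> cp; rewrite cell_waveC // [RHS]cell_waveC //.
rewrite {1}/cell_wave deviation_cell_wave // /cell_wave muln0 add0n.
apply: eq_deviation => a; congr (_%:R); apply: num_blocks_perm.
by rewrite perm_cons; apply/permEl/(perm_catCA [:: _] [:: _]).
Qed.

Lemma cell_wave0 m l c : (c <= p)%N ->
  cell_wave 0 m l 1 c = deviation p (fun a => B (a :: l)) m c.
Proof.
move=> cp; rewrite (cell_wave_shift _ _ _ cp) cell_waveC // -deviation_cell_wave //.
rewrite [RHS]deviation_cell_wave // /cell_wave muln0 add0n.
by apply: eq_deviation => a.
Qed.

Section LargeP.
Hypothesis p_gt2 : (2 < p)%N.

Lemma deviation_translate0 l :
  deviation p (fun a => B [:: p.+1, a & l]) 0 1 = deviation p (fun a => B (a :: l)) 1 1.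
Proof.
have := num_blocksSp_mul pK l (ltn0Sn 0) _; rewrite gtnNdvd // => /(_ isT).
rewrite /= muln0 => E; rewrite /deviation muln0 !add0n muln1.
rewrite muln1 in E; rewrite E.
rewrite [num_blocks K [:: p.+1, 0%N & l]]num_blocks0 ?inE ?eqxx ?orbT //.
rewrite (num_blocks_swap K p.+1 1) num_blocks1 addn1.
rewrite !natrD natrM [num_blocks K (0%N :: l)]num_blocks0 ?mem_head //.
rewrite muln2 -addnn.
have -> : p.-1%:R = p%:R - 1 :> R by rewrite -{2}(prednK p_gt0) -natr1 addrK.
by field.
Qed.

(** [V_(p+1)] translates by cells as [V_2] translates by units, up to a reflected
    term. *)
Lemma deviation_translate l m : (0 < m)%N -> (m.+1 < p)%N ->
  deviation p (fun a => B [:: p.+1, a & l]) m 1 =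
  deviation p (fun a => B (a :: l)) m.+1 1 + deviation p (fun a => B (a :: l)) m.-1 1
  + deviation p (fun a => B (a :: l)) m p.-1.
Proof.
move=> m_gt0 mp; rewrite /deviation -!mulnSr !addn1.
have n1 : ~~ (p %| m)%N by rewrite gtnNdvd //; lia.
have n2 : ~~ (p %| m.+1)%N by rewrite gtnNdvd //; lia.
rewrite (num_blocksSp_mulS pK) // !(num_blocksSp_mul pK) //= !prednK //.
rewrite !natrD !natrM -mulnSr.
have -> : p.-1%:R = p%:R - 1 :> R by rewrite -{2}(prednK p_gt0) -natr1 addrK.
have -> : p.-2%:R = p%:R - 2 :> R.
  by rewrite -(natrB _ (ltnW p_gt2)) subn2.
by field.
Qed.

Lemma cell_wave_sym0 n l c : (c <= p)%N -> cell_wave n 0 l 1 c = cell_wave 0 n l 1 c.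
Proof. by move=> cp; rewrite !(cell_wave_shift _ _ _ cp) cell_waveC. Qed.

(** With the additional exponent [p + 1], let [V_(p+1)] act on either of the two
    distinguished entries; this gives the recursions over the cells. *)
Lemma cell_wave_rec1 m l c : (0 < m)%N -> (m.+1 < p)%N -> (c <= p)%N ->
  cell_wave 1 m l 1 c = cell_wave 0 m.+1 l 1 c + cell_wave 0 m.-1 l 1 c
    + deviation p (fun a => B (a :: l)) m (p - c).
Proof.
move=> m_gt0 mp cp; rewrite !(cell_wave_shift _ _ _ cp).
rewrite {1}/cell_wave -deviation_translate0.
transitivity (cell_wave 0 m (p.+1 :: c :: l) 1 1).
  apply: eq_deviation => a; congr (_%:R); apply: num_blocks_perm.
  by apply/permEl/(perm_catCA [:: _] [:: _; _]).
rewrite cell_wave0 // -deviation_cell_wave_rev // !cell_wave0 //.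
rewrite -deviation_translate //.
by apply: eq_deviation => a; rewrite num_blocks_swap.
Qed.

Lemma cell_wave_recS n m l c : (0 < m)%N -> (m.+1 < p)%N -> (n.+2 < p)%N -> (c <= p)%N ->
  cell_wave n.+2 m l 1 c = cell_wave n.+1 m.+1 l 1 c + cell_wave n.+1 m.-1 l 1 c
    - cell_wave n m l 1 c.
Proof.
move=> m_gt0 mp np cp; rewrite !(cell_wave_shift _ _ _ cp); move: (c :: l) => {c cp}l.
have X n' m' : (0 < n')%N -> (n'.+1 < p)%N ->
    cell_wave n' m' (p.+1 :: l) 1 1 =
    cell_wave n'.+1 m' l 1 1 + cell_wave n'.-1 m' l 1 1 + cell_wave n' m' l p.-1 1.
  move=> n'_gt0 n'p; rewrite /cell_wave -deviation_translate //.
  apply: eq_deviation => a; congr (_%:R); apply: num_blocks_perm.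
  by apply/permEl/(perm_catCA [:: _; _] [:: _]).
have := X n.+1 m isT np; rewrite cell_waveC // X //= => E.
have last : cell_wave n.+1 m l p.-1 1 = cell_wave m n.+1 l p.-1 1.
  by rewrite (wave_sym1 (cell_wave_wave _ _ _)) ?leq_pred // cell_waveC ?leq_pred.
rewrite last in E; rewrite (cell_waveC n.+1 m.+1) // (cell_waveC n.+1 m.-1) //.
by have -> := addIr _ E; rewrite addrK.
Qed.

End LargeP.

(** The slope of the block count along the first variable is monotone, and by
    d'Alembert the sums of two consecutive slopes are explicit. *)
Lemma slope_sandwich n m l b c (g := cell_wave n m l 1)
    (lam := (B [:: p * n + p, p * m + c & l]%N - B [:: p * n, p * m + c & l]%N) / p%:R)
    (s := B [:: (p * n + b).+1, p * m + c & l]%N - B [:: p * n + b, p * m + c & l]%N) :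
  (b < p)%N -> (c <= p)%N ->
  lam + dalembert p g b.+1 c / 2 <= s <= lam + dalembert p g b c / 2.
Proof.
move=> bp cp; have wW := cell_wave_wave n m l; have [W0 Wp W_0 W_p _] := wW.
pose sl b := B [:: (p * n + b).+1, p * m + c & l]%N - B [:: p * n + b, p * m + c & l]%N.
have slE b' : sl b' = lam + cell_wave n m l b'.+1 c - cell_wave n m l b' c.
  rewrite /sl /lam /cell_wave /deviation addnS -[b'.+1%:R]natr1.
  by field.
have sl_le b' : sl b'.+1 <= sl b'.
  by rewrite /sl !block_slopeE ler_nat block_slope_le // addnS.
rewrite (_ : s = sl b) //; apply/andP; split.
  have [bp1|pb] := ltnP b.+1 p.
    rewrite -(wave_step wW bp1 cp) /=; have := sl_le b; rewrite !slE; lra.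
  have bE : b.+1 = p by apply/eqP; rewrite eqn_leq bp.
  have g0 : g 0%N = 0 by apply: W_0; exact: p_gt0.
  have gp : g p = 0 by apply: W_p; exact: p_gt0.
  rewrite slE bE Wp // -[b]/(b.+1.-1) bE (wave_last wW) // dalembert_last //.
  rewrite -/g; lra.
rewrite -(wave_step wW bp cp); case: b bp s => [|b] bp s; rewrite slE.
  rewrite W0 //; lra.
by have := sl_le b; rewrite !slE; lra.
Qed.

End Recursion.

(** * Bounds and stability for large characteristic *)

Section Bounds.
Variables (R : realDomainType) (K : fieldType).
Local Notation B l := ((num_blocks K l)%:R : R).

Lemma prod_leq_exp (l : seq nat) M : all (leq^~ M) l -> (\prod_(a <- l) a <= M ^ size l)%N.
Proof.
elim: l => [|a l IH] /=; first by rewrite big_nil.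
by case/andP=> aM /IH h; rewrite big_cons expnS leq_mul.
Qed.

(** The slopes are largest at [0], where they count blocks for the other
    exponents. *)
Lemma block_slope_bound v l M : (0 < size l)%N -> all (leq^~ M) l ->
  (block_slope K v l <= M ^ (size l).-1)%N.
Proof.
case: l => // a l _ /= /andP[_ h]; apply: leq_trans (block_slope_le _ _ (leq0n v)) _.
rewrite block_slope0; apply: leq_trans (num_blocks_prod _ _ _) _.
exact: prod_leq_exp.
Qed.

Lemma num_blocks_add a d l M : (0 < size l)%N -> all (leq^~ M) l ->
  (num_blocks K (a :: l) <= num_blocks K ((a + d)%N :: l)
    <= num_blocks K (a :: l) + d * M ^ (size l).-1)%N.
Proof.
move=> l0 lM; elim: d => [|d /andP[IH1 IH2]]; first by rewrite addn0 mul0n addn0 leqnn.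
rewrite addnS num_blocksS (leq_trans IH1) ?leq_addr //=.
by rewrite mulSnr addnA leq_add // block_slope_bound.
Qed.

Lemma num_blocks_lip1 a a' l M : (0 < size l)%N -> all (leq^~ M) l ->
  `|B (a :: l) - B (a' :: l)| <= `|a%:R - a'%:R| * M%:R ^+ (size l).-1.
Proof.
move=> l0 lM; wlog aa' : a a' / (a <= a')%N => [W|].
  by case: (leqP a a') => [/W //|/ltnW/W]; rewrite distrC [`|a'%:R - _|]distrC.
have /andP[h1 h2] := num_blocks_add a (a' - a) l0 lM; rewrite subnKC // in h1 h2.
rewrite distrC [`|a%:R - _|]distrC -!natrB // !normr_nat -natrX -natrM ler_nat.
by rewrite leq_subLR.
Qed.

Lemma num_blocks_lip l l' l1 M : size l = size l' -> (1 < size (l1 ++ l))%N ->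
    all (leq^~ M) (l1 ++ l) -> all (leq^~ M) l' ->
  `|B (l1 ++ l) - B (l1 ++ l')| <=
  (\sum_(j < size l) `|(nth 0 l j)%:R - (nth 0 l' j)%:R|) * M%:R ^+ (size (l1 ++ l)).-2.
Proof.
elim: l l' l1 => [|a l IH] [|a' l'] l1 //= => [_ _ _ _|[sl] s1 lM /andP[a'M l'M]].
  by rewrite subrr normr0 big_ord0 mul0r.
rewrite big_ord_recl /= mulrDl.
rewrite -[X in `|X|](subrKA (B (rcons l1 a' ++ l))).
apply: le_trans (ler_normD _ _) (lerD _ _).
  have pm b : num_blocks K (l1 ++ b :: l) = num_blocks K (b :: l1 ++ l).
    by apply/num_blocks_perm/permEl/(perm_catCA _ [:: b]).
  rewrite cat_rcons !pm; have -> : (size (l1 ++ a :: l)).-2 = (size (l1 ++ l)).-1.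
    by rewrite !size_cat /= addnS.
  apply: num_blocks_lip1; first by move: s1; rewrite !size_cat /= addnS.
  by move: lM; rewrite !all_cat /= => /andP[-> /andP[_ ->]].
rewrite -cat_rcons.
have -> : (size (l1 ++ a :: l)).-2 = (size (rcons l1 a' ++ l)).-2.
  by rewrite !size_cat size_rcons /= addnS.
apply: IH => //; first by move: s1; rewrite !size_cat size_rcons /= addnS.
by move: lM; rewrite !all_cat /= all_rcons a'M /= => /andP[-> /andP[_ ->]].
Qed.

Lemma num_blocks_pair a b : num_blocks K [:: a; b] = minn a b.
Proof.
rewrite num_blocks_cons.
pose f (i : 'I_b) : 'End(K^o) := if (i < a)%N then 0 else \1%VF.
rewrite (@nullity_diag _ _ _ _ _ f) => [|u].
  have E i : nullity (f i) = (i < a)%N.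
    rewrite /f /nullity; case: ifP => _; last first.
      apply/eqP; rewrite dimv_eq0 -subv0; apply/subvP => v.
      by rewrite memv_ker id_lfunE => /eqP ->; exact: mem0v.
    rewrite (_ : lker 0 = fullv) ?dimvf //.
    by apply/vspaceP => v; rewrite memv_ker zero_lfunE eqxx memvf.
  under eq_bigr => i _ do rewrite E.
  rewrite -(big_mkord xpredT (fun i => nat_of_bool (i < a)%N)).
  elim: b {f E} => [|b IH]; first by rewrite big_geq // minn0.
  rewrite big_nat_recr //= IH; case: ltnP => h; lia.
have powE n : coord (lpow (jordan (0 : 'End(K^o)) b) a u) n = coord u (n + a).
  elim: a n {f} => [|a IH] n; first by rewrite lpow0 addn0.
  by rewrite lpowS coord_jordan IH zero_lfunE add0r IH addSnnS.
rewrite coord_eq0; split=> [h i|h n]; rewrite ?powE.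
  rewrite /f; case: ltnP => [_|ai]; first by rewrite zero_lfunE.
  by rewrite id_lfunE -coord_ord; have := h (i - a)%N; rewrite powE subnK.
have [hn|hn] := ltnP (n + a) b; last by rewrite coord_ge.
rewrite -[(n + a)%N]/(val (Ordinal hn)) coord_ord.
by have := h (Ordinal hn); rewrite /f /= ltnNge leq_addl /= id_lfunE.
Qed.

End Bounds.

(** For entries small compared with the characteristic only the recursion by
    [V_2] is used, as in characteristic zero. *)
Lemma num_blocks_stable (k : nat -> fieldType)
    (char_k : forall p, prime p -> p \in [pchar (k p)]) (l : seq nat) :
  exists n P, forall p, prime p -> (P <= p)%N -> num_blocks (k p) l = n.
Proof.
have [m] := ubnP (size l); elim: m l => // m IHm l.
case: l => [|a [|b l]] /=.
- by move=> _; exists 1%N, 0%N => p _ _; exact: num_blocks_nil.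
- move=> _; exists (0 < a)%N, 0%N => p _ _; case: a => [|a].
    by rewrite num_blocks0 ?mem_head.
  by rewrite -num_blocks1 num_blocks_pair; case: a.
move=> hm; elim/ltn_ind: a b => a IHa b.
case: b => [|b]; first by exists 0%N, 0%N => p _ _; rewrite num_blocks0 ?inE ?eqxx ?orbT.
case: a IHa => [|[|a]] IHa.
- by exists 0%N, 0%N => p _ _; rewrite num_blocks0 ?mem_head.
- have [n [P h]] := IHm (b.+1 :: l) hm.
  by exists n, P => p pp Pp; rewrite num_blocks1 h.
have [n1 [P1 h1]] := IHa a.+1 (ltnSn _) b.
have [n2 [P2 h2]] := IHa a.+1 (ltnSn _) b.+2.
have [n3 [P3 h3]] := IHa a (ltnW (ltnSn _)) b.+1.
exists (n1 + n2 - n3)%N, (maxn P1 (maxn P2 (maxn P3 (maxn a.+2 b.+2)))) => p pp.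
rewrite !geq_max => /and5P[p1 p2 p3 pa pb].
have pK := char_k p pp.
have E1 := num_blocks2 pK (b.+1 :: l) (ltn0Sn a) (negbT (gtnNdvd (ltn0Sn a) pa)).
have E2 := num_blocks2 pK (a.+1 :: l) (ltn0Sn b) (negbT (gtnNdvd (ltn0Sn b) pb)).
have E : num_blocks (k p) [:: 2, a.+1, b.+1 & l]%N = num_blocks (k p) [:: 2, b.+1, a.+1 & l]%N.
  by apply: num_blocks_perm; rewrite perm_cons; apply/permEl/(perm_catCA [:: _] [:: _]).
move: E; rewrite E1 E2 /= => E.
rewrite -(h1 p pp p1) -(h2 p pp p2) -(h3 p pp p3).
by rewrite (num_blocks_swap _ a.+1 b) (num_blocks_swap _ a.+1 b.+2) -E addKn.
Qed.

(** * Scaling limits *)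

Lemma near_prime_infty (P : nat -> Prop) N :
  (forall p, prime p -> (N <= p)%N -> P p) -> prime_infty P.
Proof. by move=> h; exists N => // p Np pp; exact: h. Qed.

Global Instance prime_infty_filter : ProperFilter prime_infty.
Proof.
apply: Build_ProperFilter_ex => P [N _ h].
by have [p Np pp] := prime_above N; exists p; apply: h => //=; exact: ltnW.
Qed.

Section Asymptotics.
Variables (R : realType) (k : nat -> fieldType).
Hypothesis char_k : forall p, prime p -> p \in [pchar (k p)].

Local Notation B p l := ((num_blocks (k p) l)%:R : R).

Definition floors (x : seq R) p : seq nat := [seq Num.truncn (y * p%:R) | y <- x].

Definition nonnegs (x : seq R) := all (fun y => 0 <= y) x.

(** This will be the kernel function in the limit of large characteristic. *)
Definition density (x : seq R) : R :=
  lim (B p (floors x p) / p%:R ^+ (size x).-1 @[p --> prime_infty]).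

Definition has_density (x : seq R) : Prop :=
  cvg (B p (floors x p) / p%:R ^+ (size x).-1 @[p --> prime_infty]).

Section Along.
Context {I : Type} {F : set_system I} {FF : Filter F}.
Variable q : I -> nat.
Hypothesis hq : q i @[i --> F] --> prime_infty.

Lemma near_prime N : \forall i \near F, prime (q i) /\ (N <= q i)%N.
Proof. exact: (hq (near_prime_infty (N := N) (fun p pp Np => conj pp Np))). Qed.

Lemma cvg_near_eq (f g : I -> R) (l : R) : (\forall i \near F, f i = g i) ->
  f i @[i --> F] --> l -> g i @[i --> F] --> l.
Proof. by move=> fg fl; apply: cvg_trans fl; exact: near_eq_cvg. Qed.

Lemma cvg_invq : (q i)%:R^-1 @[i --> F] --> (0 : R).
Proof.
apply/cvgr0Pnorm_le => e e0.
have [N hN] : exists N : nat, e^-1 < N%:R.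
  by exists (Num.truncn e^-1).+1; exact: truncnS_gt.
have := near_prime N; apply: filterS => i [qp Nq].
rewrite ger0_norm ?invr_ge0 // invf_ple ?posrE ?ltr0n ?prime_gt0 //.
by apply: le_trans (ltW hN) _; rewrite ler_nat.
Qed.

(** Exponents that grow like [y q]. The index ranges over an arbitrary filter
    because later the prime [q] varies together with an increment of [r]. *)
Definition tends (a : I -> nat) (y : R) : Prop := (a i)%:R / (q i)%:R @[i --> F] --> y.

Lemma eq_tends a b (y z : R) : a =1 b -> y = z -> tends a y -> tends b z.
Proof. by move=> /funext -> ->. Qed.

Definition scaled (c : I -> seq nat) (x : seq R) :=
  (forall i, size (c i) = size x) /\
  forall j, (j < size x)%N -> tends (fun i => nth 0%N (c i) j) (nth 0 x j).

Lemma scaled_cons a c y x : tends a y -> scaled c x ->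
  scaled (fun i => a i :: c i) (y :: x).
Proof.
move=> ay [sc cx]; split=> [i|[|j] hj] /=; rewrite ?sc //.
exact: cx.
Qed.

Lemma tends_floor_of (z : I -> R) y : (\forall i \near F, 0 <= z i) ->
  z i @[i --> F] --> y -> tends (fun i => Num.truncn (z i * (q i)%:R)) y.
Proof.
move=> z0 zy; rewrite /tends.
apply: (@squeeze_cvgr _ _ _ _ (fun i => z i - (q i)%:R^-1) z) => //.
  have := near_prime 0; apply: filterS2 z0 => i z0 [qp _].
  have q0 : 0 < (q i)%:R :> R by rewrite ltr0n prime_gt0.
  have zq0 : 0 <= z i * (q i)%:R by rewrite mulr_ge0 // ltW.
  have /andP[h1 h2] := truncn_itv zq0.
  apply/andP; split; last by rewrite ler_pdivrMr.
  rewrite ler_pdivlMr // mulrBl mulVf ?gt_eqF // lerBlDr natr1; exact: ltW.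
by rewrite -[X in _ --> X]subr0; apply: cvgB => //; exact: cvg_invq.
Qed.

Lemma tends_floor y : 0 <= y -> tends (fun i => Num.truncn (y * (q i)%:R)) y.
Proof.
by move=> y0; apply: tends_floor_of; [exact: nearW | exact: cvg_cst].
Qed.

Lemma tends_cst n : tends (fun i => n * q i)%N n%:R.
Proof.
apply: cvg_near_cst; have := near_prime 0; apply: filterS => i [qp _].
by rewrite natrM mulfK // pnatr_eq0 -lt0n prime_gt0.
Qed.

Lemma tendsD a b y z : tends a y -> tends b z -> tends (fun i => a i + b i)%N (y + z).
Proof.
move=> ay bz; apply: cvg_near_eq (cvgD ay bz).
by apply: nearW => i; rewrite /= natrD mulrDl.
Qed.

Lemma cvg_max (f g : I -> R) y z : f i @[i --> F] --> y -> g i @[i --> F] --> z ->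
  Num.max (f i) (g i) @[i --> F] --> Num.max y z.
Proof.
move=> fy gz; rewrite (_ : (fun i => _) = fun i => (f i + g i + `|f i - g i|) / 2).
  rewrite maxr_absE; apply: cvgMl; apply: cvgD; first exact: cvgD.
  by apply: cvg_norm; apply: cvgB.
by apply/funext => i; rewrite maxr_absE.
Qed.

Lemma tendsB a b y z : tends a y -> tends b z ->
  tends (fun i => a i - b i)%N (Num.max 0 (y - z)).
Proof.
move=> ay bz; apply: cvg_near_eq (cvg_max (cvg_cst 0) (cvgB ay bz)).
have := near_prime 0; apply: filterS => i [qp _] /=.
have q0 : 0 < (q i)%:R :> R by rewrite ltr0n prime_gt0.
rewrite -mulrBl -[0](mul0r (q i)%:R^-1) -maxr_pMl ?invr_ge0 ?ltW //; congr (_ * _).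
have [ab|/ltnW ba] := leqP (a i) (b i).
  have /eqP -> := ab; apply/max_idPl.
  by rewrite subr_le0 ler_nat.
by rewrite natrB //; apply/max_idPr; rewrite subr_ge0 ler_nat.
Qed.

Lemma cvg_min (f g : I -> R) y z : f i @[i --> F] --> y -> g i @[i --> F] --> z ->
  Num.min (f i) (g i) @[i --> F] --> Num.min y z.
Proof.
move=> fy gz; rewrite (_ : (fun i => _) = fun i => (f i + g i - `|f i - g i|) / 2).
  rewrite minr_absE; apply: cvgMl; apply: cvgB; first exact: cvgD.
  by apply: cvg_norm; apply: cvgB.
by apply/funext => i; rewrite minr_absE.
Qed.

Lemma tends_min a b y z : tends a y -> tends b z ->
  tends (fun i => minn (a i) (b i)) (Num.min y z).
Proof.
move=> ay bz; apply: cvg_near_eq (cvg_min ay bz).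
apply: nearW => i; rewrite -minr_pMl ?invr_ge0 //; congr (_ * _).
by case: leqP => ab; [apply/min_idPl|apply/min_idPr]; rewrite ler_nat // ltnW.
Qed.

Lemma seq_bounded (x : seq R) : exists X : nat, forall j, (j < size x)%N -> nth 0 x j < X%:R.
Proof.
elim: x => [|y x [X hX]]; first by exists 0%N.
exists (X + (Num.truncn y).+1)%N => -[_|j hj] /=.
  by apply: lt_le_trans (truncnS_gt y) _; rewrite ler_nat leq_addl.
by apply: lt_le_trans (hX _ hj) _; rewrite ler_nat leq_addr.
Qed.

Lemma scaled_bounded c x : scaled c x -> exists X : nat,
  \forall i \near F, all (leq^~ (X * q i)%N) (c i).
Proof.
move=> [sc cx]; have [X hX] := seq_bounded x; exists X.
have H : \forall i \near F, forall j : 'I_(size x), (nth 0%N (c i) j)%:R / (q i)%:R < X%:R :> R.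
  apply: filter_forall => j; have := cx j (ltn_ord j).
  by move=> /cvgr_lt; apply; exact: hX.
have := near_prime 0; apply: filterS2 H => i H [qp _].
apply/(all_nthP 0%N) => j; rewrite sc => hj; have := H (Ordinal hj).
by rewrite /= ltr_pdivrMr ?ltr0n ?prime_gt0 // -natrM ltr_nat => /ltnW.
Qed.

Lemma scaled_floors x : nonnegs x -> scaled (fun i => floors x (q i)) x.
Proof.
move=> x0; split=> [i|j hj]; first by rewrite size_map.
have := tends_floor (allP x0 _ (mem_nth 0 hj)).
by under [in X in X -> _]eq_fun do rewrite -(nth_map 0 0%N (fun y => Num.truncn (y * _))) //.
Qed.

(** Block counts are Lipschitz, so their scaling limit does not depend on how
    the scaled point is approximated. *)
Lemma cvg_density c x : (1 < size x)%N -> nonnegs x -> has_density x -> scaled c x ->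
  B (q i) (c i) / (q i)%:R ^+ (size x).-1 @[i --> F] --> density x.
Proof.
move=> sx x0 dx sc; have sf := scaled_floors x0.
have lim_f : B (q i) (floors x (q i)) / (q i)%:R ^+ (size x).-1 @[i --> F] --> density x.
  exact: (cvg_comp _ _ hq dx).
rewrite -[density x]addr0.
rewrite (_ : (fun i => _) = fun i => B (q i) (floors x (q i)) / (q i)%:R ^+ (size x).-1
   + (B (q i) (c i) / (q i)%:R ^+ (size x).-1
   - B (q i) (floors x (q i)) / (q i)%:R ^+ (size x).-1)); last first.
  by apply/funext => i; rewrite addrC subrK.
apply: cvgD => //.
have [X1 hX1] := scaled_bounded sc; have [X2 hX2] := scaled_bounded sf.
pose X := maxn X1 X2.
pose bnd i := (\sum_(j < size x) `|(nth 0%N (c i) j)%:R / (q i)%:R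
   - (nth 0%N (floors x (q i)) j)%:R / (q i)%:R|) * X%:R ^+ (size x).-2 : R.
have bnd0 : bnd i @[i --> F] --> 0.
  rewrite -(mul0r (X%:R ^+ (size x).-2)); apply: cvgMl.
  have {2}<- : \sum_(j < size x) `|nth 0 x j - nth 0 x j| = 0 :> R.
    by rewrite big1 // => j _; rewrite subrr normr0.
  apply: (@cvg_big R _ +%R) => [|j _]; first exact: add_continuous.
  by apply: cvg_norm; apply: cvgB; [apply: sc.2|apply: sf.2].
apply/norm_cvg0P; apply: (squeeze_cvgr (f := fun=> 0) (h := bnd)) bnd0.
  have := near_prime 0; apply: filterS3 hX1 hX2 => i h1 h2 [qp _].
  have q0 : 0 < (q i)%:R :> R by rewrite ltr0n prime_gt0.
  have q00 : (q i)%:R != 0 :> R by rewrite gt_eqF.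
  have sz : (size x).-1 = (size x).-2.+1 by lia.
  have le_all Y l : (Y <= X)%N -> all (leq^~ (Y * q i)%N) l -> all (leq^~ (X * q i)%N) l.
    by move=> YX; apply: sub_all => z /leq_trans -> //; rewrite leq_mul2r YX orbT.
  have := @num_blocks_lip R (k (q i)) (c i) (floors x (q i)) [::] (X * q i).
  rewrite /= size_map sc.1 => /(_ erefl sx (le_all _ _ (leq_maxl _ _) h1)).
  move=> /(_ (le_all _ _ (leq_maxr _ _) h2)) lip.
  have qn0 n : 0 <= (q i)%:R ^+ n :> R by rewrite exprn_ge0 // ltW.
  rewrite normr_ge0 /= -mulrBl normrM normfV [X in _ / X]ger0_norm //.
  rewrite ler_pdivrMr ?exprn_gt0 //; apply: le_trans lip _.
  rewrite /bnd natrM exprMn sz exprS /= mulrA -[leRHS]mulrA [X in _ <= _ * X]mulrC.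
  rewrite -!mulrA mulrC [leRHS]mulrC -!mulrA [leRHS]mulrC mulrAC.
  rewrite [leLHS]mulrC -!mulrA ler_wpM2l // ler_wpM2l ?exprn_ge0 //.
  rewrite mulr_sumr.
  rewrite le_eqVlt; apply/orP; left; apply/eqP/eq_bigr => j _.
  rewrite -[X in X * _](@ger0_norm _ (q i)%:R) ?ltW // -normrM mulrBr.
  by rewrite !mulrA ![(q i)%:R * _]mulrC !mulfK.
exact: cvg_cst.
Qed.

End Along.
End Asymptotics.

(** * Scaling limits of the slopes *)

Section Densities.
Variables (R : realType) (k : nat -> fieldType).
Hypothesis char_k : forall p, prime p -> p \in [pchar (k p)].

Local Notation B p l := ((num_blocks (k p) l)%:R : R).

Lemma is_cvg_near_eq (f g : nat -> R) : (\forall p \near prime_infty, f p = g p) ->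
  cvg (f p @[p --> prime_infty]) -> cvg (g p @[p --> prime_infty]).
Proof.
by move=> fg /cvg_ex[l fl]; apply/cvg_ex; exists l; exact: cvg_near_eq fl.
Qed.

Let idP : id p @[p --> prime_infty] --> prime_infty.
Proof. exact: cvg_id. Qed.

(** Along multiples of [p] in one variable the count is multilinear on the cells
    of side [p] in the others, with corner values [p^s L_p(m)] that do not
    depend on large [p]. *)
Lemma is_cvg_corner (x : seq R) n l : nonnegs x ->
  cvg (B p (map (muln p) (n :: l) ++ floors x p)
       / p%:R ^+ (size l + size x) @[p --> prime_infty]).
Proof.
elim: x n l => [|y x IH] n l /= x0.
  have [v [P h]] := num_blocks_stable char_k (n :: l).
  apply: (@is_cvg_near_eq (fun=> v%:R)); last exact: is_cvg_cst.
  apply: (near_prime_infty (N := P)) => p pp Pp.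
  rewrite cats0 addn0 -(map_cons (muln p)) (num_blocks_frobenius (char_k pp)) h //.
  rewrite natrM natrX mulrAC mulfV ?mul1r // expf_neq0 // pnatr_eq0 -lt0n.
  exact: prime_gt0.
move: x0 => /andP[y0 x0]; pose m := Num.truncn y.
pose c p := (Num.truncn (y * p%:R) - p * m)%N.
have cvg_c : (c p)%:R / p%:R @[p --> prime_infty] --> y - m%:R.
  apply: cvg_near_eq (cvgB (tends_floor idP y0) (cvg_cst (m%:R : R))).
  apply: (near_prime_infty (N := 0)) => p pp _ /=.
  have p0 : p%:R != 0 :> R by rewrite pnatr_eq0 -lt0n prime_gt0.
  rewrite natrB; last first.
    rewrite truncn_ge_nat ?mulr_ge0 // natrM mulrC ler_wpM2r //.
    by rewrite truncn_le.
  by rewrite mulrBl natrM mulrAC mulfV // mul1r.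
have := IH m (n :: l) x0; have := IH m.+1 (n :: l) x0.
move=> /cvg_ex[l1 h1] /cvg_ex[l0 h0]; apply/cvg_ex.
exists (l0 + (y - m%:R) * (l1 - l0)).
apply: cvg_near_eq (cvgD h0 (cvgM cvg_c (cvgB h1 h0))).
apply: (near_prime_infty (N := 0)) => p pp _ /=.
have pK := char_k pp; have p_gt0 := prime_gt0 pp.
have p0 : p%:R != 0 :> R by rewrite pnatr_eq0 -lt0n.
set fl := floors x p; set pl := map (muln p) l.
have vE : Num.truncn (y * p%:R) = (p * m + c p)%N.
  rewrite /c subnKC // truncn_ge_nat ?mulr_ge0 // natrM mulrC ler_wpM2r //.
  by rewrite truncn_le.
have cp : (c p <= p)%N.
  rewrite leq_subLR -mulnSr -ltnS truncn_lt_nat ?mulr_ge0 //.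
  rewrite (lt_le_trans (_ : _ < (p * m.+1)%:R)) ?ler_nat ?leqnSn //.
  by rewrite natrM mulrC ltr_pM2l ?ltr0n // truncnS_gt.
have /eqP := deviation_blocks_mul R pK m n (pl ++ fl) cp.
rewrite /deviation -mulnSr -vE subr_eq0 subr_eq => /eqP E.
have -> : num_blocks (k p) [:: (p * n)%N & pl ++ Num.truncn (y * p%:R) :: fl] =
          num_blocks (k p) [:: Num.truncn (y * p%:R), (p * n)%N & pl ++ fl].
  apply/num_blocks_perm/permEl.
  exact: (perm_catCA ((p * n)%N :: pl) [:: Num.truncn (y * p%:R)]).
rewrite E !addnS -!mulrBl mulrA -mulrDl; congr (_ / _).
by rewrite addrC.
Qed.

Lemma has_density_nat n (x : seq R) : nonnegs x -> has_density k (n%:R :: x).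
Proof.
move=> x0; rewrite /has_density /=; apply: is_cvg_near_eq (@is_cvg_corner x n [::] x0).
apply: nearW => p; rewrite /= add0n.
by rewrite -natrM natrK mulnC.
Qed.

Section Cells.
Variable x : seq R.
Hypothesis x_ge0 : nonnegs x.
Hypothesis x_size : (0 < size x)%N.
Hypothesis x_density : forall y, 0 <= y -> has_density k (y :: x).

Local Notation L y := (density k (y :: x)).

Definition deviation_density m (g : R) : R :=
  L (m%:R + g) - L m%:R - g * (L m.+1%:R - L m%:R).

(** The limit of the first row of the wave on the cell [(n, m)], by the recursions
    over the cells and, for [m = 0], by their symmetry. *)
Fixpoint wave_density n m (g : R) : R :=
  match n with
  | 0 => deviation_density m g
  | 1 => if m is m'.+1 then deviation_density m.+1 g + deviation_density m' g
                            + deviation_density m (1 - g)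
         else deviation_density 1 g
  | (n'.+1 as n1).+1 =>
     if m is m'.+1 then wave_density n1 m.+1 g + wave_density n1 m' g
                        - wave_density n' m g
     else deviation_density n g
  end.

Definition dalembert_density (w : R -> R) (b g : R) : R :=
  w (Num.min (g + b) 1) - w (Num.min 1 (Num.max 0 (2 - (g + b))))
  + (w (Num.max 0 (g - b)) - w (Num.max 0 (b - g))).

Definition slope_density n m (b g : R) : R :=
  density k [:: n.+1%:R, m%:R + g & x] - density k [:: n%:R, m%:R + g & x]
  + dalembert_density (wave_density n m) b g / 2.

Section Along.
Context {I : Type} {F : set_system I} {FF : Filter F}.
Variable q : I -> nat.
Hypothesis hq : q i @[i --> F] --> prime_infty.
Variable rest : I -> seq nat.
Hypothesis hrest : @scaled R I F q rest x.

Local Notation tnd := (@tends R I F q).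

Lemma tends_q : tnd q (1 : R).
Proof.
by apply: eq_tends (tends_cst (R:=R) (n:=1) hq) => // i; rewrite mul1n.
Qed.

Lemma tends_small n : tnd (fun=> n) (0 : R).
Proof.
rewrite /tends -(mulr0 n%:R); apply: cvgM; first exact: cvg_cst.
exact: cvg_invq.
Qed.

Lemma tends_cell m a (y : R) : tnd a y -> tnd (fun i => q i * m + a i)%N (m%:R + y).
Proof.
move=> ay; apply: tendsD => //.
by apply: eq_tends (tends_cst (R:=R) (n:=m) hq) => // i; rewrite mulnC.
Qed.

Lemma cvg_density_cons a y : 0 <= y -> tnd a y ->
  B (q i) (a i :: rest i) / (q i)%:R ^+ size x @[i --> F] --> L y.
Proof.
move=> y0 ay; apply: (cvg_density hq (x := y :: x)) => //=.
- by rewrite y0.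
- exact: x_density.
- exact: scaled_cons.
Qed.

Lemma cvg_deviation m c g : 0 <= g -> tnd c g ->
  deviation (q i) (fun a => B (q i) (a :: rest i)) m (c i) / (q i)%:R ^+ size x
    @[i --> F] --> deviation_density m g.
Proof.
move=> g0 cg; have m0 : 0 <= m%:R :> R by [].
have h1 := cvg_density_cons (addr_ge0 m0 g0) (tends_cell (m:=m) cg).
have h2 := cvg_density_cons m0 (_ : tnd (fun i => q i * m)%N m%:R).
have h3 := cvg_density_cons (ler0n R m.+1) (_ : tnd (fun i => q i * m + q i)%N m.+1%:R).
have {}h2 := h2 _; have {}h3 := h3 _.
apply: cvg_near_eq (cvgB (cvgB h1 (h2 _)) (cvgM cg (cvgB (h3 _) (h2 _)))).
- by apply: nearW => i; rewrite /deviation !fctE /=; ring.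
- by apply: eq_tends (tends_cst (R:=R) (n:=m) hq) => // i; rewrite mulnC.
- by apply: eq_tends (tends_cell (m:=m) tends_q) => //; rewrite natr1.
- by apply: eq_tends (tends_cst (R:=R) (n:=m) hq) => // i; rewrite mulnC.
Qed.

Lemma cvg_wave n m c g : (\forall i \near F, (c i <= q i)%N) -> 0 <= g <= 1 -> tnd c g ->
  cell_wave R (k (q i)) (q i) n m (rest i) 1 (c i) / (q i)%:R ^+ size x
    @[i --> F] --> wave_density n m g.
Proof.
move=> cq g01 cg; have /andP[g0 g1] := g01.
have w0 m' : cell_wave R (k (q i)) (q i) 0 m' (rest i) 1 (c i) / (q i)%:R ^+ size x
    @[i --> F] --> deviation_density m' g.
  apply: cvg_near_eq (cvg_deviation (m:=m') g0 cg).
  have := near_prime hq 0; apply: filterS2 cq => i cqi [qp _].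
  by rewrite cell_wave0 //; exact: char_k.
have wn0 n' : cell_wave R (k (q i)) (q i) n' 0 (rest i) 1 (c i) / (q i)%:R ^+ size x
    @[i --> F] --> deviation_density n' g.
  apply: cvg_near_eq (w0 n').
  have := near_prime hq 0; apply: filterS2 cq => i cqi [qp _].
  by rewrite [in RHS]cell_wave_sym0 //; exact: char_k.
have w1 m' : cell_wave R (k (q i)) (q i) 1 m' (rest i) 1 (c i) / (q i)%:R ^+ size x
    @[i --> F] --> wave_density 1 m' g.
  case: m' => [|m']; first exact: wn0.
  have cg' : tnd (fun i => q i - c i)%N (1 - g).
    by apply: eq_tends (tendsB hq tends_q cg) => //; rewrite max_r // subr_ge0.
  have g'0 : 0 <= 1 - g by rewrite subr_ge0.
  apply: cvg_near_eq (cvgD (cvgD (w0 m'.+2) (w0 m')) (cvg_deviation (m:=m'.+1) g'0 cg')).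
  have := near_prime hq (m' + 5); apply: filterS2 cq => i cqi [qp qm] /=.
  have q2 : (2 < q i)%N by lia.
  by rewrite (cell_wave_rec1 R (char_k qp) q2) ?fctE ?mulrDl //; lia.
have [] : (forall m, cell_wave R (k (q i)) (q i) n m (rest i) 1 (c i) / (q i)%:R ^+ size x
    @[i --> F] --> wave_density n m g) /\
  (forall m, cell_wave R (k (q i)) (q i) n.+1 m (rest i) 1 (c i) / (q i)%:R ^+ size x
    @[i --> F] --> wave_density n.+1 m g); last by [].
elim: n {m} => [|n [IH0 IH1]]; first by split=> m; [exact: w0 | exact: w1].
split=> // -[|m]; first exact: wn0.
apply: cvg_near_eq (cvgB (cvgD (IH1 m.+2) (IH1 m)) (IH0 m.+1)).
have := near_prime hq (n + m + 5); apply: filterS2 cq => i cqi [qp qm] /=.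
have q2 : (2 < q i)%N by lia.
rewrite (cell_wave_recS R (char_k qp) q2) ?fctE; [|lia..|exact: cqi]. rewrite /=; ring.
Qed.

Lemma cvg_dalembert n m b c beta g :
    (\forall i \near F, (b i <= q i)%N) -> (\forall i \near F, (c i <= q i)%N) ->
    0 <= beta <= 1 -> 0 <= g <= 1 -> tnd b beta -> tnd c g ->
  dalembert (q i) (cell_wave R (k (q i)) (q i) n m (rest i) 1) (b i) (c i)
    / (q i)%:R ^+ size x @[i --> F] --> dalembert_density (wave_density n m) beta g.
Proof.
move=> bq cq /andP[b0 b1] /andP[g0 g1] bb cg.
have cbD : tnd (fun i => c i + b i)%N (g + beta) by exact: tendsD.
pose W (a : I -> nat) i :=
  cell_wave R (k (q i)) (q i) n m (rest i) 1 (a i) / (q i)%:R ^+ size x.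
have W_cvg a y : (\forall i \near F, (a i <= q i)%N) -> 0 <= y <= 1 -> tnd a y ->
  W a i @[i --> F] --> wave_density n m y by exact: cvg_wave.
have e1 : W (fun i => minn (c i + b i) (q i)) i @[i --> F] -->
    wave_density n m (Num.min (g + beta) 1).
  apply: W_cvg; first by apply: nearW => i; exact: geq_minr.
    by rewrite le_min ge_min lexx ler01 orbT !andbT addr_ge0.
  exact: tends_min tends_q.
have e2 : W (fun i => minn (q i) (2 * q i - (c i + b i))) i @[i --> F] -->
    wave_density n m (Num.min 1 (Num.max 0 (2 - (g + beta)))).
  apply: W_cvg; first by apply: nearW => i; exact: geq_minl.
    by rewrite le_min ge_min lexx ler01 /= le_max lexx.
  by apply: tends_min tends_q _; apply: tendsB => //; exact: tends_cst.
have e3 : W (fun i => c i - b i)%N i @[i --> F] --> wave_density n m (Num.max 0 (g - beta)).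
  apply: W_cvg; first by apply: filterS cq => i; apply: leq_trans; exact: leq_subr.
    by rewrite le_max lexx ge_max ler01 /=; lra.
  exact: tendsB.
have e4 : W (fun i => b i - c i)%N i @[i --> F] --> wave_density n m (Num.max 0 (beta - g)).
  apply: W_cvg; first by apply: filterS bq => i; apply: leq_trans; exact: leq_subr.
    by rewrite le_max lexx ge_max ler01 /=; lra.
  exact: tendsB.
apply: cvg_near_eq (cvgD (cvgB e1 e2) (cvgB e3 e4)).
by apply: nearW => i; rewrite /dalembert !fctE /W /=; ring.
Qed.

(** The two bounds for the slope are the values of one formula at [b] and
    [b + 1], so they have the same limit after rescaling. *)
Lemma cvg_slope n m b c beta g :
    (\forall i \near F, (b i < q i)%N) -> (\forall i \near F, (c i <= q i)%N) ->
    0 <= beta <= 1 -> 0 <= g <= 1 -> tnd b beta -> tnd c g ->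
  (block_slope (k (q i)) (q i * n + b i) ((q i * m + c i)%N :: rest i))%:R
    / (q i)%:R ^+ size x @[i --> F] --> slope_density n m beta g.
Proof.
move=> bq cq b01 g01 bb cg; have /andP[g0 g1] := g01.
have mg0 : 0 <= m%:R + g by rewrite addr_ge0.
have corner n' : B (q i) [:: (q i * n')%N, (q i * m + c i)%N & rest i]
      / (q i)%:R ^+ (size x).+1 @[i --> F] --> density k [:: n'%:R, m%:R + g & x].
  apply: (cvg_density hq (x := [:: n'%:R, m%:R + g & x])) => //=.
  - by rewrite mg0 ler0n.
  - by apply: has_density_nat; rewrite /= mg0.
  - apply: scaled_cons; last by apply: scaled_cons => //; exact: tends_cell.
    by apply: eq_tends (tends_cst (R:=R) (n:=n') hq) => // i; rewrite mulnC.
have lam : (B (q i) [:: (q i * n + q i)%N, (q i * m + c i)%N & rest i]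
            - B (q i) [:: (q i * n)%N, (q i * m + c i)%N & rest i]) / (q i)%:R
      / (q i)%:R ^+ size x @[i --> F] -->
      density k [:: n.+1%:R, m%:R + g & x] - density k [:: n%:R, m%:R + g & x].
  apply: cvg_near_eq (cvgB (corner n.+1) (corner n)); apply: nearW => i.
  by rewrite !fctE -mulnSr -mulrBl exprS invfM mulrA.
have bS : tnd (fun i => (b i).+1) beta.
  by apply: eq_tends (tendsD bb (tends_small 1)); rewrite ?addr0 // => i; rewrite addn1.
have bq' : \forall i \near F, (b i <= q i)%N by apply: filterS bq => i /ltnW.
have up := cvgD lam (cvgM (@cvg_dalembert n m b c beta g bq' cq b01 g01 bb cg)
                   (cvg_cst (2^-1 : R))).
have low := cvgD lam (cvgM (@cvg_dalembert n m _ c beta g bq cq b01 g01 bS cg)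
                   (cvg_cst (2^-1 : R))).
apply: (squeeze_cvgr _ (low _ _ _) (up _ _ _)).
have := near_prime hq 0; apply: filterS3 bq cq => i bqi cqi [qp _] /=.
have q0 : 0 < (q i)%:R ^+ size x :> R by rewrite exprn_gt0 // ltr0n prime_gt0.
rewrite -block_slopeE !fctE /=.
have /andP[h1 h2] := slope_sandwich R (char_k qp) n m (rest i) bqi cqi.
rewrite ![_ / _ ^+ _ / 2]mulrAC -!mulrDl !ler_pM2r ?invr_gt0 //.
by apply/andP; split.
Qed.

End Along.
End Cells.
End Densities.

(** * Existence of the scaling limit *)

Section Riemann.
Variable R : realType.

Lemma cvg_approx (A : nat -> R) :
  (forall e : R, 0 < e -> exists2 A' : nat -> R, cvg (A' p @[p --> prime_infty]) &
     \forall p \near prime_infty, `|A p - A' p| <= e) ->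
  cvg (A p @[p --> prime_infty]).
Proof.
move=> h; apply: cauchy_cvg; apply: cauchy_exP => e e0.
have e20 : 0 < e / 2 by rewrite divr_gt0.
have [A' /cvg_ex[l A'l] AA'] := h _ (divr_gt0 e20 (ltr0n R 2)).
exists l; have /cvgrPdist_lt/(_ _ e20) := A'l; apply: filterS2 AA' => p h1 h2 /=.
rewrite -ball_normE /= -(subrKA (A' p)); apply: le_lt_trans (ler_normD _ _) _.
rewrite [`|A' p - _|]distrC; lra.
Qed.

Lemma riemann_sum_bound (a : nat -> R) (u : nat -> nat) (d : R) m :
    (forall v w, (v <= w)%N -> a w <= a v) -> u 0%N = 0%N ->
    (forall i, (u i <= u i.+1)%N) -> (forall i, (u i.+1 - u i)%:R <= d) ->
  \sum_(0 <= v < u m) a v <= \sum_(i < m) (u i.+1 - u i)%:R * a (u i)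
    <= \sum_(0 <= v < u m) a v + d * (a 0%N - a (u m)).
Proof.
move=> ha u0 hu hd; elim: m => [|m /andP[IH1 IH2]].
  by rewrite u0 big_geq // big_ord0 subrr mulr0 addr0 lexx.
rewrite big_ord_recr /= (@big_cat_nat _ _ _ (u m) 0 (u m.+1)) //=.
have up : \sum_(u m <= v < u m.+1) a v <= (u m.+1 - u m)%:R * a (u m).
  rewrite mulr_natl -sumr_const_nat; apply: ler_sum_nat => v /andP[h _].
  exact: ha.
have low : (u m.+1 - u m)%:R * a (u m.+1) <= \sum_(u m <= v < u m.+1) a v.
  rewrite mulr_natl -sumr_const_nat; apply: ler_sum_nat => v /andP[_ h].
  by apply: ha; exact: ltnW.
have da : 0 <= a (u m) - a (u m.+1) by rewrite subr_ge0 ha.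
have := ler_wpM2r da (hd m); move: (_ - u m)%:R up low => D up low hD.
apply/andP; split; first exact: lerD.
apply: le_trans (lerD IH2 (lexx _)) _.
lra.
Qed.

(** Monotonicity bounds the error of a Riemann sum by the mesh times the bound
    [C], uniformly in [p]. *)
Lemma riemann_cvg (a : nat -> nat -> R) (x C : R) : 0 <= x ->
    (forall p v w, (v <= w)%N -> a p w <= a p v) -> (forall p v, 0 <= a p v) ->
    (\forall p \near prime_infty, a p 0%N <= C) ->
    (forall r : R, 0 <= r -> cvg (a p (Num.truncn (r * p%:R)) @[p --> prime_infty])) ->
  cvg ((\sum_(0 <= v < Num.truncn (x * p%:R)) a p v) / p%:R @[p --> prime_infty]).
Proof.
move=> x0 ha a0 aC acvg; apply: cvg_approx => e e0.
have C0 : 0 <= C.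
  by have [p h] := filter_ex aC; exact: le_trans (a0 p 0%N) h.
pose N := (Num.truncn (2 * x * C / e)).+1.
have N0 : 0 < N%:R :> R by rewrite ltr0n.
have hN : x / N%:R * C <= e / 2.
  have := truncnS_gt (2 * x * C / e); rewrite -/N ltr_pdivrMr // => h.
  by rewrite mulrAC ler_pdivrMr // mulrAC ler_pdivlMr //; lra.
pose u p i := Num.truncn (x / N%:R * i%:R * p%:R).
have u_cvg i : (u p i)%:R / p%:R @[p --> prime_infty] --> x / N%:R * i%:R.
  by apply: tends_floor; [exact: cvg_id | rewrite !mulr_ge0 ?invr_ge0].
have hu p i : (u p i <= u p i.+1)%N.
  by apply: le_truncn; rewrite ler_wpM2r // ler_wpM2l ?ler_nat // mulr_ge0 ?invr_ge0.
exists (fun p => (\sum_(i < N) (u p i.+1 - u p i)%:R * a p (u p i)) / p%:R).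
  rewrite (_ : (fun p => _) =
      fun p => \sum_(i < N) ((u p i.+1)%:R / p%:R - (u p i)%:R / p%:R) * a p (u p i)).
    have term i : cvg (((u p i.+1)%:R / p%:R - (u p i)%:R / p%:R) * a p (u p i)
        @[p --> prime_infty]).
      apply: is_cvgM; last by apply: acvg; rewrite !mulr_ge0 ?invr_ge0.
      by apply: is_cvgB; apply/cvg_ex; [exists (x / N%:R * i.+1%:R) | exists (x / N%:R * i%:R)].
    apply/cvg_ex; exists (\sum_(i < N) lim (((u p i.+1)%:R / p%:R - (u p i)%:R / p%:R)
       * a p (u p i) @[p --> prime_infty])).
    by apply: (@cvg_big R _ +%R) => [|i _]; [exact: add_continuous | exact: term].
  apply/funext => p; rewrite mulr_suml; apply: eq_bigr => i _.
  by rewrite natrB // -mulrBl mulrAC.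
have h1 : \forall p \near prime_infty, C / p%:R <= e / 2.
  have /cvgr0Pnorm_le/(_ (e / 2)) : C * p%:R^-1 @[p --> prime_infty] --> 0.
    rewrite -(mulr0 C); apply: cvgM; first exact: cvg_cst.
    by apply: cvg_invq; exact: cvg_id.
  rewrite divr_gt0 // => /(_ isT); apply: filterS => p.
  by rewrite ger0_norm // mulr_ge0 ?invr_ge0.
have h2 : prime_infty (fun p => prime p) by apply: (near_prime_infty (N := 0)).
apply: filterS3 h1 h2 aC => p h1 pp aC.
have p0 : 0 < p%:R :> R by rewrite ltr0n prime_gt0.
have hd i : (u p i.+1 - u p i)%:R <= x / N%:R * p%:R + 1.
  have y0 j : 0 <= x / N%:R * j%:R * p%:R by rewrite !mulr_ge0 ?invr_ge0.
  have /andP[h _] := truncn_itv (y0 i.+1); have /andP[_ h'] := truncn_itv (y0 i).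
  rewrite natrB // /u; move: h h'; rewrite -2!natr1; lra.
have u0 : u p 0%N = 0%N by rewrite /u mulr0 mul0r truncn0.
have /andP[b1 b2] := riemann_sum_bound N (ha p) u0 (hu p) hd.
have uN : u p N = Num.truncn (x * p%:R) by rewrite /u mulfVK // gt_eqF.
rewrite uN in b1 b2; rewrite -mulrBl normrM normfV distrC.
rewrite (ger0_norm (ltW p0)) ger0_norm ?subr_ge0 // ler_pdivrMr // lerBlDl.
apply: le_trans b2 _; rewrite lerD2l.
have D0 : 0 <= x / N%:R * p%:R + 1 by rewrite addr_ge0 ?mulr_ge0 ?invr_ge0 // ltW.
have : a p 0%N - a p (Num.truncn (x * p%:R)) <= C by rewrite lerBlDr (le_trans aC) // lerDl.
move=> /(ler_wpM2l D0) /le_trans; apply.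
rewrite ler_pdivrMr // in h1.
have := ler_wpM2r (ltW p0) hN; lra.
Qed.

End Riemann.

Section Densities.
Variables (R : realType) (k : nat -> fieldType).
Hypothesis char_k : forall p, prime p -> p \in [pchar (k p)].

Local Notation B p l := ((num_blocks (k p) l)%:R : R).

Lemma floor_cell (r : R) p : 0 <= r -> (0 < p)%N ->
  (p * Num.truncn r <= Num.truncn (r * p%:R) < p * (Num.truncn r).+1)%N.
Proof.
move=> r0 p0; have /andP[h1 h2] := truncn_itv r0; apply/andP; split.
  by rewrite truncn_ge_nat ?mulr_ge0 // natrM mulrC ler_wpM2r.
by rewrite truncn_lt_nat ?mulr_ge0 // natrM mulrC ltr_pM2l ?ltr0n.
Qed.

Section Along.
Context {I : Type} {F : set_system I} {FF : Filter F}.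
Variable q : I -> nat.
Hypothesis hq : q i @[i --> F] --> prime_infty.

Lemma tends_sub_cell a (y : R) m : tends (F := F) q a y -> m%:R <= y ->
  tends (F := F) q (fun i => a i - q i * m)%N (y - m%:R).
Proof.
move=> ay my; apply: eq_tends (tendsB hq ay (tends_cst (R := R) (n := m) hq)).
  by move=> i; rewrite mulnC.
by rewrite max_r // subr_ge0.
Qed.

(** The slopes converge as long as the points stay in one cell of side [q]. *)
Lemma cvg_slope_cell x n m u v rest (r y : R) : nonnegs x -> (0 < size x)%N ->
    (forall z, 0 <= z -> has_density k (z :: x)) -> scaled (F := F) q rest x ->
    (\forall i \near F, (q i * n <= u i < q i * n.+1)%N) -> n%:R <= r <= n.+1%:R ->
    (\forall i \near F, (q i * m <= v i <= q i * m.+1)%N) -> m%:R <= y <= m.+1%:R ->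
    tends (F := F) q u r -> tends (F := F) q v y ->
  (block_slope (k (q i)) (u i) (v i :: rest i))%:R / (q i)%:R ^+ size x
    @[i --> F] --> slope_density k x n m (r - n%:R) (y - m%:R).
Proof.
move=> x0 sx dx hrest hu /andP[nr rn] hv /andP[my ym] ur vy.
have hb := tends_sub_cell ur nr; have hc := tends_sub_cell vy my.
have r01 : 0 <= r - n%:R <= 1 by rewrite subr_ge0 nr /=; move: rn; rewrite -natr1; lra.
have y01 : 0 <= y - m%:R <= 1 by rewrite subr_ge0 my /=; move: ym; rewrite -natr1; lra.
apply: cvg_near_eq (cvg_slope char_k x0 sx dx hq hrest _ _ r01 y01 hb hc).
- apply: filterS2 hu hv => i /andP[h _] /andP[h' _].
  by rewrite !subnKC.
- by apply: filterS hu => i; rewrite mulnS; lia.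
- by apply: filterS hv => i; rewrite mulnS; lia.
Qed.

End Along.

Lemma num_blocks_sum p u l :
  B p (u :: l) = \sum_(0 <= v < u) (block_slope (k p) v l)%:R :> R.
Proof.
elim: u => [|u IH]; first by rewrite big_geq // num_blocks0 ?mem_head.
by rewrite big_nat_recr //= -IH -natrD num_blocksS.
Qed.

(** Induction on the number of exponents: counts are sums of slopes, and slopes
    converge because counts with one exponent less do. *)
Theorem has_density_all (x : seq R) : (1 < size x)%N -> nonnegs x -> has_density k x.
Proof.
have idP : id p @[p --> prime_infty] --> prime_infty by exact: cvg_id.
have primeP : prime_infty (fun p => prime p) by apply: (near_prime_infty (N := 0)).
have [n] := ubnP (size x); elim: n x => // n IH [|r [|y x]] //= sx _ /and3P[r0 y0 x0].
have [x_nil|x_cons] := posnP (size x).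
  have -> : x = [::] by apply/eqP; rewrite -size_eq0 x_nil.
  apply/cvg_ex; exists (Num.min r y).
  apply: cvg_near_eq (tends_min (tends_floor idP r0) (tends_floor idP y0)).
  by apply: nearW => p; rewrite num_blocks_pair.
have dx z : 0 <= z -> has_density k (z :: x).
  by move=> z0; apply: IH => //=; rewrite z0.
pose a p v := (block_slope (k p) v (floors (y :: x) p))%:R / p%:R ^+ size x : R.
have : cvg ((\sum_(0 <= v < Num.truncn (r * p%:R)) a p v) / p%:R @[p --> prime_infty]).
  have p_ge0 p j : 0 <= p%:R ^+ j :> R by rewrite exprn_ge0.
  have /(_ y y0)/cvg_ex[l yl] := dx.
  apply: (riemann_cvg (C := l + 1)) => // [p v w vw|p v||z z0].
  - by rewrite /a ler_wpM2r ?invr_ge0 // ler_nat block_slope_le.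
  - by rewrite /a mulr_ge0 ?invr_ge0.
  - have /cvgr_lt/(_ (l + 1)) := yl; rewrite ltrDl ltr01 => /(_ isT).
    by apply: filterS => p; rewrite /a block_slope0 => /ltW.
  - have /andP[z1 z2] := truncn_itv z0; have /andP[y1 y2] := truncn_itv y0.
    have := @cvg_slope_cell _ _ _ id idP x (Num.truncn z) (Num.truncn y)
      (fun p => Num.truncn (z * p%:R)) (fun p => Num.truncn (y * p%:R)) (floors x)
      z y x0 x_cons dx (scaled_floors idP x0).
    move=> H; apply/cvg_ex; eexists; apply: H.
    + by apply: filterS primeP => p /prime_gt0; exact: floor_cell.
    + by rewrite z1 ltW.
    + by apply: filterS primeP => p /prime_gt0/(floor_cell y0)/andP[-> /ltnW].
    + by rewrite y1 ltW.
    + exact: tends_floor.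
    + exact: tends_floor.
apply: is_cvg_near_eq; apply: nearW => p; rewrite num_blocks_sum /=.
by rewrite /a -mulr_suml exprS invfM mulrA mulrAC.
Qed.

End Densities.

(** * The quotient ring as an array of coefficients *)

Section Arrays.
Variable K : fieldType.

(** Arrays of coefficients indexed by exponents, stored as elements of the
    tensor product. The exponents are reversed in each variable because
    [jordan] shifts downwards while multiplication by a variable shifts
    upwards. *)
Fixpoint array (l : seq nat) (G : seq nat -> K) : kcar (tensor_blocks K l) :=
  if l is a :: l' return kcar (tensor_blocks K l) then
    truncate a (fun i => array l' (fun m => G ((a - i.+1)%N :: m)))
  else (G [::] : K^o).

Definition in_box (l m : seq nat) := all2 ltn m l.

Lemma in_boxP l m : in_box l m <->
  size m = size l /\ forall i, (i < size l)%N -> (nth 0%N m i < nth 0%N l i)%N.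
Proof.
rewrite /in_box; elim: l m => [|a l IH] [|e m] //=; try by split=> [|[]].
split=> [/andP[ea /IH[-> h]]|[[sm] h]]; first by split=> // -[|i] //; exact: h.
rewrite (h 0%N) //=; apply/IH; split=> // i hi.
exact: (h i.+1).
Qed.

Lemma eq_array l G H : (forall m, in_box l m -> G m = H m) -> array l G = array l H.
Proof.
elim: l G H => [|a l IH] G H GH /=; first by rewrite (GH [::]).
apply/ffunP => i; rewrite !ffunE; apply: IH => m lm; apply: GH => /=.
by rewrite /in_box /= -/(in_box l m) lm andbT; have := ltn_ord i; lia.
Qed.

Lemma arrayP l c G H : array l (fun m => c * G m + H m) = c *: array l G + array l H.
Proof.
elim: l G H => [|a l IH] G H //=; apply: coord_inj => n.
by rewrite coordP !coord_truncate; case: ltnP => _; rewrite ?IH // scaler0 addr0.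
Qed.

Lemma arrayD l G H : array l (fun m => G m + H m) = array l G + array l H.
Proof.
by rewrite -[X in X + _]scale1r -arrayP; apply: eq_array => m _; rewrite mul1r.
Qed.

Lemma array0 l : array l (fun=> 0) = 0.
Proof.
elim: l => [|a l IH] //=; apply/coord_eq0 => n.
by rewrite coord_truncate; case: ltnP.
Qed.

Lemma array_eq0 l G : array l G = 0 <-> forall m, in_box l m -> G m = 0.
Proof.
split; last by move=> h; rewrite -(array0 l); exact: eq_array.
elim: l G => [|a l IH] G /=; first by move=> G0 [].
move=> /coord_eq0 h [|e m] //; rewrite /in_box /= => /andP[ea lm].
have := h (a - e.+1)%N; rewrite coord_truncate; case: ltnP => [_|]; last by lia.
by move=> /IH/(_ m lm); have -> : (a - (a - e.+1).+1 = e)%N by lia.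
Qed.

Lemma array_surj l (u : kcar (tensor_blocks K l)) : exists G, array l G = u.
Proof.
elim: l u => [|a l IH] u /=; first by exists (fun=> u).
have /choice[G_ hG] : forall i, exists G, array l G = coord u i by move=> i; exact: IH.
exists (fun m => if m is e :: m' then G_ (a - e.+1)%N m' else 0).
apply: coord_inj => n; rewrite coord_truncate; case: ltnP => h; last by rewrite coord_ge.
by rewrite -hG; have -> : (a - (a - n.+1).+1 = n)%N by lia.
Qed.

(** The coefficients of [(T_1 + .. + T_s) f] in terms of those of [f]. *)
Fixpoint sum_shift (G : seq nat -> K) (m : seq nat) : K :=
  if m is e :: m' then
    (if e is e'.+1 then G (e' :: m') else 0) + sum_shift (fun x => G (e :: x)) m'
  else 0.

Lemma array_sum_shift l G :
  array l (sum_shift G) = kop (tensor_blocks K l) (array l G).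
Proof.
elim: l G => [|a l IH] G /=; first by rewrite zero_lfunE.
apply: coord_inj => n; rewrite coord_jordan !coord_truncate.
case: ltnP => na; last first.
  by rewrite raddf0 add0r ltnNge (leqW na).
rewrite arrayD IH addrC; congr (_ + _).
case: ltnP => na'.
  have -> : (a - n.+1 = (a - n.+2).+1)%N by lia.
  by [].
have -> : (a - n.+1 = 0)%N by lia.
by rewrite array0.
Qed.

Lemma sum_shiftE G m : sum_shift G m =
  \sum_(i < size m) if nth 0%N m i is e.+1 then G (set_nth 0%N m i e) else 0.
Proof.
elim: m G => [|e m IH] G /=; first by rewrite big_ord0.
by rewrite big_ord_recl /= IH.
Qed.

End Arrays.

Section Mpoly.
Variables (K : fieldType) (s : nat).
Local Notation A := (mpoly s K).
Local Notation "'X_[ m ]" := (mpolyX K m).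
Local Notation "'X_ i" := (mpolyX K (mnm1 i)).

Definition coef_seq (f : A) (m : seq nat) : K :=
  mcoeff (Multinom [tuple nth 0%N m i | i < s]) f.

Lemma mcoeffXM m (f : A) M : mcoeff M ('X_[m] * f) =
  if lem m M then mcoeff (mnm_sub M m) f else 0.
Proof.
rewrite mulrC; case: ifPn => [mM|].
  by rewrite -{1}(submK mM) addmC mcoeffMX.
move=> mM; rewrite [f in mcoeff _ (f * _)]mpolyE mulr_suml raddf_sum /=.
apply: big1 => m' _.
rewrite -scalerAl -mpolyXD mcoeffZ mcoeffX; case: eqP => [E|]; last by rewrite mulr0.
case/negP: mM; rewrite -E; apply/mnm_lepP => i.
by rewrite mnmDE leq_addl.
Qed.

Definition var_sum : A := \sum_(i < s) 'X_i.

Lemma coef_seq_var_sum f m : size m = s ->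
  coef_seq (var_sum * f) m = sum_shift (coef_seq f) m.
Proof.
move=> sm; rewrite sum_shiftE sm /coef_seq mulr_suml raddf_sum /=.
apply: eq_bigr => i _; rewrite mcoeffXM.
case E : (nth 0%N m i) => [|e].
  case: ifPn => // /mnm_lepP/(_ i); rewrite mnm1E eqxx.
  by rewrite multinomE tnth_mktuple E.
have -> : lem (mnm1 i) (Multinom [tuple nth 0%N m i0 | i0 < s]).
  apply/mnm_lepP => j; rewrite mnm1E multinomE tnth_mktuple.
  by case: eqP => [<-|//]; rewrite E.
congr (mcoeff _ f); apply/mnmP => j.
rewrite mnmBE mnm1E !multinomE !tnth_mktuple nth_set_nth /=.
case: (eqVneq i j) => [<-|ij]; first by rewrite eqxx E subn1.
by rewrite subn0; case: eqP => // /val_inj ji; rewrite ji eqxx in ij.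
Qed.

Lemma ideal_sum (J : set A) (T : Type) (r : seq T) (F : T -> A) : is_ideal J ->
  (forall x, J (F x)) -> J (\sum_(x <- r) F x).
Proof. by move=> [J0 JD JM] h; elim/big_rec: _ => // x y _; exact: JD. Qed.

Section Quotient.
Variable l : seq nat.
Hypothesis sl : size l = s.
Variable b : nat.

Local Notation V := (kcar (tensor_blocks K l)).
Local Notation N := (kop (tensor_blocks K l)).

(** Reduction modulo the ideal [(T_1^l_1, .., T_s^l_s)]. *)
Definition to_array (f : A) : V := array l (coef_seq f).

Lemma to_arrayP c f g : to_array (c *: f + g) = c *: to_array f + to_array g.
Proof.
rewrite /to_array -arrayP; apply: eq_array => m _.
by rewrite /coef_seq mcoeffD mcoeffZ.
Qed.

Lemma to_arrayD f g : to_array (f + g) = to_array f + to_array g.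
Proof. by rewrite -[f]scale1r to_arrayP !scale1r. Qed.

Lemma to_arrayB f g : to_array (f - g) = to_array f - to_array g.
Proof. by rewrite addrC -scaleN1r to_arrayP scaleN1r addrC. Qed.

Lemma in_box_size m : in_box l m -> size m = s.
Proof. by rewrite /in_box all2E sl => /andP[/eqP]. Qed.

Lemma to_array_var_sum n f : to_array (var_sum ^+ n * f) = lpow N n (to_array f).
Proof.
elim: n f => [|n IH] f; first by rewrite expr0 mul1r lpow0.
rewrite exprSr -mulrA IH lpowSr; congr (lpow N n _).
rewrite /to_array -array_sum_shift; apply: eq_array => m /in_box_size.
exact: coef_seq_var_sum.
Qed.

Lemma to_array_eq0 f : to_array f = 0 <->
  forall M : multinom s, (forall i, M i < nth 0%N l i)%N -> mcoeff M f = 0.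
Proof.
rewrite array_eq0; split=> h.
  move=> M hM; have := h (multinom_val M).
  have -> : in_box l (multinom_val M).
    apply/in_boxP; rewrite size_tuple sl; split=> // i hi.
    by rewrite -[i]/(val (Ordinal hi)) -mnm_nth.
  move=> /(_ isT); rewrite /coef_seq => <-; congr (mcoeff _ f); apply/mnmP => i.
  by rewrite multinomE tnth_mktuple (mnm_nth 0%N).
move=> m /in_boxP[sm lm]; apply: h => i; rewrite multinomE tnth_mktuple.
by apply: lm; rewrite sl.
Qed.

Lemma to_array_surj u : exists f, to_array f = u.
Proof.
have [G <-] := array_surj u.
exists (\sum_(m : bmultinom s (sumn l).+1) (G (multinom_val m) *: 'X_[m])).
apply: eq_array => m /[dup] /in_boxP[_ lm] /in_box_size sm; rewrite /coef_seq.
rewrite (mcoeff_mpoly (fun m : multinom s => G (multinom_val m))).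
  congr G; apply: (@eq_from_nth _ 0%N); rewrite size_tuple // => i hi.
  by rewrite -[i]/(val (Ordinal hi)) -tnth_nth tnth_mktuple.
rewrite mdegE ltnS sumnE (big_nth 0%N) big_mkord sl; apply: leq_sum => i _.
by rewrite multinomE tnth_mktuple ltnW // lm // sl.
Qed.

Definition generators : set A :=
  [set 'X_i ^+ nth 0%N l i | i in [set: 'I_s]] `|` [set var_sum ^+ b].

Local Notation J := (ideal_gen generators).

Lemma ideal_gen_ideal : is_ideal J.
Proof.
split=> [I [[I0 _ _] _]//|f g Jf Jg I hI|a f Jf I hI]; have [[_ ID IM] _] := hI.
  by apply: ID; [exact: (Jf I hI) | exact: (Jg I hI)].
by apply: IM; exact: (Jf I hI).
Qed.

Lemma monomial_mem (J' : set A) (m : multinom s) i : is_ideal J' -> J' ('X_i ^+ nth 0%N l i) ->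
  (nth 0%N l i <= m i)%N -> J' 'X_[m].
Proof.
move=> [_ _ JM] Ji lm.
have -> : m = mnm_add (mnm_sub m (mnm_muln (mnm1 i) (nth 0%N l i)))
                      (mnm_muln (mnm1 i) (nth 0%N l i)).
  rewrite submK //; apply/mnm_lepP => j; rewrite mulmnE mnm1E.
  by case: eqP => [<-|_]; rewrite ?mul1n.
by rewrite mpolyXD -mpolyXn; exact: JM.
Qed.

Lemma kernel_mem (J' : set A) f : is_ideal J' ->
  (forall i : 'I_s, J' ('X_i ^+ nth 0%N l i)) -> to_array f = 0 -> J' f.
Proof.
move=> Ji Jg /to_array_eq0 f0; rewrite [f]mpolyE; have [J0 JD JM] := Ji.
apply: ideal_sum => // m; rewrite -mul_mpolyC.
have [/forallP h|] := boolP [forall i : 'I_s, m i < nth 0%N l i]%N.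
  by rewrite f0 // mpolyC0 mul0r.
rewrite negb_forall => /existsP[i]; rewrite -leqNgt => h.
by apply: JM; apply: monomial_mem h.
Qed.

Lemma to_array_mul0 a f : to_array f = 0 -> to_array (a * f) = 0.
Proof.
move=> /to_array_eq0 f0; rewrite [a]mpolyE mulr_suml; apply/to_array_eq0 => M hM.
rewrite raddf_sum big1 // => m _; rewrite -scalerAl /= mcoeffZ mcoeffXM.
case: ifP => _; last by rewrite mulr0.
rewrite f0 ?mulr0 // => i; apply: leq_ltn_trans (hM i).
by rewrite mnmBE leq_subr.
Qed.

Lemma to_array_mul a f g : to_array f = to_array g -> to_array (a * f) = to_array (a * g).
Proof.
move=> fg; apply/eqP; rewrite -subr_eq0 -to_arrayB -mulrBr to_array_mul0 //.
by rewrite to_arrayB fg subrr.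
Qed.

(** Modulo the powers of the variables, the ideal is the image of the power of
    the sum of the variables. *)
Lemma mem_ideal f : J f <-> to_array f \in limg (lpow N b).
Proof.
split.
  move=> Jf; apply: (Jf [set f | to_array f \in limg (lpow N b)]); split.
    split=> [|g h|a g] /=.
    - by rewrite (iffRL (to_array_eq0 0)) ?mem0v // => M _; exact: mcoeff0.
    - by rewrite to_arrayD; exact: memvD.
    - move=> /memv_imgP[u _]; have [h <-] := to_array_surj u.
      rewrite -to_array_var_sum => /(to_array_mul a) ->.
      by rewrite mulrCA to_array_var_sum memv_img ?memvf.
  move=> _ [[i _ <-]|->] /=.
    rewrite (iffRL (to_array_eq0 _)) ?mem0v // => M hM.
    rewrite mcoeffXn; case: eqP => // E.
    by have := hM i; rewrite -E mulmnE mnm1E eqxx mul1n ltnn.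
  by rewrite -[_ ^+ b]mulr1 to_array_var_sum memv_img ?memvf.
case/memv_imgP => u _; have [g <-] := to_array_surj u; rewrite -to_array_var_sum => E.
have [J0 JD JM] := ideal_gen_ideal.
rewrite -(subrK (var_sum ^+ b * g) f); apply: JD.
  apply: kernel_mem; first exact: ideal_gen_ideal.
    by move=> i I [_ GI]; apply: GI; left; exists i.
  by rewrite to_arrayB E subrr.
by rewrite mulrC; apply: JM => I [_ GI]; apply: GI; right.
Qed.

End Quotient.
End Mpoly.

(** * Length of the quotient *)

Section Length.
Variables (K : fieldType) (s : nat).
Local Notation A := (mpoly s K).
Local Notation "'X_[ m ]" := (mpolyX K m).
Local Notation "'X_ i" := (mpolyX K (mnm1 i)).

(** Subspaces given by a propositional predicate exist because a subspace of
    maximal dimension inside the predicate exhausts it. *)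
Lemma vspace_of_pred (V : vectType K) (P : V -> Prop) : P 0 ->
    (forall c u v, P u -> P v -> P (c *: u + v)) ->
  exists U : {vspace V}, forall v, v \in U <-> P v.
Proof.
move=> P0 PP.
pose Q n := `[< exists2 U : {vspace V}, \dim U = n & forall v, v \in U -> P v >].
have exQ : exists n, Q n.
  exists 0%N; apply/asboolP; exists 0%VS; first exact: dimv0.
  by move=> v; rewrite memv0 => /eqP ->.
have ubQ n : Q n -> (n <= \dim {: V})%N.
  by move=> /asboolP[U <- _]; apply: dimvS; exact: subvf.
case: (ex_maxnP exQ ubQ) => n /asboolP[U dU UP] n_max.
exists U => v; split; first exact: UP.
move=> Pv; apply: contrapT => /negP vU.
have /n_max : Q (\dim (U + <[v]>)).
  apply/asboolP; exists (U + <[v]>)%VS => // w /memv_addP[u uU [_ /vlineP[c ->] ->]].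
  by rewrite addrC; apply: PP => //; exact: UP.
rewrite -dU => dle; case/negP: vU.
have /eqP -> : (U == U + <[v]>)%VS by rewrite eqEdim addvSl.
by apply: (subvP (addvSr _ _)); exact: memv_line.
Qed.

Lemma dim_add_line (V : vectType K) (U : {vspace V}) v : v \notin U ->
  \dim (U + <[v]>) = (\dim U).+1.
Proof.
move=> vU; have v0 : v != 0 by apply: contraNneq vU => ->; exact: mem0v.
rewrite dimv_disjoint_sum ?dim_vline ?v0 ?addn1 //.
apply/eqP; rewrite -subv0; apply/subvP => w; rewrite memv_cap => /andP[wU /vlineP[c wc]].
rewrite memv0 wc; have [->|c0] := eqVneq c 0; first by rewrite scale0r.
by case/negP: vU; rewrite -[v](scalerK c0) -wc; exact: memvZ.
Qed.

Variable l : seq nat.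
Hypothesis sl : size l = s.
Variable b : nat.

Local Notation V := (kcar (tensor_blocks K l)).
Local Notation N := (kop (tensor_blocks K l)).
Local Notation rho := (@to_array K s l).
Local Notation J := (ideal_gen (@generators K s l b)).

Definition above (J' : set A) := is_ideal J' /\ J `<=` J'.

Lemma above_gen J' (i : 'I_s) : above J' -> J' ('X_i ^+ nth 0%N l i).
Proof. by move=> [_ JJ']; apply: JJ' => I [_ GI]; apply: GI; left; exists i. Qed.

Lemma above_space J' : above J' -> exists U : {vspace V}, forall f, J' f <-> rho f \in U.
Proof.
move=> aJ'; have [J0 JD JM] := aJ'.1.
have [|c u v|U hU] := @vspace_of_pred V (fun u => exists2 f, J' f & rho f = u).
- exists 0 => //; rewrite -[0 in LHS](subrr 0) to_arrayB subrr //.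
- move=> [f Jf <-] [g Jg <-]; exists (c *: f + g); last exact: to_arrayP.
  by apply: JD => //; rewrite -mul_mpolyC; exact: JM.
exists U => f; rewrite hU; split=> [Jf|[g Jg E]]; first by exists f.
rewrite -(subrK g f); apply: JD => //; apply: (kernel_mem sl aJ'.1).
  by move=> i; exact: above_gen.
by rewrite to_arrayB E subrr.
Qed.

Lemma above_pow J' m f : above J' -> (sumn l < mdeg m)%N -> J' ('X_[m] * f).
Proof.
move=> aJ' hm; have [_ _ JM] := aJ'.1; rewrite mulrC; apply: JM.
have [i hi] : exists i : 'I_s, (nth 0%N l i <= m i)%N.
  apply: contrapT => h; move: hm; rewrite ltnNge => /negP; apply.
  rewrite mdegE sumnE (big_nth 0%N) big_mkord sl; apply: leq_sum => i _.
  by rewrite leqNgt; apply/negP => /ltnW hi; apply: h; exists i.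
by apply: (monomial_mem aJ'.1 _ hi); exact: above_gen.
Qed.

(** A proper ideal containing powers of the variables misses some [g] that all
    variables multiply into it. *)
Lemma above_socle J' f : above J' -> ~ J' f ->
  exists2 g, ~ J' g & forall i, J' ('X_i * g).
Proof.
move=> aJ'; have := @above_pow J' _ _ aJ'.
move: (sumn l).+1 => D hD.
have {hD} : forall m, (D <= mdeg m)%N -> J' ('X_[m] * f) by move=> m; exact: hD.
elim: D f => [|D IH] f hD nJf.
  by case: nJf; have := hD (@mnm0 s) isT; rewrite mpolyX0 mul1r.
have [h|] := pselect (forall i, J' ('X_i * f)); first by exists f.
move=> /existsNP[i nJ]; apply: IH nJ => m hm.
rewrite mulrA -mpolyXD; apply: hD.
by rewrite mdegD mdeg1 addn1.
Qed.

(** A socle element modulo [J'] adds a single line when it is adjoined, so chains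
    of ideals can be refined until all steps have dimension one. *)
Lemma above_extend J' g : above J' -> ~ J' g -> (forall i, J' ('X_i * g)) ->
  exists2 J'', above J'' /\ J' `<` J'' &
    forall U : {vspace V}, (forall f, J' f <-> rho f \in U) ->
                           (forall f, J'' f <-> rho f \in (U + <[rho g]>)%VS).
Proof.
move=> aJ' nJg soc; have [[J0 JD JM] JJ'] := aJ'.
have augm (h : A) : mcoeff (@mnm0 s) h = 0 -> J' (h * g).
  move=> h0; rewrite [h]mpolyE mulr_suml; apply: ideal_sum => [|m]; first exact: aJ'.1.
  rewrite -scalerAl -mul_mpolyC; have [->|m0] := eqVneq m (@mnm0 s).
    by rewrite h0 mpolyC0 mul0r.
  have [i hi] : exists i, (0 < m i)%N.
    apply: contrapT => hn; case/eqP: m0; apply/mnmP => i; rewrite mnm0E.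
    by apply/eqP; rewrite -leqn0 leqNgt; apply/negP => mi; apply: hn; exists i.
  have -> : m = mnm_add (mnm_sub m (mnm1 i)) (mnm1 i).
    rewrite submK //; apply/mnm_lepP => j; rewrite mnm1E.
    by case: eqP => [<-|].
  by rewrite mpolyXD -mulrA; apply/JM/JM.
pose J'' : set A := [set h | exists c, J' (h - c *: g)].
have sub : J' `<=` J'' by move=> h Jh; exists 0; rewrite scale0r subr0.
exists J''; last first.
  move=> U hU f; split=> [[c /hU]|].
    rewrite -scaleNr addrC to_arrayP => h; apply/memv_addP.
    exists (- c *: rho g + rho f) => //; exists (c *: rho g).
      by apply/vlineP; exists c.
    by rewrite addrAC -scalerDl addNr scale0r add0r.
  move=> /memv_addP[u uU [_ /vlineP[c ->] E]]; exists c; apply/hU.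
  by rewrite -scaleNr addrC to_arrayP E addrC -addrA -scalerDl subrr scale0r addr0.
split; last first.
  split=> // /(_ g) h; apply: nJg; apply: h; exists 1.
  by rewrite scale1r subrr.
split; last exact: subset_trans sub.
split=> [|f h [c Jf] [d Jh]|a f [c Jf]].
- exact: sub.
- exists (c + d); rewrite scalerDl opprD addrACA; exact: JD.
- exists (c * mcoeff (@mnm0 s) a).
  have -> : a * f - (c * mcoeff (@mnm0 s) a) *: g =
    a * (f - c *: g) + mpolyC s c * ((a - mpolyC s (mcoeff (@mnm0 s) a)) * g).
    by rewrite -!mul_mpolyC mpolyCM; ring.
  apply: JD; first exact: JM.
  by apply: JM; apply: augm; rewrite mcoeffB mcoeffC eqxx mulr1 subrr.
Qed.

Lemma chain_exists d J' (U : {vspace V}) : above J' ->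
    (forall f, J' f <-> rho f \in U) -> \dim {: V} = (\dim U + d)%N ->
  exists2 C, C 0%N = J' & ideal_chain J d C.
Proof.
elim: d J' U => [|d IH] J' U aJ' hU dU.
  by exists (fun=> J') => //; split=> // i; rewrite leqn0 => /eqP ->.
have [f nJf] : exists f, ~ J' f.
  apply: contrapT => h; suff : (fullv <= U)%VS by move/dimvS; rewrite dU; lia.
  apply/subvP => v _; have [f <-] := to_array_surj sl v; apply/hU.
  by apply: contrapT => nJ; apply: h; exists f.
have [g nJg soc] := above_socle aJ' nJf.
have [J'' [aJ'' ltJ] /(_ U hU) hU''] := above_extend aJ' nJg soc.
have gU : rho g \notin U by apply/negP => /hU.
have [|C C0 [C1 C2]] := IH J'' _ aJ'' hU''; first by rewrite dim_add_line // dU; lia.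
exists (fun i => if i is i'.+1 then C i' else J') => //; split=> [[|i] hi|[|i] hi] //.
- exact: C1.
- by rewrite C0.
- exact: C2.
Qed.

Lemma chain_bound n C : ideal_chain J n C ->
  (n + \dim (limg (lpow N b)) <= \dim {: V})%N.
Proof.
move=> [C1 C2]; suff : forall i, (i <= n)%N -> exists U : {vspace V},
    (forall f, C i f <-> rho f \in U) /\ (i + \dim (limg (lpow N b)) <= \dim U)%N.
  move=> /(_ n (leqnn n))[U [_ h]]; apply: leq_trans h _; apply: dimvS; exact: subvf.
elim=> [|i IH] hi.
  have [U hU] := above_space (C1 0%N hi); exists U; split=> //; rewrite add0n.
  apply: dimvS; apply/subvP => v; have [f <-] := to_array_surj sl v.
  by move=> /(mem_ideal sl b)/(C1 0%N hi).2/hU.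
have [U [hU dU]] := IH (ltnW hi); have [U' hU'] := above_space (C1 _ hi).
exists U'; split=> //; rewrite addSn; apply: leq_ltn_trans dU _.
have [sub nsub] := C2 i hi.
have UU' : (U <= U')%VS.
  apply/subvP => v; have [f <-] := to_array_surj sl v.
  by move=> /hU/sub/hU'.
rewrite ltn_neqAle dimvS // andbT; apply/negP => /eqP dE; apply: nsub => f /hU'.
have /eqP <- : (U == U')%VS by rewrite eqEdim UU' dE leqnn.
by move/hU.
Qed.

(** The quotient is the cokernel of the [b]-th power of the sum of the variables on
    the array space, and its dimension equals that of the kernel. *)
Lemma quotient_lengthE (R : realType) :
  quotient_length R J = (num_blocks K (b :: l))%:R%:E.
Proof.
have dE : \dim {: V} = (num_blocks K (b :: l) + \dim (limg (lpow N b)))%N.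
  by rewrite num_blocks_cons -(limg_ker_dim (lpow N b) fullv) capfv.
apply/eqP; rewrite eq_le; apply/andP; split.
  apply: ge_ereal_sup => _ [n [C /chain_bound hC] <-].
  by rewrite lee_fin ler_nat; move: hC; rewrite dE leq_add2r.
apply: ereal_sup_ubound; exists (num_blocks K (b :: l)) => //.
have aJ : above J by split=> //; exact: ideal_gen_ideal.
have [|C _ hC] := @chain_exists (num_blocks K (b :: l)) J _ aJ (mem_ideal sl b).
  by rewrite dE addnC.
by exists C.
Qed.

End Length.

(** * The kernel function as a limit of block counts *)

Section Ceilings.
Variable R : realType.
Implicit Types x y z : R.

(** The exponent [ceil x], with nonpositive exponents read as [0]. *)
Definition ceiln x : nat := if Num.ceil x is Posz n then n else 0%N.

Lemma ceiln_le_nat x n : (ceiln x <= n)%N = (x <= n%:R).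
Proof.
have := ceil_le_int x n; rewrite /ceiln; case: (Num.ceil x) => m /= <- //.
Qed.

Lemma ceiln_gt_nat x n : (n < ceiln x)%N = (n%:R < x).
Proof. by rewrite ltnNge ceiln_le_nat ltNge. Qed.

Lemma ceiln_ge x : x <= (ceiln x)%:R.
Proof. by rewrite -ceiln_le_nat. Qed.

Lemma ceiln_lt x : 0 <= x -> (ceiln x)%:R < x + 1.
Proof.
case E : (ceiln x) => [|n] x0; first by rewrite ltr_pwDr.
by rewrite -natr1 ltrD2r -ceiln_gt_nat E.
Qed.

Lemma le_ceiln x y : x <= y -> (ceiln x <= ceiln y)%N.
Proof. by move=> xy; rewrite ceiln_le_nat (le_trans xy) // ceiln_ge. Qed.

Definition ceils (x : seq R) (q : nat) : seq nat := [seq ceiln (z * q%:R) | z <- x].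

End Ceilings.

Section KernelIdeal.
Variables (R : realType) (K : fieldType) (s : nat).

Lemma kernel_idealE (t : 'rV[R]_s) (r : R) q :
  @kernel_ideal R K s (sum_vars s) t r q =
  ideal_gen (@generators K s (ceils [seq t ord0 i | i <- enum 'I_s] q) (ceiln (r * q%:R))).
Proof.
rewrite /kernel_ideal /generators; congr (ideal_gen (_ `|` [set _])).
  apply/seteqP; split=> _ [i _ <-]; exists i => //; rewrite /ceils -map_comp.
    rewrite (nth_map i) ?size_enum_ord // nth_ord_enum /= /ceiln /mvar.
    by case: Num.ceil.
  rewrite (nth_map i) ?size_enum_ord // nth_ord_enum /= /ceiln /mvar.
  by case: Num.ceil.
rewrite /sum_vars raddf_sum /=; under eq_bigr => i _ do rewrite map_mpolyX.
by rewrite /ceiln; case: Num.ceil.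
Qed.

Lemma kernel_funE p (t : 'rV[R]_s) (r : R) :
  kernel_fun K p (sum_vars s) t r =
  lim (((num_blocks K (ceils (r :: [seq t ord0 i | i <- enum 'I_s]) (p ^ e)))%:R
       / (p ^ e)%:R ^+ s : R) @[e --> \oo]).
Proof.
rewrite /kernel_fun; congr (lim (_ @ \oo)); apply/funext => e.
rewrite kernel_idealE quotient_lengthE //.
by rewrite /ceils size_map size_map size_enum_ord.
Qed.

End KernelIdeal.

(** * The kernel function in a fixed characteristic *)

Section KernelDensity.
Variables (R : realType) (K : fieldType) (p : nat).
Hypothesis pK : p \in [pchar K].
Local Notation B l := ((num_blocks K l)%:R : R).
Local Notation slope v l := ((block_slope K v l)%:R : R).
Implicit Types x y : seq R.

Let p_prime : prime p := pcharf_prime pK.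
Let p_gt0 : (0 < p)%N := prime_gt0 p_prime.
Let pe0 e : 0 < (p ^ e)%:R :> R. Proof. by rewrite ltr0n expn_gt0 p_gt0. Qed.

Lemma num_blocks_frobenius_exp e l :
  num_blocks K (map (muln (p ^ e)) l) = ((p ^ e) ^ (size l).-1 * num_blocks K l)%N.
Proof.
case: l => [|a l]; first by rewrite mul1n.
elim: e => [|e IH]; first by rewrite map_id_in ?exp1n ?mul1n // => b _; rewrite mul1n.
rewrite expnS (eq_map (g := muln p \o muln (p ^ e))); last by move=> b; rewrite /= mulnA.
rewrite map_comp [X in map _ X]/= num_blocks_frobenius // -/(map _ (a :: l)) IH size_map.
by rewrite /= mulnA expnMn.
Qed.

(** The block count is linear in the head between consecutive multiples of
    [p] when the other entries are multiples of [p]. *)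
Lemma block_slope_frobenius v l : (0 < size l)%N ->
  block_slope K v (map (muln p) l) = (p ^ (size l).-1 * block_slope K (v %/ p) l)%N.
Proof.
case: l => // a l _; apply/eqP; rewrite -(eqr_nat R) natrM natrX /=.
have p0 : p%:R != 0 :> R by rewrite pnatr_eq0 -lt0n.
have D b : (b <= p)%N -> _ := @deviation_blocks_mul R K p pK (v %/ p) b a (map (muln p) l).
have frob n : B [:: p * n, p * a & map (muln p) l]%N
    = p%:R ^+ (size l).+1 * B [:: n, a & l].
  by have /= -> := num_blocks_frobenius pK n (a :: l); rewrite natrM natrX.
have vE : v = (p * (v %/ p) + v %% p)%N by rewrite mulnC -divn_eq.
have hb : (v %% p < p)%N by rewrite ltn_pmod.
have := D _ hb; have := D _ (ltnW hb); rewrite /deviation addnS -vE.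
rewrite -mulnSr !frob !num_blocksS !natrD -[(v %% p).+1%:R]natr1 => d1 d2.
apply/eqP; apply: (mulfI p0); rewrite mulrA -exprS.
have {}d1 : B [:: v, p * a & map (muln p) l]%N = p%:R ^+ (size l).+1 * B [:: (v %/ p)%N, a & l]
   + (v %% p)%:R / p%:R * (p%:R ^+ (size l).+1 * slope (v %/ p) (a :: l)).
  by apply/eqP; rewrite -subr_eq0 -[X in _ == X]d1; apply/eqP; ring.
move: d2; rewrite d1 => d2.
apply/eqP; rewrite -subr_eq0; apply/eqP.
rewrite -[RHS](mulr0 p%:R) -[in RHS]d2; field.
exact: p0.
Qed.

Lemma block_slope_frobenius_exp e v l : (0 < size l)%N ->
  block_slope K v (map (muln (p ^ e)) l)
  = ((p ^ e) ^ (size l).-1 * block_slope K (v %/ p ^ e) l)%N.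
Proof.
move=> l0; elim: e v => [|e IH] v.
  by rewrite map_id_in ?exp1n ?mul1n ?divn1 // => b _; rewrite mul1n.
rewrite expnS (eq_map (g := muln p \o muln (p ^ e))); last by move=> b; rewrite /= mulnA.
by rewrite map_comp block_slope_frobenius size_map // IH mulnA expnMn divnMA.
Qed.

Lemma all2_map_leq (T : Type) (f g : T -> nat) (x : seq T) (P : pred T) :
  all P x -> (forall z, P z -> (f z <= g z)%N) -> all2 leq (map f x) (map g x).
Proof. by move=> + fg; elim: x => [//|z x IH /= /andP[/fg fz /IH xs]]; rewrite fz. Qed.

Lemma ceils_mul_le y (q n : nat) : all2 leq (ceils y (q * n)) (map (muln n) (ceils y q)).
Proof.
rewrite /ceils -map_comp; apply: (all2_map_leq (P := predT)) => [|z _ /=].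
  by apply/allP.
by rewrite ceiln_le_nat !natrM mulrA mulrC ler_wpM2l // ceiln_ge.
Qed.

Lemma floors_mul_le y (q n : nat) : nonnegs y ->
  all2 leq (map (muln n) (floors y q)) (ceils y (q * n)).
Proof.
rewrite /ceils /floors -map_comp => y0; apply: all2_map_leq y0 _ => z z0 /=.
rewrite -(ler_nat R); apply: le_trans (ceiln_ge _); rewrite !natrM mulrA mulrC.
by rewrite ler_wpM2r // -truncn_ge_nat ?mulr_ge0.
Qed.

(** Concavity bounds the secants by the slopes at points to their left and right;
    monotonicity allows to change the other exponents. *)
Lemma num_blocks_secant_le a b u l l' : (u <= a)%N -> (a <= b)%N -> all2 leq l l' ->
  B (b :: l) - B (a :: l) <= (b%:R - a%:R) * slope u l'.
Proof.
move=> ua ab ll'; rewrite -(subnKC ab); elim: (b - a)%N => [|d IH].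
  by rewrite addn0 !subrr mul0r.
rewrite addnS num_blocksS natrD -[(a + d).+1%:R]natr1.
have : slope (a + d) l <= slope u l'.
  by rewrite ler_nat (leq_trans (leq_block_slope _ _ ll')) // block_slope_le ?(leq_trans ua) ?leq_addr.
move: IH; lra.
Qed.

Lemma num_blocks_secant_ge a b u l l' : (b <= u.+1)%N -> (a <= b)%N -> all2 leq l' l ->
  (b%:R - a%:R) * slope u l' <= B (b :: l) - B (a :: l).
Proof.
move=> bu ab ll'; rewrite -(subnKC ab); have : (b - a <= b - a)%N by [].
move: {1 3 4}(b - a)%N; elim=> [|d IH] hd; first by rewrite addn0 !subrr mul0r.
rewrite addnS num_blocksS natrD -[(a + d).+1%:R]natr1.
have : slope u l' <= slope (a + d) l.
  rewrite ler_nat (leq_trans (leq_block_slope _ _ ll')) // block_slope_le //.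
  by move: bu ab hd; lia.
by have := IH (ltnW hd); lra.
Qed.

(** [l(q)/q^s] for the exponents [ceil (y_i q)], [q = p^e]. *)
Definition kratio y e : R := B (ceils y (p ^ e)) / (p ^ e)%:R ^+ (size y).-1.

Definition kdensity y : R := lim (kratio y e @[e --> \oo]).

Lemma kratio_ge0 y e : 0 <= kratio y e.
Proof. by rewrite /kratio divr_ge0 ?exprn_ge0. Qed.

Lemma kratio_le y e n : kratio y (e + n) <= kratio y e.
Proof.
have h := leq_num_blocks K (ceils_mul_le y (p ^ e) (p ^ n)).
move: h; rewrite -expnD num_blocks_frobenius_exp size_map -(ler_nat R) natrM natrX => h.
rewrite /kratio ler_pdivrMr ?exprn_gt0 //; apply: le_trans h _.
rewrite (expnD p e n) natrM exprMn !mulrA divfK ?gt_eqF ?exprn_gt0 //.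
by rewrite mulrC.
Qed.

Lemma cvg_kratio y : kratio y e @[e --> \oo] --> kdensity y.
Proof.
apply: nonincreasing_is_cvgn; last by exists 0 => _ [e _ <-]; exact: kratio_ge0.
by apply/nonincreasing_seqP => e; rewrite -addn1 kratio_le.
Qed.

(** Along powers of [p] the ratios decrease, and rounding before or after
    multiplication by [p^e] compares them with the scale [p]. *)
Lemma kdensity_le y : kdensity y <= B (ceils y p) / p%:R ^+ (size y).-1.
Proof.
apply: (cvgr_to_le (@cvg_kratio y)); exists 1%N => // e /= e1.
by have := kratio_le y 1 (e - 1); rewrite subnKC // /(kratio y 1) expn1.
Qed.

Lemma kdensity_ge y : nonnegs y -> B (floors y p) / p%:R ^+ (size y).-1 <= kdensity y.
Proof.
move=> y0; apply: (cvgr_to_ge (@cvg_kratio y)); exists 1%N => // -[//|e] _ /=.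
have h := leq_num_blocks K (floors_mul_le p (p ^ e) y0).
move: h; rewrite -expnS num_blocks_frobenius_exp size_map -(ler_nat R) natrM natrX => h.
rewrite /kratio ler_pdivlMr ?exprn_gt0 //; apply: le_trans h.
have pn : 0 < p%:R :> R by rewrite ltr0n.
rewrite (expnS p e) natrM exprMn mulrA divfK ?gt_eqF ?exprn_gt0 //.
by rewrite mulrC.
Qed.

Lemma cvg_invpe : ((p ^ e)%:R^-1 : R) @[e --> \oo] --> (0 : R).
Proof.
under eq_fun do rewrite natrX -exprVn.
apply: cvg_expr; rewrite ger0_norm ?invr_ge0 // invf_lt1 ?ltr0n // ltr1n.
exact: prime_gt1.
Qed.

Lemma cvg_ceiln (z : R) : 0 <= z ->
  ((ceiln (z * (p ^ e)%:R))%:R / (p ^ e)%:R : R) @[e --> \oo] --> z.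
Proof.
move=> z0.
have up : z + (p ^ e)%:R^-1 @[e --> \oo] --> z.
  by rewrite -[X in _ --> X]addr0; apply: cvgD; [exact: cvg_cst|exact: cvg_invpe].
apply: squeeze_cvgr _ (cvg_cst z) up; apply: nearW => e.
rewrite ler_pdivlMr // ceiln_ge ler_pdivrMr // mulrDl mulVf ?gt_eqF //= ltW //.
by rewrite ceiln_lt // mulr_ge0 // ltW.
Qed.

Let cvg_kdiff y y' :
  kratio y e - kratio y' e @[e --> \oo] --> kdensity y - kdensity y'.
Proof. by apply: cvgB; exact: cvg_kratio. Qed.

Let cvg_cdiff (r1 r2 c : R) : 0 <= r1 -> r1 <= r2 ->
  ((ceiln (r2 * (p ^ e)%:R))%:R / (p ^ e)%:R
    - (ceiln (r1 * (p ^ e)%:R))%:R / (p ^ e)%:R) * c @[e --> \oo] --> (r2 - r1) * c.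
Proof.
move=> r10 r12; apply: cvgMl; apply: cvgB; apply: cvg_ceiln => //.
exact: le_trans r12.
Qed.

Let frobenius_rescale e n (d1 d2 v : R) :
  (d1 - d2) * ((p ^ e)%:R ^+ n * v)
  = (d1 / (p ^ e.+1)%:R - d2 / (p ^ e.+1)%:R) * (v / p%:R ^+ n) * (p ^ e.+1)%:R ^+ n.+1.
Proof.
have e0 : (p ^ e)%:R != 0 :> R by rewrite gt_eqF.
have pn0 : p%:R != 0 :> R by rewrite pnatr_eq0 -lt0n.
rewrite expnS natrM; move: (p ^ e)%:R p%:R e0 pn0 => Q P Q0 P0.
rewrite exprS exprMn; field; by rewrite Q0 P0 expf_neq0.
Qed.

(** At the scale [p^(e+1)] the secant is bounded by the slope at [p^e u], which
    is [p^(e (size x - 1))] times the slope at [u] by linearity of the count between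
    multiples of [p^e]. *)
Lemma kdensity_secant_le u (r1 r2 : R) x : (0 < size x)%N -> 0 <= r1 -> r1 <= r2 ->
  u%:R <= r1 * p%:R -> kdensity (r2 :: x) - kdensity (r1 :: x)
    <= (r2 - r1) * (slope u (ceils x p) / p%:R ^+ (size x).-1).
Proof.
move=> x0 r10 r12 ur.
have lhs := @cvg_kdiff (r2 :: x) (r1 :: x).
have rhs := @cvg_cdiff r1 r2 (slope u (ceils x p) / p%:R ^+ (size x).-1) r10 r12.
apply: ler_cvg_to lhs rhs _; exists 1%N => // -[//|e] _ /=.
have h1 : (p ^ e * u <= ceiln (r1 * (p ^ e.+1)%:R))%N.
  rewrite -(ler_nat R); apply: le_trans (ceiln_ge _); rewrite expnSr !natrM mulrA mulrAC.
  by rewrite mulrC ler_wpM2r // ltW.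
have h2 : (ceiln (r1 * (p ^ e.+1)%:R) <= ceiln (r2 * (p ^ e.+1)%:R))%N.
  by rewrite le_ceiln // ler_wpM2r // ltW.
have h3 : all2 leq (ceils x (p ^ e.+1)) (map (muln (p ^ e)) (ceils x p)).
  by rewrite expnS ceils_mul_le.
have := num_blocks_secant_le h1 h2 h3.
rewrite block_slope_frobenius_exp ?[size (ceils _ _)]size_map // mulKn ?expn_gt0 ?p_gt0 // => h.
rewrite /kratio /= -[X in X <= _]mulrBl ler_pdivrMr ?exprn_gt0 //; apply: le_trans h _.
rewrite le_eqVlt; apply/orP; left; apply/eqP.
by rewrite -{3}(prednK x0) natrM (natrX _ (p ^ e)%N); exact: frobenius_rescale.
Qed.

(** The last step inside the interval that ends at [p^e (u + 1)] still has the
    slope at [p^e u], again by linearity. *)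
Lemma kdensity_secant_ge u (r1 r2 : R) x : (0 < size x)%N -> nonnegs x ->
  0 <= r1 -> r1 <= r2 -> r2 * p%:R <= u.+1%:R ->
  (r2 - r1) * (slope u (floors x p) / p%:R ^+ (size x).-1)
    <= kdensity (r2 :: x) - kdensity (r1 :: x).
Proof.
move=> x0 xnn r10 r12 ur.
have lhs := @cvg_kdiff (r2 :: x) (r1 :: x).
have rhs := @cvg_cdiff r1 r2 (slope u (floors x p) / p%:R ^+ (size x).-1) r10 r12.
apply: ler_cvg_to rhs lhs _; exists 1%N => // -[//|e] _ /=.
have h1 : (ceiln (r2 * (p ^ e.+1)%:R) <= ((p ^ e) * u.+1).-1.+1)%N.
  rewrite prednK ?muln_gt0 ?expn_gt0 ?p_gt0 // ceiln_le_nat expnSr !natrM mulrA mulrAC.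
  by rewrite mulrC ler_wpM2l // ltW.
have h2 : (ceiln (r1 * (p ^ e.+1)%:R) <= ceiln (r2 * (p ^ e.+1)%:R))%N.
  by rewrite le_ceiln // ler_wpM2r // ltW.
have h3 : all2 leq (map (muln (p ^ e)) (floors x p)) (ceils x (p ^ e.+1)).
  by rewrite expnS floors_mul_le.
have := num_blocks_secant_ge h1 h2 h3.
have -> : ((p ^ e * u.+1).-1 = u * p ^ e + (p ^ e).-1)%N.
  by rewrite mulnC mulSn -{1}[(p ^ e)%N]prednK ?expn_gt0 ?p_gt0 // addSn /= addnC.
rewrite block_slope_frobenius_exp ?[size (floors _ _)]size_map // divnMDl ?expn_gt0 ?p_gt0 //.
rewrite divn_small ?prednK ?expn_gt0 ?p_gt0 // addn0 => h.
rewrite /kratio /= -[X in _ <= X]mulrBl ler_pdivlMr ?exprn_gt0 //; apply: le_trans h.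
rewrite le_eqVlt; apply/orP; left; apply/eqP.
by rewrite -{2}(prednK x0) natrM (natrX _ (p ^ e)%N); apply/esym; exact: frobenius_rescale.
Qed.

Lemma kdensity_concave (r1 r2 r3 : R) x : 0 <= r1 -> r1 <= r2 -> r2 <= r3 ->
  (r2 - r1) * (kdensity (r3 :: x) - kdensity (r2 :: x))
    <= (r3 - r2) * (kdensity (r2 :: x) - kdensity (r1 :: x)).
Proof.
move=> r10 r12 r23; have r20 := le_trans r10 r12.
have d a b c d : 0 <= a -> a <= b ->
  ((ceiln (b * (p ^ e)%:R))%:R / (p ^ e)%:R - (ceiln (a * (p ^ e)%:R))%:R / (p ^ e)%:R)
  * (kratio (d :: x) e - kratio (c :: x) e) @[e --> \oo]
  --> (b - a) * (kdensity (d :: x) - kdensity (c :: x)).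
  move=> a0 ab; apply: cvgM; last exact: cvg_kdiff.
  by apply: cvgB; apply: cvg_ceiln => //; exact: le_trans ab.
apply: ler_cvg_to (d r1 r2 r2 r3 r10 r12) (d r2 r3 r1 r2 r20 r23) _.
apply: nearW => e /=; set l := ceils x (p ^ e).
have ll : all2 leq l l by elim: l => //= a l ->; rewrite leqnn.
have c12 : (ceiln (r1 * (p ^ e)%:R) <= ceiln (r2 * (p ^ e)%:R))%N.
  by rewrite le_ceiln // ler_wpM2r // ltW.
have c23 : (ceiln (r2 * (p ^ e)%:R) <= ceiln (r3 * (p ^ e)%:R))%N.
  by rewrite le_ceiln // ler_wpM2r // ltW.
have h1 := num_blocks_secant_ge (leqnSn _) c12 ll.
have h2 := num_blocks_secant_le (leqnn _) c23 ll.
rewrite /kratio /= -/l -!mulrBl ![_ * (_ * _)]mulrA; apply: ler_wpM2r.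
  by rewrite invr_ge0 exprn_ge0 // ltW.
rewrite mulrAC [leRHS]mulrAC; apply: ler_wpM2r; first by rewrite invr_ge0 ltW.
set c1 := ceiln (r1 * _) in h1 h2 c12 c23 *; set c2 := ceiln (r2 * _) in h1 h2 c12 c23 *.
set c3 := ceiln (r3 * _) in h1 h2 c12 c23 *.
have d21 : 0 <= c2%:R - c1%:R :> R by rewrite subr_ge0 ler_nat.
have d32 : 0 <= c3%:R - c2%:R :> R by rewrite subr_ge0 ler_nat.
apply: le_trans (ler_wpM2l d21 h2) _; rewrite mulrCA; exact: ler_wpM2l.
Qed.

End KernelDensity.

(** * One-sided derivatives and iterated limits *)

Section OneSided.
Variables (R : realType) (f : R -> R) (C : R).
Hypothesis f_homo : forall r1 r2 : R, 0 <= r1 -> r1 <= r2 -> f r1 <= f r2.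
Hypothesis f_lip : forall r1 r2 : R, 0 <= r1 -> r1 <= r2 -> f r2 - f r1 <= (r2 - r1) * C.
Hypothesis f_concave : forall r1 r2 r3 : R, 0 <= r1 -> r1 <= r2 -> r2 <= r3 ->
  (r2 - r1) * (f r3 - f r2) <= (r3 - r2) * (f r2 - f r1).

Lemma concave_right_derivable (r : R) : 0 <= r -> right_derivable f r.
Proof.
move=> r0; apply: nonincreasing_at_right_is_cvgr; apply: nearW => x.
  move=> h2 h1; rewrite !in_itv /= => /andP[h2p _] /andP[h1p _] h21.
  have r1 : r <= r + h2 by rewrite lerDl ltW.
  have r2 : r + h2 <= r + h1 by rewrite lerD2l.
  have := f_concave r0 r1 r2; rewrite /diff_quotient => H.
  by rewrite ler_pdivlMl // mulrCA ler_pdivrMl //; lra.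
exists C => _ [h /= hx <-]; move: hx; rewrite in_itv /= => /andP[h0 _].
rewrite /diff_quotient ler_pdivrMl //.
have rh : r <= r + h by rewrite lerDl ltW.
by have := f_lip r0 rh; lra.
Qed.

Lemma near_left_ge (r : R) : 0 < r -> \forall x \near (0 : R)^'-, 0 <= r + x.
Proof.
move=> r0; near=> x; have : - r <= x by near: x; apply: nbhs_left_ge; rewrite oppr_lt0.
by rewrite -[- r <= x]subr_ge0 opprK addrC.
Unshelve. all: by end_near. Qed.

Lemma concave_left_derivable (r : R) : 0 < r -> left_derivable f r.
Proof.
move=> r0.
suff : cvg (- diff_quotient f r h @[h --> 0^'-]).
  move=> /cvg_ex[l Hl]; apply/cvg_ex; exists (- l); apply: cvg_near_eq (cvgN Hl).
  by apply: nearW => h; rewrite /= ?fctE opprK.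
have nx := near_left_ge r0.
apply: nondecreasing_at_left_is_cvgr; apply: filterS nx => x rx.
  move=> h1 h2; rewrite !in_itv /= => /andP[xh1 h1n] /andP[xh2 h2n] h12.
  have rh : 0 <= r + h1 by lra.
  have r1 : r + h1 <= r + h2 by rewrite lerD2l.
  have r2 : r + h2 <= r by lra.
  have H := f_concave rh r1 r2; rewrite /diff_quotient lerN2.
  have e h : h < 0 -> h^-1 * (f (r + h) - f r) = (- h)^-1 * (f r - f (r + h)).
    by move=> h0; rewrite invrN mulNr -mulrN opprB.
  rewrite !e // ler_pdivlMl ?oppr_gt0 // mulrCA ler_pdivrMl ?oppr_gt0 //; lra.
exists 0 => _ [h /= hx <-]; move: hx; rewrite in_itv /= => /andP[xh h0].
rewrite /diff_quotient -mulNr -invrN mulr_ge0_le0 //.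
  by rewrite invr_ge0 oppr_ge0 ltW.
by rewrite subr_le0 f_homo //; lra.
Qed.

End OneSided.

(** A joint limit equals the iterated limit whenever the inner limits exist. *)
Lemma iterated_limit {I J : Type} {R : realType} (F : set_system I) (H : set_system J)
    (FF : Filter F) (HH : ProperFilter H) (Q : I -> J -> R) (L : I -> R) (G : R) :
  Q i.1 i.2 @[i --> filter_prod F H] --> G ->
  (\forall i \near F, Q i j @[j --> H] --> L i) -> L i @[i --> F] --> G.
Proof.
move=> /cvgrPdist_le QG QL; apply/cvgrPdist_le => e e0.
have [[A B] /= [FA HB] AB] := QG e e0.
apply: filterS2 FA QL => i Ai QiL.
apply: (@cvgr_to_le _ H _ R (fun j => `|G - Q i j|)).
  by apply: cvg_norm; apply: cvgB => //; exact: cvg_cst.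
by apply: filterS HB => j Bj; exact: (AB (i, j)).
Qed.

Section SideLimit.
Variables (R : realType) (F : set_system R) (FF : ProperFilter F).
Variables (f : nat -> R -> R) (g : R -> R) (r : R).
Hypothesis fg : forall z, f p z @[p --> prime_infty] --> g z.

(** Both sides of the asserted convergence are iterated limits of the difference
    quotients in [(p, h)], taken in opposite orders. *)
Lemma derive_limit :
  (forall p, prime p -> cvg (diff_quotient (f p) r h @[h --> F])) ->
  (exists G : R, diff_quotient (f i.1) r i.2 @[i --> filter_prod prime_infty F] --> G) ->
  [/\ forall p, prime p -> cvg (diff_quotient (f p) r h @[h --> F]),
      cvg (diff_quotient g r h @[h --> F]) &
      lim (diff_quotient (f p) r h @[h --> F]) @[p --> prime_infty]
        --> lim (diff_quotient g r h @[h --> F])].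
Proof.
move=> df [G QG].
have gG : diff_quotient g r h @[h --> F] --> G.
  apply: (@iterated_limit R nat R F prime_infty _ _ (fun h p => diff_quotient (f p) r h)).
    move=> A /QG [[U V] /= [hU hV] UV]; exists (V, U) => // -[h p] [/= Vh Up].
    exact: (UV (p, h)).
  apply: nearW => h; apply: cvgMr; apply: cvgB; exact: fg.
have -> : lim (diff_quotient g r h @[h --> F]) = G by apply/cvg_lim.
split=> //; apply: (@iterated_limit _ _ _ _ _ _ _ (fun p h => diff_quotient (f p) r h)) QG _.
by apply: (near_prime_infty (N := 0)) => p pp _; exact: df.
Qed.

End SideLimit.

(** * Joint limits of the difference quotients *)

Section Joint.
Variables (R : realType) (k : nat -> fieldType).
Hypothesis char_k : forall p, prime p -> p \in [pchar (k p)].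
Local Notation slope p v l := ((block_slope (k p) v l)%:R : R).
Local Notation kd p y := (@kdensity R (k p) p y).

Lemma nat_primes : prime_infty (fun p => prime p).
Proof. by apply: (near_prime_infty (N := 0)). Qed.

Section Along.
Context {I : Type} {F : set_system I} {FF : Filter F}.
Variable q : I -> nat.
Hypothesis hq : q i @[i --> F] --> prime_infty.

Lemma tends_ceil (y : R) : 0 <= y -> @tends R I F q (fun i => ceiln (y * (q i)%:R)) y.
Proof.
move=> y0; rewrite /tends.
have up : y + (q i)%:R^-1 @[i --> F] --> y.
  by rewrite -[X in _ --> X]addr0; apply: cvgD; [exact: cvg_cst|exact: cvg_invq].
apply: squeeze_cvgr _ (cvg_cst y) up; have := near_prime hq 0; apply: filterS => i [qp _].
have q0 : 0 < (q i)%:R :> R by rewrite ltr0n prime_gt0.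
rewrite ler_pdivlMr // ceiln_ge ler_pdivrMr // mulrDl mulVf ?gt_eqF //= ltW //.
by rewrite ceiln_lt // mulr_ge0 // ltW.
Qed.

Lemma scaled_ceils x : nonnegs x -> @scaled R I F q (fun i => ceils x (q i)) x.
Proof.
move=> x0; split=> [i|j hj]; first by rewrite size_map.
have := tends_ceil (allP x0 _ (mem_nth 0 hj)).
by under [in X in X -> _]eq_fun do rewrite -(nth_map 0 0%N (fun y => ceiln (y * _))) //.
Qed.

End Along.

Lemma ceil_cell (y : R) p : 0 <= y -> (0 < p)%N ->
  (p * Num.truncn y <= ceiln (y * p%:R) <= p * (Num.truncn y).+1)%N.
Proof.
move=> y0 p0; have /andP[h1 h2] := truncn_itv y0; apply/andP; split.
  by rewrite -(ler_nat R); apply: le_trans (ceiln_ge _); rewrite natrM mulrC ler_wpM2r.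
by rewrite ceiln_le_nat natrM mulrC ler_wpM2l // ltW.
Qed.

Lemma cvg_kdensity (x : seq R) : (1 < size x)%N -> nonnegs x ->
  cvg (kd p x @[p --> prime_infty]).
Proof.
move=> sx x0; have hq : id p @[p --> prime_infty] --> prime_infty by exact: cvg_id.
have dx := has_density_all char_k sx x0.
apply/cvg_ex; exists (density k x).
apply: squeeze_cvgr _ (cvg_density hq sx x0 dx (scaled_floors hq x0))
  (cvg_density hq sx x0 dx (scaled_ceils hq x0)).
apply: filterS nat_primes => p pp /=; rewrite kdensity_ge ?kdensity_le //; exact: char_k.
Qed.

Section Concavity.
Variables (x : seq R).
Hypotheses (x_nil : (0 < size x)%N) (x0 : nonnegs x).
Variable p : nat.
Hypothesis pp : prime p.
Let g r := kd p (r :: x).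

Lemma kdensity_homo (r1 r2 : R) : 0 <= r1 -> r1 <= r2 -> g r1 <= g r2.
Proof.
move=> r10 r12; rewrite -subr_ge0.
have h : r2 * p%:R <= (Num.truncn (r2 * p%:R)).+1%:R by apply/ltW/truncnS_gt.
apply: le_trans (kdensity_secant_ge (char_k pp) x_nil x0 r10 r12 h).
by rewrite mulr_ge0 ?subr_ge0 // divr_ge0 // exprn_ge0.
Qed.

Lemma kdensity_lip (r1 r2 : R) : 0 <= r1 -> r1 <= r2 ->
  g r2 - g r1 <= (r2 - r1) * (slope p 0 (ceils x p) / p%:R ^+ (size x).-1).
Proof.
move=> r10 r12; have u0 : 0%:R <= r1 * p%:R by rewrite mulr_ge0.
exact: (kdensity_secant_le (char_k pp) x_nil r10 r12 u0).
Qed.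

Lemma kdensity_right_derivable r : 0 <= r -> right_derivable g r.
Proof.
apply: (@concave_right_derivable R g _ kdensity_lip) => r1 r2 r3 a b c.
exact: (kdensity_concave (char_k pp) x a b c).
Qed.

Lemma kdensity_left_derivable r : 0 < r -> left_derivable g r.
Proof.
apply: (@concave_left_derivable R g kdensity_homo) => r1 r2 r3 a b c.
exact: (kdensity_concave (char_k pp) x a b c).
Qed.

End Concavity.

Section JointLimit.
Variables (x : seq R) (y : R).
Hypotheses (x_nil : (0 < size x)%N) (x0 : nonnegs x) (y0 : 0 <= y).
Variable r : R.
Let m := Num.truncn y.
Let dq (i : nat * R) := diff_quotient (fun z => kd i.1 (z :: y :: x)) r i.2.

(** Rounding up or down does not affect the limit of the slopes, so an upper and
    a lower bound for the quotients by slopes in one cell suffice. *)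
Lemma cvg_slope_squeeze (H : set_system R) (HH : Filter H) n (u1 u2 : nat * R -> nat)
    (Fl := filter_prod prime_infty H) :
  n%:R <= r <= n.+1%:R ->
  (\forall i \near Fl, (i.1 * n <= u1 i < i.1 * n.+1)%N) -> @tends R _ Fl fst u1 r ->
  (\forall i \near Fl, (i.1 * n <= u2 i < i.1 * n.+1)%N) -> @tends R _ Fl fst u2 r ->
  (\forall i \near Fl,
    slope i.1 (u2 i) (floors (y :: x) i.1) / i.1%:R ^+ size x <= dq i
    <= slope i.1 (u1 i) (ceils (y :: x) i.1) / i.1%:R ^+ size x) ->
  dq i @[i --> Fl] --> slope_density k x n m (r - n%:R) (y - m%:R).
Proof.
move=> nr cell1 t1 cell2 t2 bounds.
have hq : fst i @[i --> Fl] --> prime_infty by exact: cvg_fst.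
have dx z : 0 <= z -> has_density k (z :: x).
  by move=> z0; apply: has_density_all => //=; rewrite z0.
have /andP[y1 y2] := truncn_itv y0.
have ym : m%:R <= y <= m.+1%:R by rewrite y1 ltW.
have qp : \forall i \near Fl, (0 < i.1)%N.
  by have := near_prime hq 0; apply: filterS => i [/prime_gt0].
have low : slope i.1 (u2 i) (floors (y :: x) i.1) / i.1%:R ^+ size x @[i --> Fl]
    --> slope_density k x n m (r - n%:R) (y - m%:R).
  apply: (cvg_slope_cell char_k hq x0 x_nil dx (scaled_floors hq x0) cell2 nr _ ym t2).
    by apply: filterS qp => i /(floor_cell y0)/andP[-> /ltnW].
  exact: tends_floor.
have up : slope i.1 (u1 i) (ceils (y :: x) i.1) / i.1%:R ^+ size x @[i --> Fl]
    --> slope_density k x n m (r - n%:R) (y - m%:R).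
  apply: (cvg_slope_cell char_k hq x0 x_nil dx (scaled_ceils hq x0) cell1 nr _ ym t1).
    by apply: filterS qp => i; exact: ceil_cell.
  exact: tends_ceil.
exact: (squeeze_cvgr bounds low up).
Qed.

Lemma tends_moving_floor (H : set_system R) (HH : Filter H) :
  0 <= r -> h @[h --> H] --> (0 : R) -> (\forall h \near H, 0 <= r + h) ->
  @tends R _ (filter_prod prime_infty H) fst
    (fun i => Num.truncn ((r + i.2) * i.1%:R)) r.
Proof.
move=> r0 h0 rh; have hq : fst i @[i --> filter_prod prime_infty H] --> prime_infty.
  exact: cvg_fst.
apply: (tends_floor_of hq (z := fun i => r + i.2)).
  exact: (cvg_snd rh).
rewrite -[X in _ --> X]addr0; apply: cvgD; first exact: cvg_cst.
by apply: cvg_comp h0; exact: cvg_snd.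
Qed.

Lemma joint_right_limit : 0 <= r ->
  exists G : R, dq i @[i --> filter_prod prime_infty 0^'+] --> G.
Proof.
move=> r0; pose n := Num.truncn r; have /andP[n1 n2] := truncn_itv r0.
set Fl := filter_prod _ _; have hq : fst i @[i --> Fl] --> prime_infty by exact: cvg_fst.
(* Points to the right of [r] lie in the cell that begins at [floor r]. *)
have side : \forall i \near Fl, 0 < i.2 /\ r + i.2 < n.+1%:R.
  apply: (cvg_snd (t := fun h => 0 < h /\ r + h < n.+1%:R)); near=> h; split=> //.
  by rewrite -ltrBrDl; near: h; apply: nbhs_right_lt; rewrite subr_gt0.
have near_p := near_prime hq 0.
exists (slope_density k x n m (r - n%:R) (y - m%:R)).
apply: (@cvg_slope_squeeze _ _ n (fun i => Num.truncn (r * i.1%:R))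
  (fun i => Num.truncn ((r + i.2) * i.1%:R))).
- by rewrite n1 ltW.
- by apply: filterS near_p => i [/prime_gt0 p0 _]; exact: floor_cell.
- exact: tends_floor.
- apply: filterS2 near_p side => i [/prime_gt0 p0 _] [h0 hn].
  have rh0 : 0 <= r + i.2 by rewrite addr_ge0 // ltW.
  have := floor_cell rh0 p0; suff -> : Num.truncn (r + i.2) = n by [].
  apply/eqP; rewrite truncn_eq //; apply/andP; split => //.
  by apply: le_trans n1 _; rewrite lerDl ltW.
- apply: tends_moving_floor => //; last by near=> h; rewrite addr_ge0.
  apply: cvg_at_right_filter; exact: cvg_id.
apply: filterS2 near_p side => i [pp _] [h0 hn].
have rh : r <= r + i.2 by rewrite lerDl ltW.
rewrite /dq /diff_quotient ler_pdivlMl // ler_pdivrMl //.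
have xy0 : nonnegs (y :: x) by rewrite /= y0.
have u1 : (Num.truncn (r * i.1%:R))%:R <= r * i.1%:R by rewrite -truncn_ge_nat ?mulr_ge0.
have u2 : (r + i.2) * i.1%:R <= (Num.truncn ((r + i.2) * i.1%:R)).+1%:R.
  exact/ltW/truncnS_gt.
have := kdensity_secant_le (char_k pp) (x := y :: x) isT r0 rh u1.
have := kdensity_secant_ge (char_k pp) (x := y :: x) isT xy0 r0 rh u2.
by rewrite addrAC subrr add0r /= => -> ->.
Unshelve. all: by end_near. Qed.

Lemma joint_left_limit : 0 < r ->
  exists G : R, dq i @[i --> filter_prod prime_infty 0^'-] --> G.
Proof.
(* Points to the left of an integer [r] lie in the cell that ends at [r]. *)
move=> r0; pose n := (ceiln r).-1.
have c0 : (0 < ceiln r)%N by rewrite ceiln_gt_nat.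
have nr : n%:R < r by rewrite -ceiln_gt_nat /n prednK.
have rn : r <= n.+1%:R by rewrite /n prednK // ceiln_ge.
set Fl := filter_prod _ _; have hq : fst i @[i --> Fl] --> prime_infty by exact: cvg_fst.
have side : \forall i \near Fl, i.2 < 0 /\ n%:R <= r + i.2.
  apply: (cvg_snd (t := fun h => h < 0 /\ n%:R <= r + h)); near=> h; split=> //.
  by rewrite -lerBlDl; near: h; apply: nbhs_left_ge; rewrite subr_lt0.
have near_p := near_prime hq 0.
exists (slope_density k x n m (r - n%:R) (y - m%:R)).
apply: (@cvg_slope_squeeze _ _ n (fun i => Num.truncn ((r + i.2) * i.1%:R))
  (fun i => (ceiln (r * i.1%:R)).-1)).
- by rewrite ltW.
- apply: filterS2 near_p side => i [/prime_gt0 p0 _] [h0 hn].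
  have rh0 : 0 <= r + i.2 by apply: le_trans hn.
  have := floor_cell rh0 p0; suff -> : Num.truncn (r + i.2) = n by [].
  apply/eqP; rewrite truncn_eq //; apply/andP; split => //.
  by apply: lt_le_trans rn; rewrite gtrDl.
- apply: tends_moving_floor; first exact: ltW.
    apply: cvg_at_left_filter; exact: cvg_id.
  exact: near_left_ge.
- apply: filterS near_p => i [/prime_gt0 p0 _].
  have h1 : (i.1 * n < ceiln (r * i.1%:R))%N.
    by rewrite ceiln_gt_nat natrM mulrC ltr_pM2r ?ltr0n.
  have h2 : (ceiln (r * i.1%:R) <= i.1 * n.+1)%N.
    by rewrite ceiln_le_nat natrM mulrC ler_wpM2l.
  have c1 : (0 < ceiln (r * i.1%:R))%N by apply: leq_trans h1.
  by apply/andP; split; [rewrite -ltnS prednK | rewrite prednK].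
- apply: eq_tends (tendsB hq (tends_ceil hq (ltW r0)) (@tends_small R _ _ _ _ hq 1)) => [i|].
    by rewrite subn1.
  by rewrite subr0; apply/max_idPr/ltW.
apply: filterS2 near_p side => i [pp _] [h0 hn].
have rh0 : 0 <= r + i.2 by apply: le_trans hn.
have rh : r + i.2 <= r by rewrite gerDl ltW.
have -> : dq i = (- i.2)^-1 * (kd i.1 [:: r, y & x] - kd i.1 [:: r + i.2, y & x]).
  by rewrite /dq /diff_quotient invrN mulNr -mulrN opprB.
have nh : 0 < - i.2 by rewrite oppr_gt0.
rewrite ler_pdivlMl // ler_pdivrMl //.
have xy0 : nonnegs (y :: x) by rewrite /= y0.
have u1 : (Num.truncn ((r + i.2) * i.1%:R))%:R <= (r + i.2) * i.1%:R.
  by rewrite -truncn_ge_nat ?mulr_ge0.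
have u2 : r * i.1%:R <= (ceiln (r * i.1%:R)).-1.+1%:R.
  apply: le_trans (ceiln_ge _) _; rewrite ler_nat; exact: leqSpred.
have := kdensity_secant_le (char_k pp) (x := y :: x) isT rh0 rh u1.
have := kdensity_secant_ge (char_k pp) (x := y :: x) isT xy0 rh0 rh u2.
by rewrite opprD addrA subrr add0r /= => -> ->.
Unshelve. all: by end_near. Qed.

End JointLimit.
End Joint.

(** * The limit theorem *)

Lemma ceiln_eq0 (R : realType) (z : R) : z <= 0 -> ceiln z = 0%N.
Proof. by move=> z0; apply/eqP; rewrite -leqn0 ceiln_le_nat. Qed.

Section Kernel.
Variables (R : realType) (k : nat -> fieldType).
Hypothesis char_k : forall p, prime p -> p \in [pchar (k p)].
Local Notation kd p y := (@kdensity R (k p) p y).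

(** Nonpositive exponents behave like [0]. *)
Definition pos_part : R -> R := Num.max 0.

Lemma pos_part_ge0 z : 0 <= pos_part z.
Proof. by rewrite /pos_part le_max lexx. Qed.

Lemma ceils_pos_part (y : seq R) q : ceils (map pos_part y) q = ceils y q.
Proof.
rewrite /ceils -map_comp; apply: eq_map => z /=; rewrite /pos_part.
case: (leP 0 z) => // /ltW z0.
by rewrite mul0r !ceiln_eq0 // mulr_le0_ge0.
Qed.

Lemma kdensity_pos_part p (y : seq R) : kd p (map pos_part y) = kd p y.
Proof.
rewrite /kdensity; congr (lim (_ @ \oo)); apply/funext => e.
by rewrite /kratio ceils_pos_part size_map.
Qed.

Lemma nonnegs_pos_part (y : seq R) : nonnegs (map pos_part y).
Proof. by apply/allP => _ /mapP[z _ ->]; exact: pos_part_ge0. Qed.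

Lemma kdensity_npos p (r : R) x : r <= 0 -> kd p (r :: x) = 0.
Proof.
move=> r0; rewrite /kdensity.
rewrite (_ : [eta _] = fun=> (0 : R)) ?lim_cst //.
apply/funext => e; rewrite /kratio num_blocks0 ?mul0r //= ceiln_eq0 ?mem_head //.
by rewrite mulr_le0_ge0.
Qed.

Lemma kdensity_pair p (r y : R) : prime p -> 0 <= r -> 0 <= y ->
  kd p [:: r; y] = Num.min r y.
Proof.
move=> pp r0 y0; rewrite /kdensity; apply: cvg_lim => //.
apply: cvg_near_eq (cvg_min (cvg_ceiln (char_k pp) r0) (cvg_ceiln (char_k pp) y0)).
apply: nearW => e; rewrite /kratio /= num_blocks_pair expr1 -minr_pMl ?invr_ge0 //.
congr (_ * _).
set a := ceiln _; set b := ceiln _.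
by case: leqP => ab; [apply/min_idPl|apply/min_idPr]; rewrite ler_nat // ltnW.
Qed.

(** With one exponent [y] the kernel function is the same for all [p], so the
    joint limit is a limit in [h] alone. *)
Lemma kdensity_pair_joint_limit (H : set_system R) (HH : ProperFilter H) (r y : R) : 0 <= r -> 0 <= y ->
    h @[h --> H] --> (0 : R) -> (\forall h \near H, 0 <= r + h) ->
    cvg (diff_quotient (fun z => kd 2 [:: z; y]) r h @[h --> H]) ->
  exists G : R, diff_quotient (fun z => kd i.1 [:: z; y]) r i.2
    @[i --> filter_prod prime_infty H] --> G.
Proof.
move=> r0 y0 h0 rh /cvg_ex[G HG]; exists G.
have hG : diff_quotient (fun z => kd 2 [:: z; y]) r i.2
    @[i --> filter_prod prime_infty H] --> G.
  by apply: cvg_comp HG; exact: cvg_snd.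
apply: cvg_near_eq hG.
have n1 : \forall i \near filter_prod prime_infty H, prime i.1.
  exact: (cvg_fst nat_primes).
have n2 : \forall i \near filter_prod prime_infty H, 0 <= r + i.2 by exact: (cvg_snd rh).
apply: filterS2 n1 n2 => i pp ri.
by rewrite /diff_quotient !kdensity_pair.
Qed.

Lemma npos_difference_quotients (H : set_system R) (HH : ProperFilter H) r x : r <= 0 ->
    (\forall h \near H, r + h <= 0) ->
  (forall p, diff_quotient (fun z => kd p (z :: x)) r h @[h --> H] --> (0 : R)) /\
  diff_quotient (fun z => kd i.1 (z :: x)) r i.2
    @[i --> filter_prod prime_infty H] --> (0 : R).
Proof.
move=> r0 rh; have E p h : r + h <= 0 -> diff_quotient (fun z => kd p (z :: x)) r h = 0.
  by move=> hr; rewrite /diff_quotient !kdensity_npos // subrr mulr0.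
split=> [p|]; apply: cvg_near_cst; first by apply: filterS rh => h /E.
have n2 : \forall i \near filter_prod prime_infty H, r + i.2 <= 0 by exact: (cvg_snd rh).
by apply: filterS n2 => i /E.
Qed.

Section Sides.
Variable x : seq R.
Hypotheses (x_nil : (0 < size x)%N) (x0 : nonnegs x).
Local Notation dq p r h := (diff_quotient (fun z => kd p (z :: x)) r h).

Lemma right_hypotheses r :
  (forall p, prime p -> cvg (dq p r h @[h --> 0^'+])) /\
  (exists G : R, dq i.1 r i.2 @[i --> filter_prod prime_infty 0^'+] --> G).
Proof.
case: (leP 0 r) => [r0|r0]; last first.
  have rh : \forall h \near 0^'+, r + h <= 0.
    by near=> h; rewrite -lerBrDl; near: h; apply: nbhs_right_le; rewrite subr_gt0.
  have [h1 h2] := npos_difference_quotients (at_right_proper_filter _) x (ltW r0) rh.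
  by split=> [p _|]; [apply/cvg_ex; exists 0; exact: h1 | exists 0].
have dr p : prime p -> cvg (dq p r h @[h --> 0^'+]).
  by move=> pp; exact: (kdensity_right_derivable char_k x_nil pp r0).
split=> //.
case: x x_nil x0 dr => // y [|z x'] _ /= /andP[y0 x'0] dr.
  apply: kdensity_pair_joint_limit => //; last exact: dr.
    by apply: cvg_at_right_filter; exact: cvg_id.
  by near=> h; rewrite addr_ge0.
exact: (joint_right_limit char_k (x := z :: x') isT).
Unshelve. all: by end_near. Qed.

Lemma left_hypotheses r :
  (forall p, prime p -> cvg (dq p r h @[h --> 0^'-])) /\
  (exists G : R, dq i.1 r i.2 @[i --> filter_prod prime_infty 0^'-] --> G).
Proof.
case: (leP r 0) => r0.
  have rh : \forall h \near 0^'-, r + h <= 0.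
    by near=> h; rewrite -[0]addr0 lerD // ltW.
  have [h1 h2] := npos_difference_quotients (at_left_proper_filter _) x r0 rh.
  by split=> [p _|]; [apply/cvg_ex; exists 0; exact: h1 | exists 0].
have dl p : prime p -> cvg (dq p r h @[h --> 0^'-]).
  by move=> pp; exact: (kdensity_left_derivable char_k x_nil x0 pp r0).
split=> //.
case: x x_nil x0 dl => // y [|z x'] _ /= /andP[y0 x'0] dl.
  apply: kdensity_pair_joint_limit => //; last exact: dl.
  - exact: ltW.
  - by apply: cvg_at_left_filter; exact: cvg_id.
  - exact: near_left_ge.
exact: (joint_left_limit char_k (x := z :: x') isT).
Unshelve. all: by end_near. Qed.

Lemma is_cvg_kdensity_any r : cvg (kd p (r :: x) @[p --> prime_infty]).
Proof.
have -> : (fun p => kd p (r :: x)) = fun p => kd p (pos_part r :: x).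
  apply/funext => p; rewrite -(kdensity_pos_part p (r :: x)) -[RHS]kdensity_pos_part /=.
  by congr (kd p (_ :: _)); apply/esym/max_idPr; exact: pos_part_ge0.
apply: cvg_kdensity => //=.
by rewrite x0 pos_part_ge0.
Qed.

End Sides.
End Kernel.

Theorem corollary6p8 (R : realType) (s : nat) (s_gt0 : (0 < s)%N)
    (k : nat -> fieldType)
    (char_k : forall p : nat, prime p -> p \in [pchar (k p)]) :
  let D (p : nat) (t : 'rV[R]_s) (r : R) : R :=
    kernel_fun (k p) p (sum_vars s) t r in
  let Dinf (t : 'rV[R]_s) (r : R) : R :=
    kernel_fun_infty k (sum_vars s) t r in
  (forall (t : 'rV[R]_s) (r : R), cvg (D p t r @[p --> prime_infty])) /\
  (forall (t : 'rV[R]_s) (r : R),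
    [/\ forall p : nat, prime p -> right_derivable (D p t) r,
        right_derivable (Dinf t) r &
        right_derive (D p t) r @[p --> prime_infty]
          --> right_derive (Dinf t) r] /\
    [/\ forall p : nat, prime p -> left_derivable (D p t) r,
        left_derivable (Dinf t) r &
        left_derive (D p t) r @[p --> prime_infty]
          --> left_derive (Dinf t) r]).
Proof.
move=> D Dinf.
pose x (t : 'rV[R]_s) := map (@pos_part R) [seq t ord0 i | i <- enum 'I_s].
have sx t : (0 < size (x t))%N by rewrite /x size_map size_map -cardE card_ord.
have x0 t : nonnegs (x t) by exact: nonnegs_pos_part.
have DE p t : D p t = fun r => @kdensity R (k p) p (r :: x t).
  apply/funext => r; rewrite /D kernel_funE /kdensity; congr (lim (_ @ \oo)).
  apply/funext => e; rewrite /kratio /= ceils_pos_part.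
  by rewrite /x size_map size_map -cardE card_ord.
have cD t r : cvg (D p t r @[p --> prime_infty]).
  by under eq_fun do rewrite DE; exact: is_cvg_kdensity_any.
split=> // t r.
have lim_D z : D p t z @[p --> prime_infty] --> Dinf t z by exact: cD.
have [r1 [Gr rG]] := right_hypotheses char_k (sx t) (x0 t) r.
have [l1 [Gl lG]] := left_hypotheses char_k (sx t) (x0 t) r.
split; apply: (@derive_limit R _ _ (fun p => D p t) (Dinf t) r lim_D).
- by move=> p pp; rewrite DE; exact: r1.
- by exists Gr; apply: cvg_near_eq rG; apply: nearW => i; rewrite DE.
- by move=> p pp; rewrite DE; exact: l1.
- by exists Gl; apply: cvg_near_eq lG; apply: nearW => i; rewrite DE.
Qed.
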